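(* Let $\pi:E\to D$ be an ample holomorphic line bundle over a compact complex manifold $D$ of dimension $n-1\ge1$, and let $h$ be a Hermitian metric on $E$ whose curvature form is a Kähler form $\omega_D$ on $D$. Let $E'$ be the complement of the zero section, let $\omega_0=\sqrt{-1}\partial\overline\partial|S|^{-2}_{\pi^*h}$ on $E'$, and let $V=z\partial_z+\bar z\partial_{\bar z}$ (see the context). Put $\omega=\omega_0-\mathrm{Ric}(\omega_0)+\sqrt{-1}\partial\overline\partial u$. There is a unique asymptotic expansion $$u\sim\sum_{k>0}u_{(k)},\qquad\mathcal L_Vu_{(k)}=k\,u_{(k)},$$ so that $\omega$ formally satisfies the expanding soliton equation $$\mathrm{Ric}(\omega)+\tfrac12\mathcal L_V\omega=-\omega.$$
   Context: The curvature form of $h$ is $-\sqrt{-1}\partial\overline\partial\log|s|_h^2$ for a local nonvanishing holomorphic section $s$. $S$ is the canonical section of $\pi^*E$ over $E$, $S(e)=e\in(\pi^*E)_e\cong E_{\pi(e)}$; in a local holomorphic trivialization with coordinates $w=(w^1,\dots,w^{n-1})$ on $D$ and fiber coordinate $z$, $|S|^2_{\pi^*h}=h(w)z\bar z$. The vector field $V=z\partial_z+\bar z\partial_{\bar z}$ is globally defined on $E'$ (generator of fiberwise rescaling). $\mathrm{Ric}(\omega)=-\sqrt{-1}\partial\overline\partial\log\det(g_{i\bar j})$ is the Ricci form. One has $\mathcal L_V\omega_0=-2\omega_0$ and $\mathcal L_V\mathrm{Ric}(\omega_0)=0$. The index $k$ runs over positive integers and the $u_{(k)}$ are smooth functions on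 $E'$. ''Formally satisfies'' means that the equation holds as an identity of formal series graded by $\mathcal L_V$-weight (weight component by weight component), where $\mathrm{Ric}(\omega)=\mathrm{Ric}(\omega_0)-\sqrt{-1}\partial\overline\partial\,\mathrm{Tr}\log\big(I-\omega_0^{-1}\mathrm{Ric}(\omega_0)+\sqrt{-1}\,\omega_0^{-1}\partial\overline\partial\sum_ku_{(k)}\big)$ is expanded in weights; $\omega_0^{-1}\mathrm{Ric}(\omega_0)$ has weight $2$ and $\omega_0^{-1}\partial\overline\partial u_{(k)}$ has weight $k+2$. *)

(* Defs.v *)
From HB Require Import structures.
From mathcomp Require Import all_boot all_order all_algebra.
From mathcomp Require Import all_classical all_reals all_analysis.
From mathcomp Require Import complex.
Set Implicit Arguments.
Unset Strict Implicit.
Unset Printing Implicit Defensive.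
Import Order.TTheory GRing.Theory Num.Theory.
Import numFieldNormedType.Exports.
Local Open Scope classical_set_scope.
Local Open Scope ring_scope.
Local Open Scope complex_scope.

(** * Calculus on open subsets of C^n *)

(* C^n as a real normed space: the pair (x, y) stands for x + i y. *)
Definition Cn (R : realType) (n : nat) : normedModType R :=
  ('rV[R]_n * 'rV[R]_n)%type.

Definition ccoord (R : realType) (n : nat) (p : Cn R n) (k : 'I_n) : R[i] :=
  p.1 0 k +i* p.2 0 k.

Fixpoint Ck (R : realType) (V : normedModType R) (k : nat) (U : set V)
    (f : V -> R) : Prop :=
  (forall x, U x -> {for x, continuous f}) /\
  match k with
  | 0%N => True
  | k'.+1 => forall v : V,
      (forall x, U x -> derivable f x v) /\ Ck k' U (fun x => 'D_v f x)
  end.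

(* C^oo on U; meant for open U. *)
Definition smooth (R : realType) (V : normedModType R) (U : set V)
    (f : V -> R) : Prop :=
  forall k, Ck k U f.

Definition csmooth (R : realType) (V : normedModType R) (U : set V)
    (F : V -> R[i]) : Prop :=
  smooth U (fun x => complex.Re (F x)) /\ smooth U (fun x => complex.Im (F x)).

(* Real directional derivative of a complex-valued function. *)
Definition cderive (R : realType) (V : normedModType R) (F : V -> R[i])
    (v : V) (x : V) : R[i] :=
  'D_v (fun y => complex.Re (F y)) x +i* 'D_v (fun y => complex.Im (F y)) x.

Definition dirRe (R : realType) (n : nat) (k : 'I_n) : Cn R n :=
  (delta_mx 0 k, 0).
Definition dirIm (R : realType) (n : nat) (k : 'I_n) : Cn R n :=
  (0, delta_mx 0 k).

(* d/dz^k = (d/dx^k - i d/dy^k)/2 and d/dzbar^k = (d/dx^k + i d/dy^k)/2 *)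
Definition del (R : realType) (n : nat) (k : 'I_n) (F : Cn R n -> R[i])
    (p : Cn R n) : R[i] :=
  2^-1 * (cderive F (dirRe R k) p - 'i * cderive F (dirIm R k) p).
Definition delbar (R : realType) (n : nat) (k : 'I_n) (F : Cn R n -> R[i])
    (p : Cn R n) : R[i] :=
  2^-1 * (cderive F (dirRe R k) p + 'i * cderive F (dirIm R k) p).

Definition holomorphic (R : realType) (n : nat) (U : set (Cn R n))
    (F : Cn R n -> R[i]) : Prop :=
  csmooth U F /\ forall p, U p -> forall k, delbar k F p = 0.

(** * (1,1)-forms in coordinates *)

(* The (1,1)-form  i G_{a bbar} dz^a /\ dzbar^b  is represented by its
   coefficient matrix G; thus [ddbar F] represents  i del delbar F. *)
Definition ddbar (R : realType) (n : nat) (F : Cn R n -> R[i])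
    (p : Cn R n) : 'M[R[i]]_n :=
  \matrix_(a, b) del a (delbar b F) p.

Definition ddbarR (R : realType) (n : nat) (f : Cn R n -> R) :
    Cn R n -> 'M[R[i]]_n :=
  ddbar (fun p => (f p)%:C).

(* Ric = - i del delbar log det g; det g is real for a Hermitian g. *)
Definition ric (R : realType) (n : nat) (G : Cn R n -> 'M[R[i]]_n) :
    Cn R n -> 'M[R[i]]_n :=
  fun p => - ddbarR (fun q => ln (complex.Re (\det (G q)))) p.

(* Smooth, Hermitian, positive definite and d-closed. *)
Definition kahler_on (R : realType) (n : nat) (U : set (Cn R n))
    (G : Cn R n -> 'M[R[i]]_n) : Prop :=
  [/\ forall a b, csmooth U (fun p => G p a b),
      forall p, U p -> forall a b, G p b a = conjc (G p a b),
      forall p, U p -> forall v : 'rV[R[i]]_n, v != 0 ->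
        0 < \sum_a \sum_b G p a b * v 0 a * conjc (v 0 b),
      forall p, U p -> forall a b c,
        del c (fun q => G q a b) p = del a (fun q => G q c b) p
    & forall p, U p -> forall a b c,
        delbar c (fun q => G q a b) p = delbar b (fun q => G q a c) p].

(* Lie derivatives along the real vector field X + Xbar, where X is the
   holomorphic field sum_k X^k d/dz^k. *)
Definition lieF (R : realType) (n : nat) (X : Cn R n -> 'rV[R[i]]_n)
    (F : Cn R n -> R[i]) (p : Cn R n) : R[i] :=
  \sum_k (X p 0 k * del k F p + conjc (X p 0 k) * delbar k F p).

(* Uses L dz^k = dX^k = sum_a (dX^k/dz^a) dz^a. *)
Definition lie11 (R : realType) (n : nat) (X : Cn R n -> 'rV[R[i]]_n)
    (G : Cn R n -> 'M[R[i]]_n) (p : Cn R n) : 'M[R[i]]_n :=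
  \matrix_(a, b)
    (lieF X (fun q => G q a b) p
     + \sum_k del a (fun q => X q 0 k) p * G p k b
     + \sum_k conjc (del b (fun q => X q 0 k) p) * G p a k).

(** * Complex manifolds and holomorphic line bundles *)

Record complexManifold (R : realType) (d : nat) := ComplexManifold {
  cm_space :> topologicalType;
  cm_idx : Type;
  cm_dom : cm_idx -> set cm_space;
  cm_chart : cm_idx -> cm_space -> Cn R d;
  cm_inv : cm_idx -> Cn R d -> cm_space;
  cm_hausdorff : hausdorff_space cm_space;
  cm_second_countable : @second_countable cm_space;
  cm_dom_open : forall i, open (cm_dom i);
  cm_cover : forall x, exists i, cm_dom i x;
  cm_chart_open : forall i, open (cm_chart i @` cm_dom i);
  cm_chartK : forall i x, cm_dom i x -> cm_inv i (cm_chart i x) = x;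
  cm_chart_cont : forall i x, cm_dom i x -> {for x, continuous (cm_chart i)};
  cm_inv_cont : forall i p, (cm_chart i @` cm_dom i) p ->
    {for p, continuous (cm_inv i)};
  cm_trans_holo : forall i j k,
    holomorphic (cm_chart i @` (cm_dom i `&` cm_dom j))
      (fun p => ccoord (cm_chart j (cm_inv i p)) k)
}.

Definition holomorphic_on (R : realType) (d : nat) (D : complexManifold R d)
    (W : set D) (f : D -> R[i]) : Prop :=
  forall i, holomorphic (cm_chart i @` (cm_dom i `&` W))
    (fun p => f (cm_inv i p)).

(* The total space carries local trivializations
     e |-> (lb_proj e, lb_fib j e),  lb_proj^-1 (lb_dom j) -> lb_dom j x C,
   with inverses [lb_inv j], and transition functions [lb_trans j k] (which are
   nowhere zero by bijectivity).  Its vector space, topological and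
   holomorphic structures are the ones transported by these. *)
Record lineBundle (R : realType) (d : nat) (D : complexManifold R d) :=
    LineBundle {
  lb_total :> Type;
  lb_proj : lb_total -> D;
  lb_idx : Type;
  lb_dom : lb_idx -> set D;
  lb_fib : lb_idx -> lb_total -> R[i];
  lb_inv : lb_idx -> D -> R[i] -> lb_total;
  lb_trans : lb_idx -> lb_idx -> D -> R[i];
  lb_dom_open : forall j, open (lb_dom j);
  lb_cover : forall x, exists j, lb_dom j x;
  lb_fibK : forall j e, lb_dom j (lb_proj e) ->
    lb_inv j (lb_proj e) (lb_fib j e) = e;
  lb_proj_inv : forall j x z, lb_dom j x -> lb_proj (lb_inv j x z) = x;
  lb_fib_inv : forall j x z, lb_dom j x -> lb_fib j (lb_inv j x z) = z;
  lb_trans_holo : forall j k,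
    holomorphic_on (lb_dom j `&` lb_dom k) (lb_trans j k);
  lb_transE : forall j k e,
    lb_dom j (lb_proj e) -> lb_dom k (lb_proj e) ->
    lb_fib k e = lb_trans j k (lb_proj e) * lb_fib j e
}.

Definition lb_frame (R : realType) (d : nat) (D : complexManifold R d)
    (E : lineBundle D) (j : lb_idx E) (x : D) : E :=
  lb_inv j x 1.

(* Image in C^d of the part of the i-th chart of D over which the j-th
   trivialization is defined. *)
Definition base_dom (R : realType) (d : nat) (D : complexManifold R d)
    (E : lineBundle D) (i : cm_idx D) (j : lb_idx E) : set (Cn R d) :=
  cm_chart i @` (cm_dom i `&` lb_dom j).

(* Global holomorphic sections of the m-th tensor power of E, given by their
   components in the local frames. *)
Definition power_section (R : realType) (d : nat) (D : complexManifold R d)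
    (E : lineBundle D) (m : nat) (s : lb_idx E -> D -> R[i]) : Prop :=
  (forall j, holomorphic_on (lb_dom j) (s j)) /\
  (forall j k x, lb_dom j x -> lb_dom k x ->
     s k x = lb_trans j k x ^+ m * s j x).

(* Some positive power of E has sections s_0, ..., s_N without common zero such
   that [s_0 : ... : s_N] : D -> P^N is injective with injective differential
   (v is in the kernel of the differential of [s] iff ds(v) is proportional
   to s). *)
Definition ample (R : realType) (d : nat) (D : complexManifold R d)
    (E : lineBundle D) : Prop :=
  exists (m N : nat) (s : 'I_N.+1 -> lb_idx E -> D -> R[i]),
  (0 < m)%N /\
  [/\ forall a, power_section m (s a),
      forall j x, lb_dom j x -> exists a, s a j x != 0,
      forall j k x y (c : R[i]), lb_dom j x -> lb_dom k y ->
        (forall a, s a j x = c * s a k y) -> x = y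
    & forall (i : cm_idx D) (j : lb_idx E) p, base_dom i j p ->
        forall (v : 'rV[R[i]]_d) (c : R[i]),
        (forall a, \sum_b v 0 b * del b (fun q => s a j (cm_inv i q)) p
                   = c * s a j (cm_inv i p)) ->
        v = 0].

(* A Hermitian metric is given by its squared norm e |-> |e|_h^2. *)
Record hermitianMetric (R : realType) (d : nat) (D : complexManifold R d)
    (E : lineBundle D) := HermitianMetric {
  hm_sq :> E -> R;
  hm_sqE : forall j e, lb_dom j (lb_proj e) ->
    hm_sq e = hm_sq (lb_frame j (lb_proj e)) *
              (complex.Re (lb_fib j e) ^+ 2 + complex.Im (lb_fib j e) ^+ 2);
  hm_pos : forall (j : lb_idx E) x, lb_dom j x -> 0 < hm_sq (lb_frame j x);
  hm_smooth : forall (i : cm_idx D) (j : lb_idx E),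
    smooth (base_dom i j) (fun p => hm_sq (lb_frame j (cm_inv i p)))
}.

Definition curvature (R : realType) (d : nat) (D : complexManifold R d)
    (E : lineBundle D) (h : hermitianMetric E) (i : cm_idx D) (j : lb_idx E) :
    Cn R d -> 'M[R[i]]_d :=
  fun p => - ddbarR (fun q => ln (h (lb_frame j (cm_inv i q)))) p.

Definition kahler_curvature (R : realType) (d : nat) (D : complexManifold R d)
    (E : lineBundle D) (h : hermitianMetric E) : Prop :=
  forall i j, kahler_on (base_dom i j) (curvature h i j).

(** * The complement E' of the zero section *)

Definition off_zero (R : realType) (d : nat) (D : complexManifold R d)
    (E : lineBundle D) : set E :=
  [set e | forall j, lb_dom j (lb_proj e) -> lb_fib j e != 0].

(* Coordinates (w, z) in C^d x C = C^(d + 1); the last one is the fiber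
   coordinate z. *)
Definition wpart (R : realType) (d : nat) (p : Cn R (d + 1)) : Cn R d :=
  (lsubmx p.1, lsubmx p.2).
Definition zpart (R : realType) (d : nat) (p : Cn R (d + 1)) : R[i] :=
  ccoord p (rshift d ord0).

Definition total_dom (R : realType) (d : nat) (D : complexManifold R d)
    (E : lineBundle D) (i : cm_idx D) (j : lb_idx E) : set (Cn R (d + 1)) :=
  [set p | base_dom i j (wpart p) /\ zpart p != 0].

(* The point of E' with coordinates p = (w, z). *)
Definition total_inv (R : realType) (d : nat) (D : complexManifold R d)
    (E : lineBundle D) (i : cm_idx D) (j : lb_idx E) (p : Cn R (d + 1)) : E :=
  lb_inv j (cm_inv i (wpart p)) (zpart p).

(* A function on E' is a function on E whose values on the zero section are
   ignored. *)
Definition smooth_off_zero (R : realType) (d : nat) (D : complexManifold R d)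
    (E : lineBundle D) (f : E -> R) : Prop :=
  forall (i : cm_idx D) (j : lb_idx E),
    smooth (total_dom i j) (fun p => f (total_inv i j p)).

(* The holomorphic part z d/dz of V = z d/dz + zbar d/dzbar. *)
Definition euler (R : realType) (d : nat) (p : Cn R (d + 1)) :
    'rV[R[i]]_(d + 1) :=
  row_mx 0 (zpart p)%:M.

Definition has_weight (R : realType) (d : nat) (D : complexManifold R d)
    (E : lineBundle D) (k : nat) (f : E -> R) : Prop :=
  forall (i : cm_idx D) (j : lb_idx E) p, total_dom i j p ->
    lieF (@euler R d) (fun q => (f (total_inv i j q))%:C) p
    = k%:R * (f (total_inv i j p))%:C.

(** * Formal series graded by weight *)

(* Weight m component of the p-th power of the formal series sum_m A_m. *)
Fixpoint series_pow (K : pzRingType) (n : nat) (A : nat -> 'M[K]_n)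
    (p m : nat) : 'M[K]_n :=
  match p with
  | 0%N => if m == 0%N then 1%:M else 0
  | p'.+1 => \sum_(l < m.+1) A l *m series_pow A p' (m - l)
  end.

(* Weight m component of Tr log (I + A) = sum_p (-1)^(p+1)/p Tr A^p; when
   A_0 = 0 the terms with p > m do not contribute to weight m. *)
Definition trlog_comp (K : fieldType) (n : nat) (A : nat -> 'M[K]_n)
    (m : nat) : K :=
  \sum_(1 <= p < m.+1) (-1) ^+ p.+1 / p%:R * \tr (series_pow A p m).

(* In the four definitions below, f0 and u k are the coordinate expressions of
   |S|^-2 and u_(k), the latter being used for k > 0 only. *)

(* Weight components of
     - omega_0^-1 Ric(omega_0) + i omega_0^-1 del delbar sum_k u_(k). *)
Definition pert_comp (R : realType) (n : nat) (f0 : Cn R n -> R)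
    (u : nat -> Cn R n -> R) (p : Cn R n) (m : nat) : 'M[R[i]]_n :=
  let g0 := ddbarR f0 in
  match m with
  | 0%N | 1%N => 0
  | 2%N => - (invmx (g0 p) *m ric g0 p)
  | k.+3 => invmx (g0 p) *m ddbarR (u k.+1) p
  end.

(* Weight components of omega = omega_0 - Ric(omega_0) + i del delbar u; note
   that Negz 1 = -2. *)
Definition omega_comp (R : realType) (n : nat) (f0 : Cn R n -> R)
    (u : nat -> Cn R n -> R) (m : int) : Cn R n -> 'M[R[i]]_n :=
  let g0 := ddbarR f0 in
  match m with
  | Negz 1 => g0
  | Negz _ => fun=> 0
  | Posz 0 => fun p => - ric g0 p
  | Posz k.+1 => ddbarR (u k.+1)
  end.

(* Weight components of
     Ric(omega) = Ric(omega_0) - i del delbar Tr log (I + pert). *)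
Definition ric_comp (R : realType) (n : nat) (f0 : Cn R n -> R)
    (u : nat -> Cn R n -> R) (m : int) : Cn R n -> 'M[R[i]]_n :=
  match m with
  | Negz _ => fun=> 0
  | Posz 0 => ric (ddbarR f0)
  | Posz k.+1 => fun p => - ddbar (fun q => trlog_comp (pert_comp f0 u q) k.+1) p
  end.

(* Ric(omega) + (1/2) L_{X + Xbar} omega = - omega, in each weight. *)
Definition formal_soliton_at (R : realType) (n : nat)
    (X : Cn R n -> 'rV[R[i]]_n) (f0 : Cn R n -> R) (u : nat -> Cn R n -> R)
    (p : Cn R n) : Prop :=
  forall m : int,
    ric_comp f0 u m p + 2^-1 *: lie11 X (omega_comp f0 u m) p
    = - omega_comp f0 u m p.

Definition formal_soliton (R : realType) (d : nat) (D : complexManifold R d)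
    (E : lineBundle D) (h : hermitianMetric E) (u : nat -> E -> R) : Prop :=
  forall (i : cm_idx D) (j : lb_idx E) p, total_dom i j p ->
    formal_soliton_at (@euler R d)
      (fun q => (h (total_inv i j q))^-1)
      (fun k q => u k (total_inv i j q)) p.

Definition soliton_expansion (R : realType) (d : nat)
    (D : complexManifold R d) (E : lineBundle D) (h : hermitianMetric E)
    (u : nat -> E -> R) : Prop :=
  [/\ forall k, (0 < k)%N -> smooth_off_zero (u k),
      forall k, (0 < k)%N -> has_weight k (u k)
    & formal_soliton h u].

(* Main.v *)
Require Import Defs.
From HB Require Import structures.
From mathcomp Require Import all_boot all_order all_algebra.
From mathcomp Require Import all_classical all_reals all_analysis.
From mathcomp Require Import complex ring lra spectral perm.
Set Implicit Arguments.
Unset Strict Implicit.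
Unset Printing Implicit Defensive.
Import Order.TTheory GRing.Theory Num.Theory.
Import numFieldNormedType.Exports.
Local Open Scope classical_set_scope.
Local Open Scope ring_scope.
Local Open Scope complex_scope.

(* Both sides of the equation are graded by weight.  Weights -2 and 0 hold
   identically; in weight k > 0 the equation reads
     i del delbar T_k = (1 + k/2) i del delbar u_(k),
   where T_k, the weight k part of Tr log, only involves u_(l) with l + 2 <= k.

   Existence: take u_(k) = 2/(k + 2) T_k recursively.  T_k is natural under
   holomorphic maps pulling omega_0 back to a multiple of itself.  For changes of
   charts this makes u_(k) globally defined, for fiberwise dilations it gives its
   weight.

   Uniqueness: the difference f of two solutions in the first weight k where they
   differ is pluriharmonic and homogeneous of degree k along the fibers.  Then
   f^2 |S|^-2k is invariant under dilations, so it attains its maximum since D is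
   compact.  Where f <> 0, the complex Hessian of its logarithm is
   -2 f^-2 del f delbar f + k pi^* omega_D, which is positive on the vectors in the
   kernel of del f that are not vertical.  These exist: as V f = k f <> 0, every
   base vector lifts to the kernel of del f. *)

(** * Directional derivatives and smooth functions *)

(** [Ck] provides only iterated directional derivatives, so linearity in the direction, symmetry of
    second derivatives and the chain rule have to be established; all three rest on the mean value
    theorem along segments. Existence requires no elliptic equation: the factor 1 + k/2 never
    vanishes, so each weight is solved at the level of potentials. T_k is real because the matrices
    G^-1 H_l, with G and H_l Hermitian, are simultaneously conjugate by G to their adjoints. Ric is
    natural because log det g changes by a constant plus log |det J|^2, J being the Jacobian, and
    the latter is pluriharmonic. For uniqueness, |S|^-2 has weight -2, whence the exponent k in f^2
    |S|^-2k, and the square keeps the logarithm meaningful for either sign of f. E' is not compact;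
    bounds come from the slice |z| = 1 over polydiscs, which every dilation orbit meets, and
    compactness of D makes them global. The non-vertical vector exists because D has positive
    dimension. *)

Section Directional.
Variables (R : realType) (V : normedModType R).
Implicit Types (f g : V -> R) (x u v : V) (U : set V).

Lemma growth_line f x v t :
  (fun h : R => h^-1 *: (((fun s : R => f (x + s *: v)) \o shift t) (h *: 1) -
     f (x + t *: v))) =
  (fun h : R => h^-1 *: ((f \o shift (x + t *: v)) (h *: v) - f (x + t *: v))).
Proof.
apply/funext => h /=; rewrite [h *: 1]mulr1 scalerDl addrCA addrA.
by rewrite (addrC x) -addrA.
Qed.

Lemma is_derive_line f x v t : derivable f (x + t *: v) v ->
  is_derive t 1 (fun s => f (x + s *: v)) ('D_v f (x + t *: v)).
Proof.
move=> df; split; first by rewrite /derivable growth_line.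
by rewrite /derive growth_line.
Qed.

Lemma is_derive_lineP f x v (d : R) :
  is_derive x v f d <-> is_derive (0 : R) 1 (fun s => f (x + s *: v)) d.
Proof.
have G := growth_line f x v 0.
have x0 : x + 0 *: v = x by rewrite scale0r addr0.
split=> -[df <-]; split.
- by rewrite /derivable G x0.
- by rewrite /derive G x0.
- by rewrite /derivable G x0 in df.
- by rewrite /derive G x0.
Qed.

Lemma derive_cvg f x v : derivable f x v ->
  (fun h : R => h^-1 * (f (h *: v + x) - f x)) @ 0^' --> 'D_v f x.
Proof. by []. Qed.

Lemma is_derive_scale f x v (c : R) :
  derivable f x v -> is_derive x (c *: v) f (c * 'D_v f x).
Proof.
move=> /derivableP /is_derive_lineP df; apply/is_derive_lineP.
have -> : (fun s => f (x + s *: (c *: v))) =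
  (fun s => f (x + s *: v)) \o ( *%R c).
  by apply/funext => s /=; rewrite scalerA (mulrC c).
rewrite mulrC; apply: is_derive1_comp; first by rewrite mulr0.
have := @is_deriveZ R R R id c 0 1 1 (is_derive_id _ _).
by rewrite [c *: 1]mulr1.
Qed.

Lemma derive_scale f x v (c : R) :
  derivable f x v -> 'D_(c *: v) f x = c * 'D_v f x.
Proof. by move=> /(is_derive_scale c)[]. Qed.

Lemma derivable_scale f x v (c : R) :
  derivable f x v -> derivable f x (c *: v).
Proof. by move=> /(is_derive_scale c)[]. Qed.

Lemma dir_MVT f x v :
  (forall t : R, 0 <= t <= 1 -> derivable f (x + t *: v) v) ->
  exists2 c : R, 0 <= c <= 1 & f (x + v) - f x = 'D_v f (x + c *: v).
Proof.
move=> df.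
have [|||c] := @MVT_segment R (fun s => f (x + s *: v))
  (fun s => 'D_v f (x + s *: v)) 0 1.
- by [].
- move=> t /itvP t01; apply: is_derive_line; apply: df.
  by rewrite !t01.
- apply: derivable_within_continuous => t /itvP t01.
  have [] // := @is_derive_line f x v t; apply: df.
  by rewrite !t01.
move=> /itvP c01; rewrite scale1r scale0r addr0 subr0 mulr1 => ?.
by exists c => //; rewrite !c01.
Qed.

Lemma scale_dir_MVT f x v (h : R) :
  (forall t : R, 0 <= t <= 1 -> derivable f (x + (t * h) *: v) v) ->
  exists2 c : R, 0 <= c <= 1 &
    f (x + h *: v) - f x = h * 'D_v f (x + (c * h) *: v).
Proof.
move=> df; have [|c c01 ->] := @dir_MVT f x (h *: v).
  by move=> t t01; rewrite scalerA; apply: derivable_scale; apply: df.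
by exists c => //; rewrite scalerA derive_scale//; apply: df.
Qed.

Lemma open_ballP U x : open U -> U x ->
  exists2 e : R, 0 < e & forall y, `|y - x| < e -> U y.
Proof.
move=> oU Ux; have /nbhs_ballP[e /= e0 eU] := open_nbhs_nbhs (conj oU Ux).
by exists e => // y yx; apply: eU; rewrite -ball_normE /= distrC.
Qed.

Lemma ler_norm_comb2 (a b s : R) u v : `|a| <= s -> `|b| <= s ->
  `|a *: u + b *: v| <= s * (`|u| + `|v|).
Proof.
move=> ha hb; apply: le_trans (ler_normD _ _) _.
by rewrite !normrZ mulrDr lerD// ler_wpM2r.
Qed.

Lemma norm_frac_le (c h : R) : 0 <= c <= 1 -> `|c * h| <= `|h|.
Proof.
by move=> /andP[c0 c1]; rewrite normrM (ger0_norm c0) ler_piMl.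
Qed.

(** The increment is split at x + h u. By the mean value theorem its second half is h times 'D_v f
    at a nearby point, so only 'D_v f has to be continuous at x. *)
Lemma is_derive_dirD f U x u v : open U -> U x ->
  (forall y, U y -> derivable f y v) -> derivable f x u ->
  {for x, continuous (fun y => 'D_v f y)} ->
  is_derive x (u + v) f ('D_u f x + 'D_v f x).
Proof.
move=> oU Ux dv du cv.
suff H : (fun h : R => h^-1 *: ((f \o shift x) (h *: (u + v)) - f x)) @ 0^'
   --> 'D_u f x + 'D_v f x.
  split; first by apply/cvg_ex; exists ('D_u f x + 'D_v f x).
  exact/cvg_lim.
have -> : (fun h : R => h^-1 *: ((f \o shift x) (h *: (u + v)) - f x)) =
  (fun h : R => h^-1 *: ((f \o shift x) (h *: u) - f x)) \+
  (fun h : R => h^-1 *: (f (x + h *: u + h *: v) - f (x + h *: u))).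
  apply/funext => h /=; rewrite -scalerDr; congr (_ *: _).
  by rewrite scalerDr (addrC (h *: u + _) x) addrA (addrC (h *: u) x); ring.
apply: cvgD; first exact: du.
apply/cvgrPdist_lt => e e0.
have /cvgrPdist_lt /(_ _ e0) /nbhs_ballP[r /= r0 rB] := cv.
have [s s0 sU] := open_ballP oU Ux.
pose m := Num.min r s.
have m0 : 0 < m by rewrite lt_min r0 s0.
pose C := `|u| + `|v| + 1.
have C0 : 0 < C by rewrite ltr_wpDl.
have near_small : \forall h \near (0:R), `|h| < m / C.
  by apply: nbhs0_lt; rewrite divr_gt0.
near=> h.
have h0 : h != 0 by near: h; exact: nbhs_dnbhs_neq.
have hm : `|h| < m / C by near: h; apply: nbhs_dnbhs.
have small (a b : R) : `|a| <= `|h| -> `|b| <= `|h| ->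
    `|(x + a *: u + b *: v) - x| < m.
  move=> ha hb; rewrite -(addrA x) (addrC x) addrK.
  apply: le_lt_trans (ler_norm_comb2 _ _ ha hb) _.
  rewrite ltr_pdivlMr // in hm; apply: le_lt_trans hm.
  by rewrite ler_wpM2l// lerDl.
have [|c c01 ->] := @scale_dir_MVT f (x + h *: u) v h.
  move=> t t01; apply: dv; apply: sU.
  apply: lt_le_trans (small h (t * h) _ _) _ => //; last by rewrite ge_min lexx orbT.
  exact: norm_frac_le.
rewrite [_ *: _]mulrA mulVf// mul1r; apply: rB.
rewrite -ball_normE /= distrC.
apply: lt_le_trans (small h (c * h) _ _) _ => //; last by rewrite ge_min lexx.
exact: norm_frac_le.
Unshelve. all: by end_near. Qed.

(** Mean value theorem twice: for y |-> f (y + s v) - f y along u, then for 'D_u f along v. The case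
    u = v also serves in the second derivative test. *)
Lemma mixed_difference f x u v (s : R) : 0 < s ->
  (forall a b : R, `|a| <= s -> `|b| <= s ->
     derivable f (x + a *: u + b *: v) u /\
     derivable (fun y => 'D_u f y) (x + a *: u + b *: v) v) ->
  exists a b : R, [/\ `|a| <= s, `|b| <= s &
    f (x + s *: u + s *: v) - f (x + s *: u) - f (x + s *: v) + f x
    = s * s * 'D_v (fun y => 'D_u f y) (x + a *: u + b *: v)].
Proof.
move=> s0 H.
have ns : `|s| = s by rewrite gtr0_norm.
have s_le : `|s| <= s by rewrite ns.
have z_le : `|0 : R| <= s by rewrite normr0 ltW.
have dshift (y : V) : derivable f (y + s *: v) u ->
    is_derive y u (fun y => f (y + s *: v)) ('D_u f (y + s *: v)).
  move=> /derivableP/is_derive_lineP d; apply/is_derive_lineP.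
  by under eq_fun do rewrite addrAC.
pose G := (fun y => f (y + s *: v)) \- f.
have dG (a : R) : `|a| <= s -> is_derive (x + a *: u) u G
    ('D_u f (x + a *: u + s *: v) - 'D_u f (x + a *: u)).
  move=> as_; apply: is_deriveB; first exact/dshift/(H a s as_ s_le).1.
  by apply: derivableP; have [+ _] := H a 0 as_ z_le; rewrite scale0r addr0.
have fs (t : R) : 0 <= t <= 1 -> `|t * s| <= s.
  by move=> t01; rewrite -[leRHS]ns norm_frac_le.
have [|c c01 EG] := @scale_dir_MVT G x u s.
  by move=> t t01; have [] := dG (t * s) (fs _ t01).
rewrite (@derive_val _ _ _ _ _ _ _ (dG _ (fs _ c01))) in EG.
have [|c' c01' E'] := @scale_dir_MVT (fun y => 'D_u f y) (x + (c * s) *: u) v s.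
  by move=> t t01; exact: (H _ _ (fs _ c01) (fs _ t01)).2.
exists (c * s), (c' * s); split; [exact: fs|exact: fs|].
rewrite -mulrA -E' -EG /G /=; ring.
Qed.

(** The second difference is symmetric in u and v, so both mixed derivatives take a common value at
    points arbitrarily close to x; continuity carries the equality to x. *)
Lemma derive_comm f U x u v : open U -> U x ->
  (forall y, U y -> [/\ derivable f y u, derivable f y v,
     derivable (fun y => 'D_u f y) y v & derivable (fun y => 'D_v f y) y u]) ->
  {for x, continuous (fun y => 'D_v (fun y => 'D_u f y) y)} ->
  {for x, continuous (fun y => 'D_u (fun y => 'D_v f y) y)} ->
  'D_v (fun y => 'D_u f y) x = 'D_u (fun y => 'D_v f y) x.
Proof.
move=> oU Ux dU c1 c2; apply/eqP; rewrite -subr_eq0 -normr_le0.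
apply/ler_addgt0Pl => e e0; rewrite addr0.
have e20 : 0 < e / 2 by rewrite divr_gt0.
have /cvgrPdist_lt /(_ _ e20) /nbhs_ballP[r1 /= r10 rB1] := c1.
have /cvgrPdist_lt /(_ _ e20) /nbhs_ballP[r2 /= r20 rB2] := c2.
have [r3 r30 rU] := open_ballP oU Ux.
pose m := Num.min (Num.min r1 r2) r3.
have m0 : 0 < m by rewrite !lt_min r10 r20 r30.
pose C := `|u| + `|v| + 1.
have C0 : 0 < C by rewrite ltr_wpDl.
(* The intermediate points satisfy only |a|, |b| <= s; halving makes the distance to x strictly less
   than m. *)
pose s := m / C / 2.
have s0 : 0 < s by rewrite !divr_gt0.
have small (a b : R) : `|a| <= s -> `|b| <= s ->
    `|(x + a *: u + b *: v) - x| < m.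
  move=> ha hb; rewrite -(addrA x) (addrC x) addrK.
  apply: le_lt_trans (ler_norm_comb2 _ _ ha hb) _.
  apply: (@le_lt_trans _ _ (s * C)); first by rewrite ler_wpM2l ?lerDl// ltW.
  have -> : s * C = m / 2 by rewrite /s; field; rewrite gt_eqF.
  by rewrite ltr_pdivrMr// ltr_pMr// ltr1n.
have sU (a b : R) : `|a| <= s -> `|b| <= s -> U (x + a *: u + b *: v).
  by move=> ha hb; apply/rU/(lt_le_trans (small _ _ ha hb)); rewrite ge_min lexx orbT.
have [|a [b [ha hb E1]]] := @mixed_difference f x u v s s0.
  by move=> a b ha hb; have [] := dU _ (sU a b ha hb).
have [|b' [a' [hb' ha' E2]]] := @mixed_difference f x v u s s0.
  move=> b' a' hb' ha'; have := sU a' b' ha' hb'; rewrite (addrAC x).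
  by move=> /dU[].
have E : 'D_v (fun y => 'D_u f y) (x + a *: u + b *: v) =
         'D_u (fun y => 'D_v f y) (x + a' *: u + b' *: v).
  rewrite (addrAC x (s *: v)) in E2; rewrite (addrAC x (a' *: u)).
  apply: (@mulfI _ (s * s)); first by rewrite mulf_neq0 ?gt_eqF.
  apply: etrans (esym E1) _; apply: etrans _ E2.
  by rewrite (addrAC (f _) (- f (x + s *: u))).
have K1 := rB1 (x + a *: u + b *: v); have K2 := rB2 (x + a' *: u + b' *: v).
rewrite -[X in X <= _]normrN opprB.
have {}K1 : `|'D_v (fun y => 'D_u f y) x - 'D_v (fun y => 'D_u f y) (x + a *: u + b *: v)| < e / 2.
  apply: K1; rewrite -ball_normE /= distrC; apply: lt_le_trans (small _ _ ha hb) _.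
  by rewrite !ge_min lexx.
have {}K2 : `|'D_u (fun y => 'D_v f y) x -
    'D_u (fun y => 'D_v f y) (x + a' *: u + b' *: v)| < e / 2.
  apply: K2; rewrite -ball_normE /= distrC; apply: lt_le_trans (small _ _ ha' hb') _.
  by rewrite !ge_min lexx orbT.
rewrite [e]splitr; apply: ltW; apply: le_lt_trans (ltrD K2 K1).
rewrite E -[X in _ <= _ + X]normrN opprB; apply: le_trans (ler_normD _ _).
by rewrite subrKA.
Qed.

End Directional.

(** * Algebra of C^k and smooth functions *)

Section Smooth.
Variables (R : realType) (V : normedModType R).
Implicit Types (f g : V -> R) (x u v : V) (U : set V).

Lemma Ck_cont k U f x : Ck k U f -> U x -> {for x, continuous f}.
Proof. by case: k => [|k] [cf _] Ux; exact: cf. Qed.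

Lemma Ck_derivable k U f x v : Ck k.+1 U f -> U x -> derivable f x v.
Proof. by move=> [_ /(_ v)[+ _]]; apply. Qed.

Lemma Ck_derive k U f v : Ck k.+1 U f -> Ck k U (fun x => 'D_v f x).
Proof. by move=> [_ /(_ v)[]]. Qed.

Lemma open_near U x (P : V -> Prop) : open U -> U x -> (forall y, U y -> P y) ->
  \near x, P x.
Proof.
by move=> oU Ux UP; apply: filterS (open_nbhs_nbhs (conj oU Ux)).
Qed.

Lemma continuous_at_eq U f g x : open U -> U x -> (forall y, U y -> f y = g y) ->
  {for x, continuous f} -> {for x, continuous g}.
Proof.
move=> oU Ux fg cf; rewrite /prop_for /continuous_at -(fg x Ux).
apply: cvg_trans cf; apply: near_eq_cvg.
exact: open_near oU Ux (fun y Uy => fg y Uy).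
Qed.

Lemma derive_eq_on U f g x v : open U -> U x -> (forall y, U y -> f y = g y) ->
  'D_v f x = 'D_v g x.
Proof.
move=> oU Ux fg; apply: near_eq_derive.
exact: open_near oU Ux (fun y Uy => fg y Uy).
Qed.

Lemma Ck_eq k U f g : open U -> (forall y, U y -> f y = g y) ->
  Ck k U f -> Ck k U g.
Proof.
move=> oU; elim: k f g => [|k IH] f g fg.
  by move=> [cf _]; split=> // x Ux; exact: continuous_at_eq oU Ux fg (cf _ Ux).
move=> [cf df]; split=> [x Ux|v]; first exact: continuous_at_eq oU Ux fg (cf _ Ux).
have [dv Cv] := df v; split=> [x Ux|].
  apply: near_eq_derivable (dv x Ux).
  exact: open_near oU Ux (fun y Uy => fg y Uy).
apply: IH Cv => x Ux; exact: derive_eq_on oU Ux fg.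
Qed.

Lemma CkS k U f : Ck k.+1 U f -> Ck k U f.
Proof.
elim: k f => [|k IH] f; first by case=> cf _; split.
move=> [cf df]; split=> // v; have [dv /IH Cv] := df v; split=> //.
Qed.

Lemma Ck_sub k U W f : W `<=` U -> Ck k U f -> Ck k W f.
Proof.
move=> WU; elim: k f => [|k IH] f [cf df]; split=> //.
- by move=> x /WU; exact: cf.
- by move=> x /WU; exact: cf.
- by move=> v; have [dv Cv] := df v; split=> [x /WU|]; [exact: dv|exact: IH].
Qed.

Lemma Ck_cst k U (c : R) : Ck k U (fun=> c).
Proof.
elim: k c => [|k IH] c; split=> //; try by move=> x _; exact: cst_continuous.
move=> v; split=> [x _|]; first exact: derivable_cst.
have -> : (fun x => 'D_v (fun=> c) x) = (fun=> 0) :> (V -> R).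
  by apply/funext => x; exact: derive_cst.
exact: IH.
Qed.

Lemma CkD k U f g : open U -> Ck k U f -> Ck k U g -> Ck k U (fun x => f x + g x).
Proof.
move=> oU; elim: k f g => [|k IH] f g [cf df] [cg dg].
  by split=> // x Ux; apply: continuousD; [exact: cf|exact: cg].
split=> [x Ux|v]; first by apply: continuousD; [exact: cf|exact: cg].
have [dfv Cf] := df v; have [dgv Cg] := dg v; split=> [x Ux|].
  by apply: derivableD; [exact: dfv|exact: dgv].
apply: Ck_eq oU _ (IH _ _ Cf Cg) => x Ux.
by rewrite -deriveD//; [exact: dfv|exact: dgv].
Qed.

Lemma CkM k U f g : open U -> Ck k U f -> Ck k U g -> Ck k U (fun x => f x * g x).
Proof.
move=> oU; elim: k f g => [|k IH] f g Cf Cg.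
  by split=> // x Ux; apply: continuousM; [exact: Ck_cont Cf Ux|exact: Ck_cont Cg Ux].
split=> [x Ux|v]; first by apply: continuousM; [exact: Ck_cont Cf Ux|exact: Ck_cont Cg Ux].
have df x : U x -> derivable f x v by exact: Ck_derivable Cf.
have dg x : U x -> derivable g x v by exact: Ck_derivable Cg.
split=> [x Ux|]; first by apply: derivableM; [exact: df|exact: dg].
have E : Ck k U (fun x => f x * 'D_v g x + g x * 'D_v f x).
  by apply: CkD => //; apply: IH => //; [exact: CkS|exact: Ck_derive|exact: CkS|exact: Ck_derive].
apply: Ck_eq oU _ E => x Ux.
by rewrite (_ : (fun x => f x * g x) = f * g)// deriveM//; [exact: df|exact: dg].
Qed.

Lemma CkV k U f : open U -> (forall x, U x -> f x != 0) -> Ck k U f ->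
  Ck k U (fun x => (f x)^-1).
Proof.
move=> oU f0; elim: k => [|k IH] Cf.
  by split=> // x Ux; apply: continuousV; [exact: f0|exact: Ck_cont Cf Ux].
split=> [x Ux|v]; first by apply: continuousV; [exact: f0|exact: Ck_cont Cf Ux].
have df x : U x -> derivable f x v by exact: Ck_derivable Cf.
split=> [x Ux|]; first by apply: derivableV; [exact: f0|exact: df].
have IC := IH (CkS Cf).
have E : Ck k U (fun x => (-1) * ((f x)^-1 * (f x)^-1 * 'D_v f x)).
  apply: CkM => //; first exact: Ck_cst.
  by apply: CkM => //; [exact: CkM|exact: Ck_derive].
apply: Ck_eq oU _ E => x Ux.
rewrite (deriveV (f0 _ Ux) (df _ Ux)) mulN1r -exprVn expr2.
by rewrite [in RHS]scaleNr.
Qed.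

Lemma is_derive_ln f x v : 0 < f x -> derivable f x v ->
  is_derive x v (fun y => ln (f y)) ((f x)^-1 * 'D_v f x).
Proof.
move=> f0 /derivableP /is_derive_lineP df; apply/is_derive_lineP.
apply: (@is_derive1_comp _ (@ln R) (fun s => f (x + s *: v))) df.
by rewrite scale0r addr0; exact: is_derive1_ln.
Qed.

(** Unlike for the inverse, no induction on k: the derivative f^-1 'D_v f no longer contains a
    logarithm. *)
Lemma Ck_ln k U f : open U -> (forall x, U x -> 0 < f x) -> Ck k U f ->
  Ck k U (fun x => ln (f x)).
Proof.
move=> oU f0.
have cl (C : forall x, U x -> {for x, continuous f}) x :
    U x -> {for x, continuous (fun x => ln (f x))}.
  move=> Ux; apply: (@continuous_comp _ _ _ f (@ln R)); first exact: C.
  exact/continuous_ln/f0.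
case: k => [|k] Cf.
  by split=> // x Ux; apply: cl => // y Uy; exact: Ck_cont Cf Uy.
split=> [x Ux|v]; first by apply: cl => // y Uy; exact: Ck_cont Cf Uy.
have df x : U x -> derivable f x v by exact: Ck_derivable Cf.
have il x : U x -> is_derive x v (fun y => ln (f y)) ((f x)^-1 * 'D_v f x).
  by move=> Ux; exact: is_derive_ln (f0 x Ux) (df x Ux).
split=> [x Ux|]; first by have [] := il x Ux.
have E : Ck k U (fun x => (f x)^-1 * 'D_v f x).
  apply: CkM => //; last exact: Ck_derive.
  by apply: CkV => // [x Ux|]; [rewrite gt_eqF// f0|exact: CkS].
by apply: Ck_eq oU _ E => x Ux; have [_ ->] := il x Ux.
Qed.

Lemma smooth_derive U f v : smooth U f -> smooth U (fun x => 'D_v f x).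
Proof. by move=> sf k; exact: Ck_derive (sf k.+1). Qed.

Lemma smooth_derivable U f x v : smooth U f -> U x -> derivable f x v.
Proof. by move=> /(_ 1%N)/Ck_derivable; apply. Qed.

Lemma smooth_cont U f x : smooth U f -> U x -> {for x, continuous f}.
Proof. by move=> /(_ 0%N)/Ck_cont; apply. Qed.

Lemma smooth_eq U f g : open U -> (forall y, U y -> f y = g y) ->
  smooth U f -> smooth U g.
Proof. by move=> oU fg sf k; apply: Ck_eq oU fg (sf k). Qed.

Lemma smooth_sub U W f : W `<=` U -> smooth U f -> smooth W f.
Proof. by move=> WU sf k; apply: Ck_sub WU (sf k). Qed.

Lemma smooth_cst U (c : R) : smooth U (fun=> c).
Proof. by move=> k; exact: Ck_cst. Qed.

Lemma smoothD U f g : open U -> smooth U f -> smooth U g ->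
  smooth U (fun x => f x + g x).
Proof. by move=> oU sf sg k; exact: CkD. Qed.

Lemma smoothM U f g : open U -> smooth U f -> smooth U g ->
  smooth U (fun x => f x * g x).
Proof. by move=> oU sf sg k; exact: CkM. Qed.

Lemma smoothN U f : open U -> smooth U f -> smooth U (fun x => - f x).
Proof.
move=> oU sf; have := smoothM oU (smooth_cst U (-1)) sf.
by under eq_fun do rewrite mulN1r.
Qed.

Lemma smoothB U f g : open U -> smooth U f -> smooth U g ->
  smooth U (fun x => f x - g x).
Proof. by move=> oU sf sg; apply: smoothD => //; exact: smoothN. Qed.

Lemma smoothV U f : open U -> (forall x, U x -> f x != 0) -> smooth U f ->
  smooth U (fun x => (f x)^-1).
Proof. by move=> oU f0 sf k; exact: CkV. Qed.

Lemma smooth_ln U f : open U -> (forall x, U x -> 0 < f x) -> smooth U f ->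
  smooth U (fun x => ln (f x)).
Proof. by move=> oU f0 sf k; exact: Ck_ln. Qed.

Lemma smooth_schwarz U f x u v : open U -> smooth U f -> U x ->
  'D_v (fun y => 'D_u f y) x = 'D_u (fun y => 'D_v f y) x.
Proof.
move=> oU sf Ux; apply: (@derive_comm _ _ f U) => //.
- move=> y Uy; split; try exact: smooth_derivable Uy.
    by apply: smooth_derivable Uy; exact: smooth_derive.
  by apply: smooth_derivable Uy; exact: smooth_derive.
- by apply: smooth_cont Ux; do 2 apply: smooth_derive.
- by apply: smooth_cont Ux; do 2 apply: smooth_derive.
Qed.

Lemma smooth_dirD U f x u v : open U -> smooth U f -> U x ->
  'D_(u + v) f x = 'D_u f x + 'D_v f x.
Proof.
move=> oU sf Ux; apply: derive_val.
apply: (is_derive_dirD oU Ux).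
- by move=> y Uy; exact: smooth_derivable Uy.
- exact: smooth_derivable Ux.
- by apply: smooth_cont Ux; exact: smooth_derive.
Qed.

Lemma smooth_dirZ U f x (c : R) v : smooth U f -> U x ->
  'D_(c *: v) f x = c * 'D_v f x.
Proof. by move=> sf Ux; apply: derive_scale; exact: smooth_derivable Ux. Qed.

Lemma smooth_dir_sum U f x (I : Type) (r : seq I) (P : pred I) (w : I -> V) :
  open U -> smooth U f -> U x ->
  'D_(\sum_(i <- r | P i) w i) f x = \sum_(i <- r | P i) 'D_(w i) f x.
Proof.
move=> oU sf Ux; elim/big_rec2: _ => [|i a b _ <-]; first exact: derive0.
exact: smooth_dirD Ux.
Qed.

End Smooth.

(** * Linear maps and composition with them *)

Section SmoothLinear.
Variables (R : realType) (V W : normedModType R).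

Lemma derive_comp_linear (L : V -> W) (f : W -> R) x v : linear L ->
  'D_v (fun y => f (L y)) x = 'D_(L v) f (L x).
Proof.
move=> linL; rewrite /derive; set a := fun h => _; set b := fun h => _.
suff -> : a = b by [].
by apply/funext => h; rewrite /a /b /= linL.
Qed.

Lemma derivable_comp_linear (L : V -> W) (f : W -> R) x v : linear L ->
  derivable f (L x) (L v) -> derivable (fun y => f (L y)) x v.
Proof.
move=> linL; rewrite /derivable; set a := fun h => _; set b := fun h => _.
suff -> : a = b by [].
by apply/funext => h; rewrite /a /b /= linL.
Qed.

Lemma smooth_comp_linear (L : V -> W) (U : set W) (f : W -> R) :
  linear L -> continuous L -> smooth U f ->
  smooth (L @^-1` U) (fun y => f (L y)).
Proof.
move=> linL cL sf k; have {}sf := sf k.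
have cc (f' : W -> R) : (forall x, U x -> {for x, continuous f'}) ->
   forall x, (L @^-1` U) x -> {for x, continuous (fun y => f' (L y))}.
  by move=> cf x Ux; apply: (@continuous_comp _ _ _ L f'); [exact: cL|exact: cf].
elim: k f sf => [|k IH] f [cf df]; split; try exact: cc.
  by [].
move=> v; have [dv Cv] := df (L v); split=> [x Ux|].
  by apply: derivable_comp_linear => //; exact: dv.
have := IH _ Cv; congr (Ck _ _ _).
by apply/funext => y; rewrite derive_comp_linear.
Qed.

Lemma is_derive_linear (f : V -> R) x v : scalar f ->
  is_derive x v f (f v).
Proof.
move=> linf; apply/is_derive_lineP.
have -> : (fun s : R => f (x + s *: v)) = cst (f x) + (f v) *: id.
  by apply/funext => s; rewrite addrC linf addrC /= mulrC.
have := @is_deriveD R R R _ _ 0 1 0 _ (@is_derive_cst R R R (f x) 0 1)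
  (@is_deriveZ R R R id (f v) 0 1 1 (is_derive_id _ _)).
by rewrite add0r [_ *: 1]mulr1.
Qed.

Lemma smooth_linear U (f : V -> R) : scalar f -> continuous f -> smooth U f.
Proof.
move=> linf cf [|k]; split=> //; try by move=> x _; exact: cf.
move=> v; split=> [x _|]; first by have [] := is_derive_linear x v linf.
have -> : (fun x => 'D_v f x) = fun=> f v.
  by apply/funext => x; have [_ ->] := is_derive_linear x v linf.
exact: Ck_cst.
Qed.

End SmoothLinear.

(** * Wirtinger derivatives *)

Local Opaque derive.

Section ComplexParts.
Variable R : rcfType.
Implicit Types x y : R[i].

Lemma cReD x y : complex.Re (x + y) = complex.Re x + complex.Re y.
Proof. by case: x; case: y. Qed.
Lemma cImD x y : complex.Im (x + y) = complex.Im x + complex.Im y.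
Proof. by case: x; case: y. Qed.
Lemma cReN x : complex.Re (- x) = - complex.Re x.
Proof. by case: x. Qed.
Lemma cImN x : complex.Im (- x) = - complex.Im x.
Proof. by case: x. Qed.
Lemma cReM x y : complex.Re (x * y) =
  complex.Re x * complex.Re y - complex.Im x * complex.Im y.
Proof. by case: x; case: y. Qed.
Lemma cImM x y : complex.Im (x * y) =
  complex.Re x * complex.Im y + complex.Im x * complex.Re y.
Proof. by case: x => a b; case: y => c d /=; rewrite addrC. Qed.
Lemma cReJ x : complex.Re (conjc x) = complex.Re x.
Proof. by case: x. Qed.
Lemma cImJ x : complex.Im (conjc x) = - complex.Im x.
Proof. by case: x. Qed.
Lemma cReV x : complex.Re (x^-1) =
  complex.Re x * (complex.Re x * complex.Re x + complex.Im x * complex.Im x)^-1.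
Proof. by case: x => a b /=; rewrite !expr2. Qed.
Lemma cImV x : complex.Im (x^-1) =
  - (complex.Im x * (complex.Re x * complex.Re x + complex.Im x * complex.Im x)^-1).
Proof. by case: x => a b /=; rewrite !expr2. Qed.

Lemma complexP x y : complex.Re x = complex.Re y -> complex.Im x = complex.Im y ->
  x = y.
Proof. by case: x => a b; case: y => c d /= -> ->. Qed.

Lemma complexR_inv (a : R) : a^-1%:C = a%:C^-1.
Proof. exact: (fmorphV (real_complex R)). Qed.

Lemma complexR_eqE (a b : R) : (a%:C == b%:C) = (a == b).
Proof. by rewrite eq_complex /= eqxx andbT. Qed.

Lemma sqr_Re_Im_neq0 x : x != 0 ->
  complex.Re x * complex.Re x + complex.Im x * complex.Im x != 0.
Proof.
by rewrite -!expr2 paddr_eq0 ?sqr_ge0// !sqrf_eq0 -[x == 0]/(_) eq_complex.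
Qed.

Lemma conjcM x y : conjc (x * y) = conjc x * conjc y.
Proof. exact: rmorphM. Qed.
Lemma conjcD x y : conjc (x + y) = conjc x + conjc y.
Proof. exact: rmorphD. Qed.
Lemma conjcB x y : conjc (x - y) = conjc x - conjc y.
Proof. exact: rmorphB. Qed.
Lemma conjci : conjc ('i : R[i]) = - 'i.
Proof. by apply: complexP => //=; rewrite oppr0. Qed.
Lemma mulc_ii : ('i : R[i]) * 'i = -1.
Proof. by apply: complexP; rewrite /= ?mulr0 ?mul0r ?mulr1 ?addr0 ?sub0r ?oppr0. Qed.
Lemma conjc_half : conjc (2^-1 : R[i]) = 2^-1.
Proof. by rewrite conjc_inv (conjc_nat _ 2). Qed.
Lemma conjc_sum (I : Type) (r : seq I) (P : pred I) (F : I -> R[i]) :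
  conjc (\sum_(i <- r | P i) F i) = \sum_(i <- r | P i) conjc (F i).
Proof. exact: rmorph_sum. Qed.
End ComplexParts.

(** * Smooth complex-valued functions *)

Section CSmooth.
Variables (R : realType) (V : normedModType R) (U : set V).
Hypothesis oU : open U.
Implicit Types (F G : V -> R[i]) (x u v : V).

Lemma csmooth_eq F G : (forall x, U x -> F x = G x) -> csmooth U F -> csmooth U G.
Proof.
move=> FG [sr si]; split; first by apply: smooth_eq sr => // x /FG ->.
by apply: smooth_eq si => // x /FG ->.
Qed.

Lemma csmooth_sub (W : set V) F : W `<=` U -> csmooth U F -> csmooth W F.
Proof. by move=> WU [sr si]; split; apply: smooth_sub WU _. Qed.

Lemma csmooth_cst (c : R[i]) : csmooth U (fun=> c).
Proof. by split; exact: smooth_cst. Qed.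

Lemma csmooth_real (f : V -> R) : smooth U f -> csmooth U (fun x => (f x)%:C).
Proof. by move=> sf; split=> //=; exact: smooth_cst. Qed.

Lemma csmoothD F G : csmooth U F -> csmooth U G -> csmooth U (fun x => F x + G x).
Proof.
move=> [sr si] [tr ti]; split.
  by under eq_fun do rewrite cReD; exact: smoothD.
by under eq_fun do rewrite cImD; exact: smoothD.
Qed.

Lemma csmoothN F : csmooth U F -> csmooth U (fun x => - F x).
Proof.
move=> [sr si]; split.
  by under eq_fun do rewrite cReN; exact: smoothN.
by under eq_fun do rewrite cImN; exact: smoothN.
Qed.

Lemma csmoothB F G : csmooth U F -> csmooth U G -> csmooth U (fun x => F x - G x).
Proof. by move=> sF sG; apply: csmoothD => //; exact: csmoothN. Qed.

Lemma csmoothM F G : csmooth U F -> csmooth U G -> csmooth U (fun x => F x * G x).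
Proof.
move=> [sr si] [tr ti]; split.
  by under eq_fun do rewrite cReM; apply: smoothB => //; exact: smoothM.
by under eq_fun do rewrite cImM; apply: smoothD => //; exact: smoothM.
Qed.

Lemma csmoothJ F : csmooth U F -> csmooth U (fun x => conjc (F x)).
Proof.
move=> [sr si]; split.
  by under eq_fun do rewrite cReJ.
by under eq_fun do rewrite cImJ; exact: smoothN.
Qed.

Lemma csmoothV F : (forall x, U x -> F x != 0) -> csmooth U F ->
  csmooth U (fun x => (F x)^-1).
Proof.
move=> F0 [sr si].
have sn : smooth U (fun x => (complex.Re (F x) * complex.Re (F x) +
    complex.Im (F x) * complex.Im (F x))^-1).
  apply: smoothV => // [x /F0|]; first exact: sqr_Re_Im_neq0.
  by apply: smoothD => //; exact: smoothM.
split.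
  by under eq_fun do rewrite cReV; exact: smoothM.
by under eq_fun do rewrite cImV; apply: smoothN => //; exact: smoothM.
Qed.

Lemma csmooth_sum (I : Type) (r : seq I) (P : pred I) (F : I -> V -> R[i]) :
  (forall i, csmooth U (F i)) -> csmooth U (fun x => \sum_(i <- r | P i) F i x).
Proof.
move=> sF; elim: r => [|i r IH].
  by under eq_fun do rewrite big_nil; exact: csmooth_cst.
under eq_fun do rewrite big_cons; case: (P i) => //.
by apply: csmoothD.
Qed.

Lemma csmooth_prod (I : Type) (r : seq I) (P : pred I) (F : I -> V -> R[i]) :
  (forall i, csmooth U (F i)) -> csmooth U (fun x => \prod_(i <- r | P i) F i x).
Proof.
move=> sF; elim: r => [|i r IH].
  by under eq_fun do rewrite big_nil; exact: csmooth_cst.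
under eq_fun do rewrite big_cons; case: (P i) => //.
by apply: csmoothM.
Qed.

Lemma csmooth_cderive F v : csmooth U F -> csmooth U (fun x => cderive F v x).
Proof. by move=> [sr si]; split; exact: smooth_derive. Qed.

Lemma cderive_eq F G v x : U x -> (forall y, U y -> F y = G y) ->
  cderive F v x = cderive G v x.
Proof.
move=> Ux FG; rewrite /cderive.
by congr (_ +i* _); apply: (derive_eq_on _ oU Ux) => y /FG ->.
Qed.

Lemma cderive_cst (c : R[i]) v x : cderive (fun=> c) v x = 0.
Proof. by rewrite /cderive /=; congr (_ +i* _); exact: derive_cst. Qed.

Lemma cderiveD F G v x : csmooth U F -> csmooth U G -> U x ->
  cderive (fun x => F x + G x) v x = cderive F v x + cderive G v x.
Proof.
move=> [sr si] [tr ti] Ux; apply: complexP => /=.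
  by under eq_fun do rewrite cReD; rewrite -deriveD//; exact: smooth_derivable Ux.
by under eq_fun do rewrite cImD; rewrite -deriveD//; exact: smooth_derivable Ux.
Qed.

Lemma cderiveM F G v x : csmooth U F -> csmooth U G -> U x ->
  cderive (fun x => F x * G x) v x = F x * cderive G v x + cderive F v x * G x.
Proof.
move=> [sr si] [tr ti] Ux.
have dM (f g : V -> R) : smooth U f -> smooth U g ->
    is_derive x v (fun x => f x * g x) (f x * 'D_v g x + g x * 'D_v f x).
  move=> sf sg; have := @is_deriveM _ _ f g x v _ _
    (derivableP (smooth_derivable sf Ux)) (derivableP (smooth_derivable sg Ux)).
  by [].
rewrite /cderive; apply: complexP => /=.
  under eq_fun do rewrite cReM.
  have [_ ->] := is_deriveB (dM _ _ sr tr) (dM _ _ si ti).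
  by case: (F x) => a b; case: (G x) => c d /=; ring.
under eq_fun do rewrite cImM.
have [_ ->] := is_deriveD (dM _ _ sr ti) (dM _ _ si tr).
by case: (F x) => a b; case: (G x) => c d /=; ring.
Qed.

Lemma cderiveJ F v x : csmooth U F -> U x ->
  cderive (fun x => conjc (F x)) v x = conjc (cderive F v x).
Proof.
move=> [sr si] Ux; rewrite /cderive /=; congr (_ +i* _).
  by under eq_fun do rewrite cReJ.
under eq_fun do rewrite cImJ.
by rewrite -deriveN//; exact: smooth_derivable Ux.
Qed.

Lemma cderive_schwarz F u v x : csmooth U F -> U x ->
  cderive (fun y => cderive F u y) v x = cderive (fun y => cderive F v y) u x.
Proof.
move=> [sr si] Ux; rewrite /cderive /=.
have -> := smooth_schwarz u v oU sr Ux.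
by have -> := smooth_schwarz u v oU si Ux.
Qed.

End CSmooth.

Local Opaque cderive.

Section Wirtinger.
Variables (R : realType) (n : nat) (U : set (Cn R n)).
Hypothesis oU : open U.
Implicit Types (F G : Cn R n -> R[i]) (p : Cn R n).

Lemma csmooth_del F k : csmooth U F -> csmooth U (fun p => del k F p).
Proof.
move=> sF; apply: csmoothM => //; first exact: csmooth_cst.
apply: csmoothB => //; first exact: csmooth_cderive.
by apply: csmoothM => //; [exact: csmooth_cst|exact: csmooth_cderive].
Qed.

Lemma csmooth_delbar F k : csmooth U F -> csmooth U (fun p => delbar k F p).
Proof.
move=> sF; apply: csmoothM => //; first exact: csmooth_cst.
apply: csmoothD => //; first exact: csmooth_cderive.
by apply: csmoothM => //; [exact: csmooth_cst|exact: csmooth_cderive].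
Qed.

Lemma del_eq F G k p : U p -> (forall q, U q -> F q = G q) -> del k F p = del k G p.
Proof. by move=> Up FG; rewrite /del !(cderive_eq oU _ Up FG). Qed.

Lemma delbar_eq F G k p : U p -> (forall q, U q -> F q = G q) ->
  delbar k F p = delbar k G p.
Proof. by move=> Up FG; rewrite /delbar !(cderive_eq oU _ Up FG). Qed.

Lemma del_cst (c : R[i]) k p : del k (fun=> c) p = 0.
Proof. by rewrite /del !cderive_cst mulr0 subr0 mulr0. Qed.

Lemma delbar_cst (c : R[i]) k p : delbar k (fun=> c) p = 0.
Proof. by rewrite /delbar !cderive_cst mulr0 addr0 mulr0. Qed.

Lemma delD F G k p : csmooth U F -> csmooth U G -> U p ->
  del k (fun p => F p + G p) p = del k F p + del k G p.
Proof. move=> sF sG Up; rewrite /del !(cderiveD _ sF sG Up).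
move: (cderive F _ _) (cderive F _ _) (cderive G _ _) (cderive G _ _) => a b c e.
ring. Qed.

Lemma delbarD F G k p : csmooth U F -> csmooth U G -> U p ->
  delbar k (fun p => F p + G p) p = delbar k F p + delbar k G p.
Proof. move=> sF sG Up; rewrite /delbar !(cderiveD _ sF sG Up).
move: (cderive F _ _) (cderive F _ _) (cderive G _ _) (cderive G _ _) => a b c e.
ring. Qed.

Lemma delM F G k p : csmooth U F -> csmooth U G -> U p ->
  del k (fun p => F p * G p) p = F p * del k G p + del k F p * G p.
Proof. move=> sF sG Up; rewrite /del !(cderiveM _ sF sG Up).
move: (cderive F _ _) (cderive F _ _) (cderive G _ _) (cderive G _ _) => a b c e.
move: (F p) (G p) => f g; ring. Qed.

Lemma delbarM F G k p : csmooth U F -> csmooth U G -> U p ->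
  delbar k (fun p => F p * G p) p = F p * delbar k G p + delbar k F p * G p.
Proof. move=> sF sG Up; rewrite /delbar !(cderiveM _ sF sG Up).
move: (cderive F _ _) (cderive F _ _) (cderive G _ _) (cderive G _ _) => a b c e.
move: (F p) (G p) => f g; ring. Qed.

Lemma delJ F k p : csmooth U F -> U p ->
  del k (fun p => conjc (F p)) p = conjc (delbar k F p).
Proof.
move=> sF Up; rewrite /del /delbar !(cderiveJ _ sF Up).
by rewrite conjcM conjcD conjcM conjci conjc_half mulNr.
Qed.

Lemma delbarJ F k p : csmooth U F -> U p ->
  delbar k (fun p => conjc (F p)) p = conjc (del k F p).
Proof.
move=> sF Up; rewrite /del /delbar !(cderiveJ _ sF Up).
by rewrite conjcM conjcB conjcM conjci conjc_half mulNr opprK.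
Qed.

Lemma delZ (c : R[i]) F k p : csmooth U F -> U p ->
  del k (fun p => c * F p) p = c * del k F p.
Proof. by move=> sF Up; rewrite delM ?del_cst ?mul0r ?addr0//; exact: csmooth_cst. Qed.

Lemma delbarZ (c : R[i]) F k p : csmooth U F -> U p ->
  delbar k (fun p => c * F p) p = c * delbar k F p.
Proof. by move=> sF Up; rewrite delbarM ?delbar_cst ?mul0r ?addr0//; exact: csmooth_cst. Qed.

Lemma del_sum (I : Type) (r : seq I) (P : pred I) (F : I -> Cn R n -> R[i]) k p :
  (forall i, csmooth U (F i)) -> U p ->
  del k (fun p => \sum_(i <- r | P i) F i p) p = \sum_(i <- r | P i) del k (F i) p.
Proof.
move=> sF Up; elim: r => [|i r IH].
  by under eq_fun do rewrite big_nil; rewrite big_nil del_cst.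
under eq_fun do rewrite big_cons; rewrite big_cons; case: (P i) => //.
by rewrite delD// ?IH//; exact: csmooth_sum.
Qed.

Lemma delbar_sum (I : Type) (r : seq I) (P : pred I) (F : I -> Cn R n -> R[i]) k p :
  (forall i, csmooth U (F i)) -> U p ->
  delbar k (fun p => \sum_(i <- r | P i) F i p) p = \sum_(i <- r | P i) delbar k (F i) p.
Proof.
move=> sF Up; elim: r => [|i r IH].
  by under eq_fun do rewrite big_nil; rewrite big_nil delbar_cst.
under eq_fun do rewrite big_cons; rewrite big_cons; case: (P i) => //.
by rewrite delbarD// ?IH//; exact: csmooth_sum.
Qed.

Lemma delbar_prod0 (I : Type) (r : seq I) (P : pred I) (F : I -> Cn R n -> R[i]) k p :
  (forall i, csmooth U (F i)) -> U p -> (forall i, delbar k (F i) p = 0) ->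
  delbar k (fun p => \prod_(i <- r | P i) F i p) p = 0.
Proof.
move=> sF Up F0; elim: r => [|i r IH].
  by under eq_fun do rewrite big_nil; rewrite delbar_cst.
under eq_fun do rewrite big_cons; case: (P i) => //.
by rewrite delbarM// ?IH ?F0 ?mulr0 ?mul0r ?addr0//; exact: csmooth_prod.
Qed.

(** Leibniz rule applied to F F^-1 = 1. *)
Lemma delV F k p : (forall q, U q -> F q != 0) -> csmooth U F -> U p ->
  del k (fun p => (F p)^-1) p = - (del k F p / F p ^+ 2).
Proof.
move=> F0 sF Up; have sV := csmoothV oU F0 sF.
have := delM k sF sV Up.
rewrite (@del_eq _ (fun=> 1)) ?del_cst//; last by move=> q /F0 ?; rewrite mulfV.
have Fp := F0 p Up; move=> /eqP; rewrite eq_sym addr_eq0 => /eqP E.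
apply: (mulfI Fp); rewrite E; field; exact: Fp.
Qed.

Lemma delbarV F k p : (forall q, U q -> F q != 0) -> csmooth U F -> U p ->
  delbar k (fun p => (F p)^-1) p = - (delbar k F p / F p ^+ 2).
Proof.
move=> F0 sF Up; have sV := csmoothV oU F0 sF.
have := delbarM k sF sV Up.
rewrite (@delbar_eq _ (fun=> 1)) ?delbar_cst//; last by move=> q /F0 ?; rewrite mulfV.
have Fp := F0 p Up; move=> /eqP; rewrite eq_sym addr_eq0 => /eqP E.
apply: (mulfI Fp); rewrite E; field; exact: Fp.
Qed.

Lemma delC F a b p : csmooth U F -> U p ->
  del a (delbar b F) p = delbar b (del a F) p.
Proof.
move=> sF Up; have sc v := csmooth_cderive v sF.
have si v : csmooth U (fun q => 'i * cderive F v q).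
  by apply: csmoothM => //; exact: csmooth_cst.
have cM v w : cderive (fun q => 'i * cderive F v q) w p =
    'i * cderive (fun q => cderive F v q) w p.
  rewrite (cderiveM w (csmooth_cst U 'i) (sc v) Up) cderive_cst mul0r addr0 //.
have cH (G : Cn R n -> R[i]) w : csmooth U G ->
    cderive (fun q => 2^-1 * G q) w p = 2^-1 * cderive G w p.
  move=> sG.
  rewrite (cderiveM w (csmooth_cst U (2^-1)) sG Up) cderive_cst mul0r addr0 //.
have cB v1 v2 w : cderive (fun q => cderive F v1 q - 'i * cderive F v2 q) w p =
  cderive (fun q => cderive F v1 q) w p - 'i * cderive (fun q => cderive F v2 q) w p.
  have := cderiveD w (sc v1) (csmoothN oU (si v2)) Up.
  move=> ->; have := cderiveM w (csmooth_cst U (-1)) (si v2) Up.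
  rewrite cderive_cst mul0r addr0 cM mulN1r => <-.
  suff -> : (fun q => -1 * ('i * cderive F v2 q)) =
            (fun q => - ('i * cderive F v2 q)) by [].
  by apply/funext => q; rewrite mulN1r.
rewrite /del /delbar !cH; try by
  [apply: csmoothD|apply: csmoothB].
rewrite !cB !(fun v1 v2 w => cderiveD w (sc v1) (si v2) Up) !cM.
(* Both sides expand into the same four second derivatives, C u v standing for the derivative along
   u and then v; symmetry of C is all that is used. *)
have key (C : Cn R n -> Cn R n -> R[i]) ra ia rb ib :
    (forall u v, C u v = C v u) ->
    2^-1 * (2^-1 * (C rb ra + 'i * C ib ra) - 'i * (2^-1 * (C rb ia + 'i * C ib ia)))
    = 2^-1 * (2^-1 * (C ra rb - 'i * C ia rb) + 'i * (2^-1 * (C ra ib - 'i * C ia ib))).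
  move=> sC; rewrite (sC rb ra) (sC ib ra) (sC rb ia) (sC ib ia).
  by move: (C _ _) (C _ _) (C _ _) (C _ _) => x y z t; ring.
exact: (key (fun u v => cderive (fun q => cderive F u q) v p) _ _ _ _
  (fun u v => cderive_schwarz oU u v sF Up)).
Qed.

End Wirtinger.

Local Transparent cderive.

(** * The chain rule *)

Section Coordinates.
Variables (R : realType) (n : nat).
Implicit Types (v p : Cn R n).

Lemma Cn_decomp v : v = \sum_k (v.1 0 k *: dirRe R k + v.2 0 k *: dirIm R k).
Proof.
rewrite big_split /=; case: v => v1 v2 /=.
have E1 : v1 = \sum_k v1 0 k *: delta_mx 0 k by rewrite -row_sum_delta.
have E2 : v2 = \sum_k v2 0 k *: delta_mx 0 k by rewrite -row_sum_delta.
have H1 : \sum_k v1 0 k *: dirRe R k = (v1, 0) :> Cn R n.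
  rewrite [in RHS]E1; elim/big_rec2: _ => [//|k x y _ ->].
  by rewrite /dirRe; congr (_, _); rewrite /= scaler0 add0r.
have H2 : \sum_k v2 0 k *: dirIm R k = (0, v2) :> Cn R n.
  rewrite [in RHS]E2; elim/big_rec2: _ => [//|k x y _ ->].
  by rewrite /dirIm; congr (_, _); rewrite /= scaler0 add0r.
by rewrite H1 H2; congr (_, _); rewrite /= ?addr0 ?add0r.
Qed.

Lemma derive_coords (U : set (Cn R n)) (f : Cn R n -> R) v p :
  open U -> smooth U f -> U p ->
  'D_v f p = \sum_k (v.1 0 k * 'D_(dirRe R k) f p + v.2 0 k * 'D_(dirIm R k) f p).
Proof.
move=> oU sf Up; rewrite {1}[v]Cn_decomp (smooth_dir_sum _ _ _ oU sf Up).
apply: eq_bigr => k _; rewrite (smooth_dirD _ _ oU sf Up).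
by rewrite !(smooth_dirZ _ _ sf Up).
Qed.

Lemma re_coord_continuous k : continuous (fun p : Cn R n => p.1 0 k).
Proof.
move=> p; apply: (@continuous_comp _ _ _ fst (fun x : 'rV[R]_n => x 0 k)).
  exact: cvg_fst.
exact: coord_continuous.
Qed.

Lemma im_coord_continuous k : continuous (fun p : Cn R n => p.2 0 k).
Proof.
move=> p; apply: (@continuous_comp _ _ _ snd (fun x : 'rV[R]_n => x 0 k)).
  exact: cvg_snd.
exact: coord_continuous.
Qed.

Lemma re_coord_scalar k : scalar (fun p : Cn R n => p.1 0 k).
Proof. by move=> a u v /=; rewrite !mxE. Qed.

Lemma im_coord_scalar k : scalar (fun p : Cn R n => p.2 0 k).
Proof. by move=> a u v /=; rewrite !mxE. Qed.

Lemma csmooth_ccoord U k : csmooth U (fun p : Cn R n => ccoord p k).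
Proof.
split; rewrite /ccoord /=; apply: smooth_linear.
- exact: re_coord_scalar.
- exact: re_coord_continuous.
- exact: im_coord_scalar.
- exact: im_coord_continuous.
Qed.

Lemma cderive_ccoord k v p : cderive (fun p => ccoord p k) v p = ccoord v k.
Proof.
rewrite /cderive /ccoord /=.
have [_ ->] := is_derive_linear p v (@re_coord_scalar k).
by have [_ ->] := is_derive_linear p v (@im_coord_scalar k).
Qed.

Lemma ccoord_dirRe (k l : 'I_n) : ccoord (dirRe R k) l = (k == l)%:R.
Proof. by rewrite /ccoord /dirRe /= !mxE eqxx /= eq_sym; case: eqP. Qed.

Lemma ccoord_dirIm (k l : 'I_n) : ccoord (dirIm R k) l = 'i * (k == l)%:R.
Proof.
rewrite /ccoord /dirIm /= !mxE eqxx /= eq_sym.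
by case: eqP => _; rewrite ?mulr1 ?mulr0.
Qed.

Lemma del_ccoord k l p : del k (fun p => ccoord p l) p = (k == l)%:R.
Proof.
rewrite /del !cderive_ccoord ccoord_dirRe ccoord_dirIm mulrA mulc_ii mulN1r opprK.
have h2 : (2 : R[i]) != 0 by rewrite pnatr_eq0.
by case: eqP => _ /=; rewrite ?addr0 ?mulr0// mulVf.
Qed.

Lemma delbar_ccoord k l p : delbar k (fun p => ccoord p l) p = 0.
Proof.
rewrite /delbar !cderive_ccoord ccoord_dirRe ccoord_dirIm mulrA mulc_ii mulN1r.
by rewrite subrr mulr0.
Qed.

Lemma cderive_wirtinger (U : set (Cn R n)) (F : Cn R n -> R[i]) v p :
  open U -> csmooth U F -> U p ->
  cderive F v p =
  \sum_k (ccoord v k * del k F p + conjc (ccoord v k) * delbar k F p).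
Proof.
move=> oU [sr si] Up.
have -> : cderive F v p = \sum_k ((v.1 0 k)%:C * cderive F (dirRe R k) p +
    (v.2 0 k)%:C * cderive F (dirIm R k) p).
  rewrite {1}/cderive (derive_coords v oU sr Up) (derive_coords v oU si Up).
  elim/big_rec3: _ => [//|k x y z _ <-].
  rewrite /cderive; apply: complexP => /=.
    by move: ('D_(dirRe R k) _ p) ('D_(dirIm R k) _ p) => *; ring.
  by move: ('D_(dirRe R k) _ p) ('D_(dirIm R k) _ p) => *; ring.
apply: eq_bigr => k _; rewrite /ccoord /del /delbar.
move: (cderive F _ p) (cderive F _ p) (v.1 0 k) (v.2 0 k) => A B x y.
have -> : x +i* y = x%:C + 'i * y%:C.
  by apply: complexP => /=; ring.
have -> : conjc (x%:C + 'i * y%:C) = x%:C - 'i * y%:C.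
  by apply: complexP => /=; ring.
have h2 : (2 : R[i]) != 0 by rewrite pnatr_eq0.
have ii := @mulc_ii R; apply: (mulfI h2); apply/eqP; rewrite -subr_eq0.
(* [field] treats 'i as an indeterminate, so the difference of the two sides is exhibited as a
   multiple of 1 + 'i * 'i. *)
set X := (X in X == 0).
have -> : X = (1 + 'i * 'i) * (2 * (y%:C * A)).
  by rewrite /X; field.
by rewrite ii subrr mul0r.
Qed.

End Coordinates.

(** * The real chain rule for smooth maps into C^m *)

Section Chain.
Variables (R : realType) (V : normedModType R) (m : nat).
Implicit Types (phi : V -> Cn R m) (x v : V).

Definition csmooth_map (U : set V) phi :=
  forall k, csmooth U (fun x => ccoord (phi x) k).

Definition map_derive phi v x : Cn R m :=
  (\row_k 'D_v (fun y => (phi y).1 0 k) x, \row_k 'D_v (fun y => (phi y).2 0 k) x).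

Lemma cvg_fin_sum (T : Type) (F : set_system T) (FF : Filter F) (W : normedModType R)
   (n : nat) (f : 'I_n -> T -> W) (a : 'I_n -> W) :
  (forall i, f i @ F --> a i) -> (fun t => \sum_i f i t) @ F --> \sum_i a i.
Proof.
elim: n f a => [|n IH] f a fa.
  by rewrite big_ord0; under eq_fun do rewrite big_ord0; exact: cvg_cst.
rewrite big_ord_recl; under eq_fun do rewrite big_ord_recl.
by apply: cvgD; [exact: fa|apply: IH => i; exact: fa].
Qed.

Lemma cvg_line x v : (fun h : R => h *: v + x) @ 0^' --> x.
Proof.
have H : (fun h : R => h *: v + x) @ (0 : R) --> 0 *: v + x.
  by apply: cvgD; [exact: scalel_continuous|exact: cvg_cst].
rewrite scale0r add0r in H.
by apply: cvg_trans H; apply: cvg_app; exact: cvg_within.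
Qed.

(** The increment of f over the segment from phi x to phi (h v + x) is a directional derivative at
    an intermediate point. Expanded in coordinate directions, the quotients of the components of phi
    converge and the partial derivatives of f are continuous. *)
Lemma is_derive_chain (U : set V) (W : set (Cn R m)) phi (f : Cn R m -> R) v x :
  open W -> U x -> W (phi x) -> csmooth_map U phi -> smooth W f ->
  is_derive x v (fun y => f (phi y)) ('D_(map_derive phi v x) f (phi x)).
Proof.
move=> oW Ux Wx sphi sf.
pose d (h : R) := phi (h *: v + x) - phi x.
pose q (h : R) := h^-1 *: (f (phi (h *: v + x)) - f (phi x)).
suff H : q @ 0^' --> 'D_(map_derive phi v x) f (phi x).
  split; first by apply/cvg_ex; exists ('D_(map_derive phi v x) f (phi x)).
  exact/cvg_lim.
have cco (g : V -> R) : smooth U g -> (fun h => g (h *: v + x) - g x) @ 0^' --> (0 : R).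
  move=> sg; rewrite -[X in _ --> X](subrr (g x)); apply: cvgB; last exact: cvg_cst.
  have cg := smooth_cont sg Ux.
  exact: (cvg_comp (fun h : R => h *: v + x) g (@cvg_line x v) cg).
have sRe k : smooth U (fun y => (phi y).1 0 k) by have [] := sphi k.
have sIm k : smooth U (fun y => (phi y).2 0 k) by have [] := sphi k.
have dRe k : (fun h => (d h).1 0 k) @ 0^' --> (0 : R).
  by rewrite /d /=; under eq_fun do rewrite !mxE; exact: cco (sRe k).
have dIm k : (fun h => (d h).2 0 k) @ 0^' --> (0 : R).
  by rewrite /d /=; under eq_fun do rewrite !mxE; exact: cco (sIm k).
have d0 : d @ 0^' --> (0 : Cn R m).
  have -> : d = fun h => \sum_k ((d h).1 0 k *: dirRe R k + (d h).2 0 k *: dirIm R k).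
    by apply/funext => h; exact: Cn_decomp.
  have Z : \sum_k ((0:R) *: dirRe R k + (0:R) *: dirIm R k) = 0 :> Cn R m.
    by rewrite big1// => k _; rewrite !scale0r addr0.
  rewrite -[X in _ --> X]Z.
  apply: cvg_fin_sum => k; apply: cvgD.
    exact: cvgZr_tmp (dRe k).
  exact: cvgZr_tmp (dIm k).
have [e e0 eW] := open_ballP oW Wx.
(* When |d h| >= e the segment may leave W, and c h = 0 is a default for which nothing is
   claimed. *)
have /choice[c Hc] : forall h : R, exists c : R, 0 <= c <= 1 /\ (`|d h| < e ->
    f (phi x + d h) - f (phi x) = 'D_(d h) f (phi x + c *: d h)).
  move=> h; have [de|de] := boolP (`|d h| < e); last first.
    by exists 0; rewrite lexx ler01.
  have [|c c01 E] := @dir_MVT _ _ f (phi x) (d h).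
    move=> t t01; apply: smooth_derivable sf _; apply: eW.
    rewrite addrC addKr normrZ; apply: le_lt_trans de.
    by case/andP: t01 => t0 t1; rewrite ger0_norm// ler_piMl.
  by exists c.
pose y h := phi x + c h *: d h.
have yx : y @ 0^' --> phi x.
  rewrite -[X in _ --> X]addr0; apply: cvgD; first exact: cvg_cst.
  apply/cvgr0Pnorm_lt => r r0.
  have /cvgr0Pnorm_lt /(_ r r0) := d0.
  apply: filterS => h; apply: le_lt_trans; rewrite normrZ.
  by have [/andP[c0 c1] _] := Hc h; rewrite ger0_norm// ler_piMl.
have Dy w : (fun h => 'D_w f (y h)) @ 0^' --> 'D_w f (phi x).
  have cg := smooth_cont (smooth_derive w sf) Wx.
  exact: (cvg_comp y (fun z => 'D_w f z) yx cg).
have qRe k : (fun h : R => h^-1 * (d h).1 0 k) @ 0^' -->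
    'D_v (fun y => (phi y).1 0 k) x.
  have := derive_cvg (@smooth_derivable _ _ _ _ x v (sRe k) Ux).
  by rewrite /d; under [in X in _ -> X]eq_fun do rewrite !mxE.
have qIm k : (fun h : R => h^-1 * (d h).2 0 k) @ 0^' -->
    'D_v (fun y => (phi y).2 0 k) x.
  have := derive_cvg (@smooth_derivable _ _ _ _ x v (sIm k) Ux).
  by rewrite /d; under [in X in _ -> X]eq_fun do rewrite !mxE.
rewrite (derive_coords _ oW sf Wx).
have L : (fun h => \sum_k ((h^-1 * (d h).1 0 k) * 'D_(dirRe R k) f (y h) +
   (h^-1 * (d h).2 0 k) * 'D_(dirIm R k) f (y h))) @ 0^' -->
   \sum_k ((map_derive phi v x).1 0 k * 'D_(dirRe R k) f (phi x)
      + (map_derive phi v x).2 0 k * 'D_(dirIm R k) f (phi x)).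
  apply: cvg_fin_sum => k; rewrite /map_derive /= !mxE.
  by apply: cvgD; apply: cvgM => //.
apply: cvg_trans L; apply: near_eq_cvg.
have /cvgr0Pnorm_lt /(_ e e0) := d0.
apply: filterS => h de; have [c01 /(_ de) E] := Hc h.
rewrite /q -[phi (h *: v + x)](subrK (phi x)) -/(d h) (addrC (d h)) E -/(y h).
have Wy : W (y h).
  apply: eW; rewrite /y addrC addKr normrZ; apply: le_lt_trans de.
  by case/andP: c01 => t0 t1; rewrite ger0_norm// ler_piMl.
rewrite (derive_coords _ oW sf Wy) scaler_sumr.
by apply: eq_bigr => k _; rewrite scalerDr [in RHS]/GRing.scale /= !mulrA.
Qed.

End Chain.

Section SmoothComp.
Variables (R : realType) (V : normedModType R) (m : nat).
Variables (U : set V) (W : set (Cn R m)) (phi : V -> Cn R m).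
Hypotheses (oU : open U) (oW : open W) (sphi : csmooth_map U phi).
Hypothesis phiW : forall x, U x -> W (phi x).

Lemma csmooth_map_cont x : U x -> {for x, continuous phi}.
Proof.
move=> Ux; have -> : phi = fun y =>
    \sum_k ((phi y).1 0 k *: dirRe R k + (phi y).2 0 k *: dirIm R k).
  by apply/funext => y; exact: Cn_decomp.
apply: cvg_fin_sum => k; apply: cvgD.
  by apply: cvgZr_tmp; have [s _] := sphi k; exact: smooth_cont s Ux.
by apply: cvgZr_tmp; have [_ s] := sphi k; exact: smooth_cont s Ux.
Qed.

Lemma Ck_sum k n (f : 'I_n -> V -> R) : (forall i, Ck k U (f i)) ->
  Ck k U (fun x => \sum_i f i x).
Proof.
elim: n f => [|n IH] f sf.
  by under eq_fun do rewrite big_ord0; exact: Ck_cst.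
under eq_fun do rewrite big_ord_recl; apply: CkD => //.
exact: IH.
Qed.

(** Induction on k for all f at once: a derivative of f o phi is a sum of products of derivatives of
    phi with partial derivatives of f composed with phi, and the latter are again of the form
    treated. *)
Lemma smooth_comp (f : Cn R m -> R) : smooth W f -> smooth U (fun x => f (phi x)).
Proof.
move=> sf k; elim: k f sf => [|k IH] f sf.
  split=> // x Ux; apply: (@continuous_comp _ _ _ phi f).
    exact: csmooth_map_cont.
  exact: smooth_cont sf (phiW Ux).
split=> [x Ux|v]; first exact: Ck_cont (IH f sf) Ux.
have D x : U x -> is_derive x v (fun y => f (phi y))
    ('D_(map_derive phi v x) f (phi x)).
  by move=> Ux; exact: is_derive_chain oW Ux (phiW Ux) sphi sf.
split=> [x Ux|]; first by have [] := D x Ux.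
have E : Ck k U (fun x => \sum_l
   ('D_v (fun y => (phi y).1 0 l) x * 'D_(dirRe R l) f (phi x) +
    'D_v (fun y => (phi y).2 0 l) x * 'D_(dirIm R l) f (phi x))).
  apply: Ck_sum => l; apply: CkD => //; apply: CkM => //.
  - by have [s _] := sphi l; apply: smooth_derive.
  - by apply: (IH (fun y => 'D_(dirRe R l) f y)); exact: smooth_derive.
  - by have [_ s] := sphi l; apply: smooth_derive.
  - by apply: (IH (fun y => 'D_(dirIm R l) f y)); exact: smooth_derive.
apply: Ck_eq oU _ E => x Ux; have [_ ->] := D x Ux.
rewrite (derive_coords _ oW sf (phiW Ux)); apply: eq_bigr => l _.
by rewrite /map_derive /= !mxE.
Qed.

Lemma csmooth_comp (F : Cn R m -> R[i]) : csmooth W F ->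
  csmooth U (fun x => F (phi x)).
Proof.
move=> [sr si]; split; first exact: (smooth_comp sr).
exact: (smooth_comp si).
Qed.

Lemma ccoord_map_derive v x k :
  ccoord (map_derive phi v x) k = cderive (fun y => ccoord (phi y) k) v x.
Proof. by rewrite /ccoord /map_derive /= !mxE. Qed.

Lemma cderive_chain (F : Cn R m -> R[i]) v x : csmooth W F -> U x ->
  cderive (fun y => F (phi y)) v x = cderive F (map_derive phi v x) (phi x).
Proof.
move=> [sr si] Ux; rewrite /cderive.
have [_ ->] := is_derive_chain v oW Ux (phiW Ux) sphi sr.
by have [_ ->] := is_derive_chain v oW Ux (phiW Ux) sphi si.
Qed.

Lemma cderive_chain_wirtinger (F : Cn R m -> R[i]) v x : csmooth W F -> U x ->
  cderive (fun y => F (phi y)) v x =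
  \sum_k (cderive (fun y => ccoord (phi y) k) v x * del k F (phi x) +
          conjc (cderive (fun y => ccoord (phi y) k) v x) * delbar k F (phi x)).
Proof.
move=> sF Ux; rewrite cderive_chain// (cderive_wirtinger _ oW sF (phiW Ux)).
by apply: eq_bigr => k _; rewrite ccoord_map_derive.
Qed.

End SmoothComp.

(** * Pullback of the complex Hessian by holomorphic maps *)

Section HolomorphicChain.
Variables (R : realType) (n m : nat).
Variables (U : set (Cn R n)) (W : set (Cn R m)) (phi : Cn R n -> Cn R m).

Definition holo_map :=
  forall k, holomorphic U (fun p => ccoord (phi p) k).

(* The differential acts on row vectors, so that a (1,1)-form G pulls back to
   [jac p *m G *m ctrmx (jac p)]. *)
Definition jac (p : Cn R n) : 'M[R[i]]_(n, m) :=
  \matrix_(a, k) del a (fun q => ccoord (phi q) k) p.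

Hypotheses (oU : open U) (oW : open W) (hphi : holo_map).
Hypothesis phiW : forall x, U x -> W (phi x).

Let sphi : csmooth_map U phi. Proof. by move=> k; have [] := hphi k. Qed.

(** Common regrouping for both chain rules: s = - 'i gives [del], s = 'i gives [delbar]. *)
Lemma wirtinger_sum (x y d e : 'I_m -> R[i]) (s : R[i]) :
  2^-1 * (\sum_k (x k * d k + conjc (x k) * e k) +
   s * \sum_k (y k * d k + conjc (y k) * e k)) =
  \sum_k (d k * (2^-1 * (x k + s * y k)) +
          e k * (2^-1 * (conjc (x k) + s * conjc (y k)))).
Proof.
rewrite mulr_sumr -big_split /= mulr_sumr; apply: eq_bigr => k _.
by move: (conjc (x k)) (conjc (y k)) (x k) (y k) (d k) (e k) => *; ring.
Qed.

Lemma del_chain (F : Cn R m -> R[i]) a p : csmooth W F -> U p ->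
  del a (fun q => F (phi q)) p =
  \sum_k del k F (phi p) * del a (fun q => ccoord (phi q) k) p.
Proof.
move=> sF Up; rewrite {1}/del.
rewrite !(cderive_chain_wirtinger oW sphi phiW _ sF Up) -mulNr wirtinger_sum.
apply: eq_bigr => k _; rewrite [X in _ + X](_ : _ = 0) ?addr0.
  by rewrite /del mulNr.
(* The coefficient of [delbar k F] is the conjugate of [delbar a] of a component of phi, which
   vanishes by holomorphy. *)
have := (hphi k).2 p Up a; rewrite /delbar.
move: (cderive _ _ p) (cderive _ _ p) => x y E.
have : conjc (2^-1 * (y + 'i * x)) = 0 by rewrite E conjc0.
by rewrite conjcM conjcD conjcM conjci conjc_half => ->; rewrite mulr0.
Qed.

Lemma delbar_chain (F : Cn R m -> R[i]) a p : csmooth W F -> U p ->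
  delbar a (fun q => F (phi q)) p =
  \sum_k delbar k F (phi p) * conjc (del a (fun q => ccoord (phi q) k) p).
Proof.
move=> sF Up; rewrite {1}/delbar.
rewrite !(cderive_chain_wirtinger oW sphi phiW _ sF Up) wirtinger_sum.
apply: eq_bigr => k _.
have E := (hphi k).2 p Up a; rewrite /delbar in E.
rewrite E mulr0 add0r /del conjcM conjcB conjcM conjci conjc_half.
by rewrite mulNr opprK.
Qed.

(** No second derivatives of phi survive: they enter through [del a] of the conjugate of [del b]
    phi_k, the conjugate of [delbar a] [del b] phi_k, and this is 0 because [del] and [delbar]
    commute. *)
Lemma ddbar_chain (F : Cn R m -> R[i]) p : csmooth W F -> U p ->
  ddbar (fun q => F (phi q)) p =
  jac p *m ddbar F (phi p) *m (map_mx conjc (jac p))^T.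
Proof.
move=> sF Up; apply/matrixP => a b.
have E : {in U, forall q, delbar b (fun q => F (phi q)) q =
   \sum_k delbar k F (phi q) * conjc (del b (fun q => ccoord (phi q) k) q)}.
  by move=> q; rewrite inE => Uq; exact: delbar_chain.
have sk k : csmooth U (fun q => delbar k F (phi q)).
  by apply: (csmooth_comp oU oW sphi phiW); exact: csmooth_delbar.
have sJ k : csmooth U (fun q => conjc (del b (fun q => ccoord (phi q) k) q)).
  by apply: csmoothJ => //; apply: csmooth_del.
have JZ k : del a (fun q => conjc (del b (fun q => ccoord (phi q) k) q)) p = 0.
  rewrite (delJ _ (csmooth_del oU b (sphi k)) Up) -(delC oU _ _ (sphi k) Up).
  rewrite (del_eq oU b Up (G := fun=> 0)) ?del_cst ?conjc0//.
  by move=> q Uq; exact: (hphi k).2.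
rewrite [LHS]mxE (del_eq oU a Up (G := fun q => \sum_k delbar k F (phi q) *
   conjc (del b (fun q => ccoord (phi q) k) q))); last first.
  by move=> q Uq; apply: E; rewrite inE.
rewrite (del_sum oU _ _ _ _ Up); last by move=> k; exact: csmoothM.
rewrite [RHS]mxE; apply: eq_bigr => k _.
rewrite (delM _ (sk k) (sJ k) Up) JZ mulr0 add0r.
rewrite (del_chain _ (csmooth_delbar oW k sF) Up).
rewrite [in RHS]mxE [in X in _ = _ * X]mxE [in X in _ = _ * X]mxE mulrC [RHS]mulrC.
rewrite [in X in _ = X * _]mxE; congr (_ * _); apply: eq_bigr => l _.
by rewrite ![in RHS]mxE mulrC.
Qed.

End HolomorphicChain.

Lemma ddbarE (R : realType) n (F : Cn R n -> R[i]) p a b :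
  ddbar F p a b = del a (delbar b F) p.
Proof. by rewrite mxE. Qed.

Lemma ddbarRE (R : realType) n (f : Cn R n -> R) p a b :
  ddbarR f p a b = del a (delbar b (fun q => (f q)%:C)) p.
Proof. by rewrite mxE. Qed.

(** * Logarithms and complex Hessians *)

Section Logarithm.
Variables (R : realType) (n : nat) (U : set (Cn R n)).
Hypothesis oU : open U.

Lemma cderive_ln (f : Cn R n -> R) v p : (forall q, U q -> 0 < f q) ->
  smooth U f -> U p ->
  cderive (fun q => (ln (f q))%:C) v p = (f p)^-1%:C * cderive (fun q => (f q)%:C) v p.
Proof.
move=> f0 sf Up; rewrite /cderive /=.
have [_ ->] := is_derive_ln (f0 p Up) (smooth_derivable (v := v) sf Up).
have -> : 'D_v (fun=> 0 : R) p = 0 by exact: derive_cst.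
by apply: complexP => /=; move: ('D_v _ p) => *; ring.
Qed.

Lemma del_ln (f : Cn R n -> R) a p : (forall q, U q -> 0 < f q) ->
  smooth U f -> U p ->
  del a (fun q => (ln (f q))%:C) p = (f p)^-1%:C * del a (fun q => (f q)%:C) p.
Proof.
move=> f0 sf Up; rewrite /del !(cderive_ln _ f0 sf Up).
by move: (cderive _ _ p) (cderive _ _ p) (_%:C) => *; ring.
Qed.

Lemma delbar_ln (f : Cn R n -> R) a p : (forall q, U q -> 0 < f q) ->
  smooth U f -> U p ->
  delbar a (fun q => (ln (f q))%:C) p = (f p)^-1%:C * delbar a (fun q => (f q)%:C) p.
Proof.
move=> f0 sf Up; rewrite /delbar !(cderive_ln _ f0 sf Up).
by move: (cderive _ _ p) (cderive _ _ p) (_%:C) => *; ring.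
Qed.

(** For f = |S|^-2 this splits the metric into a rank one term, which controls the fiber direction,
    and the Hessian of log f, which is the pulled back curvature. *)
Lemma ddbar_exp (f l : Cn R n -> R) p a b : (forall q, U q -> 0 < f q) ->
  (forall q, U q -> l q = ln (f q)) -> smooth U f -> U p ->
  ddbarR f p a b = (f p)%:C * (del a (fun q => (l q)%:C) p *
     delbar b (fun q => (l q)%:C) p + ddbarR l p a b).
Proof.
move=> f0 lE sf Up; apply: etrans (ddbarRE f p a b) _.
apply: etrans (congr1 (fun t => (f p)%:C * (_ + t)) (esym (ddbarRE l p a b))).
have fC q : U q -> (f q)%:C * (f q)^-1%:C = 1.
  by move=> /f0 fq; rewrite -rmorphM /= divff ?gt_eqF.
have lCE q : U q -> (l q)%:C = (ln (f q))%:C by move=> /lE ->.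
have sl : csmooth U (fun q => (l q)%:C).
  apply: csmooth_eq (fun q Uq => esym (lCE q Uq)) _ => //.
  exact/csmooth_real/smooth_ln.
have dl c q : U q -> del c (fun q => (f q)%:C) q = (f q)%:C * del c (fun q => (l q)%:C) q.
  by move=> Uq; rewrite (del_eq oU c Uq lCE) (del_ln c f0 sf Uq) mulrA fC// mul1r.
have dbl c q : U q ->
    delbar c (fun q => (f q)%:C) q = (f q)%:C * delbar c (fun q => (l q)%:C) q.
  by move=> Uq; rewrite (delbar_eq oU c Uq lCE) (delbar_ln c f0 sf Uq) mulrA fC// mul1r.
rewrite (del_eq oU a Up (dbl b)).
rewrite (delM _ (csmooth_real sf) (csmooth_delbar oU b sl) Up) dl//.
by rewrite mulrDr addrC mulrA.
Qed.

(** No branch of log F is chosen: delbar log |F|^2 is the conjugate of del F / F, hence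
    antiholomorphic, and [del] kills it. *)
Lemma ddbar_ln_sqnorm (F : Cn R n -> R[i]) p : holomorphic U F ->
  (forall q, U q -> F q != 0) -> U p ->
  ddbarR (fun q => ln (complex.Re (F q * conjc (F q)))) p = 0.
Proof.
move=> [sF hF] F0 Up; apply/matrixP => a b; rewrite ddbarRE [RHS]mxE.
have gC q : (complex.Re (F q * conjc (F q)))%:C = F q * conjc (F q).
  by case: (F q) => x y; apply: complexP => //=; ring.
have g0 q : U q -> 0 < complex.Re (F q * conjc (F q)).
  move=> /F0 Fq; have : 0 < F q * conjc (F q).
    by rewrite lt_def mulcJ_ge0 andbT mulf_neq0// conjc_eq0.
  by rewrite -gC ltcR.
have sJ := csmoothJ oU sF.
have sFJ : csmooth U (fun q => F q * conjc (F q)) by exact: csmoothM.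
have sg : smooth U (fun q => complex.Re (F q * conjc (F q))) by have [] := sFJ.
have F0J q : U q -> conjc (F q) != 0 by move=> /F0; rewrite conjc_eq0.
rewrite (del_eq oU a Up (G := fun q => conjc (del b F q / F q))).
  have sb := csmooth_del oU b sF; have sV := csmoothV oU F0 sF.
  rewrite (delJ _ _ Up); last exact: csmoothM.
  rewrite (delbarM _ sb sV Up) (delbarV oU _ F0 sF Up) hF// mul0r oppr0 mulr0 add0r.
  rewrite -(delC oU _ _ sF Up) (del_eq oU b Up (G := fun=> 0)) ?del_cst ?mul0r ?conjc0//.
  by move=> q Uq; exact: hF.
move=> q Uq; rewrite (delbar_ln b g0 sg Uq).
under eq_fun do rewrite gC.
rewrite (delbarM _ sF sJ Uq) hF// mul0r addr0 (delbarJ _ sF Uq).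
have -> : (complex.Re (F q * conjc (F q)))^-1%:C = (F q * conjc (F q))^-1.
  by rewrite complexR_inv gC.
rewrite (conjcM (del b F q)) conjc_inv; have := F0 q Uq; have := F0J q Uq.
move: (conjc (F q)) (F q) (conjc (del b F q)) => x y z x0 y0.
by field; rewrite x0 y0.
Qed.

End Logarithm.

(** * Formal series of matrices and Hermitian forms *)

Section TriangleSum.
Lemma triangle_exchange (V : nmodType) (m : nat) (F : nat -> nat -> V) :
  \sum_(l < m.+1) \sum_(k < (m - l).+1) F l k =
  \sum_(k < m.+1) \sum_(l < (m - k).+1) F l k.
Proof.
have E (G : nat -> nat -> V) : \sum_(l < m.+1) \sum_(k < (m - l).+1) G l k =
    \sum_(l < m.+1) \sum_(k < m.+1 | (l + k <= m)%N) G l k.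
  apply: eq_bigr => l _; rewrite (big_ord_widen m.+1 (G l)) ?ltnS ?leq_subr//.
  by apply: eq_bigl => k; rewrite ltnS leq_subRL// -ltnS ltn_ord.
rewrite E (E (fun k l => F l k)) (exchange_big_dep xpredT)//=.
by apply: eq_bigr => k _; apply: eq_bigl => l; rewrite addnC.
Qed.
End TriangleSum.

Section SeriesPow.
Variables (K : fieldType) (n : nat).
Implicit Types (A B : nat -> 'M[K]_n).

(** Conjugate transposition reverses products, so the recursion is also needed with the new factor
    on the right. *)
Lemma series_powSr A p m : series_pow A p.+1 m =
  \sum_(l < m.+1) series_pow A p (m - l) *m A l.
Proof.
elim: p m => [|p IH] m.
  have nz (l : 'I_m.+1) : l != ord_max -> ((m - l)%N == 0%N) = false.
    rewrite -val_eqE /= => lm; apply/negbTE; rewrite subn_eq0 -ltnNge.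
    by rewrite ltn_neqAle lm -ltnS ltn_ord.
  rewrite /= (bigD1 ord_max)//= subnn eqxx mulmx1 big1 ?addr0; last first.
    by move=> l /nz ->; rewrite mulmx0.
  rewrite (bigD1 ord_max)//= subnn eqxx mul1mx big1 ?addr0//.
  by move=> l /nz ->; rewrite mul0mx.
rewrite [LHS]/=.
transitivity (\sum_(l < m.+1) \sum_(k < (m - l).+1)
    A l *m (series_pow A p (m - l - k) *m A k)).
  by apply: eq_bigr => l _; rewrite -mulmx_sumr -IH.
rewrite (triangle_exchange m (fun l k => A l *m (series_pow A p (m - l - k) *m A k))).
apply: eq_bigr => k _; rewrite [series_pow _ _ _]/= mulmx_suml.
by apply: eq_bigr => l _; rewrite -mulmxA subnAC.
Qed.

Lemma series_pow_conj (c : K) (Q : 'M[K]_n) A B p m : Q \in unitmx ->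
  (forall l, A l = c ^+ l *: (invmx Q *m B l *m Q)) ->
  series_pow A p m = c ^+ m *: (invmx Q *m series_pow B p m *m Q).
Proof.
move=> uQ AB; elim: p m => [|p IH] m /=.
  case: eqP => [->|_]; first by rewrite expr0 scale1r mulmx1 mulVmx.
  by rewrite mulmx0 mul0mx scaler0.
rewrite mulmx_sumr mulmx_suml scaler_sumr; apply: eq_bigr => l _.
rewrite AB IH -scalemxAl -scalemxAr scalerA -exprD subnKC -1?ltnS//.
by congr (_ *: _); rewrite !mulmxA mulmxK.
Qed.

(** The trace forgets Q and the weights add up to c^m. Used with Q the adjoint of a Jacobian for
    naturality, and with c = 1 and Q the metric for reality. *)
Lemma trlog_comp_conj (c : K) (Q : 'M[K]_n) A B m : Q \in unitmx ->
  (forall l, A l = c ^+ l *: (invmx Q *m B l *m Q)) ->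
  trlog_comp A m = c ^+ m * trlog_comp B m.
Proof.
move=> uQ AB; rewrite /trlog_comp mulr_sumr; apply: eq_bigr => p _.
rewrite (series_pow_conj p m uQ AB) mxtraceZ mxtrace_mulC mulmxA mulmxV//.
by rewrite mul1mx mulrCA.
Qed.

End SeriesPow.

Section Hermitian.
Variables (R : rcfType) (n : nat).
Implicit Types (G : 'M[R[i]]_n).

Definition ctrmx m k (A : 'M[R[i]]_(m, k)) : 'M[R[i]]_(k, m) := (map_mx conjc A)^T.

Lemma ctrmxM m k l (A : 'M[R[i]]_(m, k)) (B : 'M[R[i]]_(k, l)) :
  ctrmx (A *m B) = ctrmx B *m ctrmx A.
Proof. by rewrite /ctrmx map_mxM trmx_mul. Qed.

Lemma ctrmx_sum m k (I : Type) (r : seq I) (P : pred I) (F : I -> 'M[R[i]]_(m, k)) :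
  ctrmx (\sum_(i <- r | P i) F i) = \sum_(i <- r | P i) ctrmx (F i).
Proof. by rewrite /ctrmx map_mx_sum linear_sum. Qed.

(** The adjoint of G^-1 H_l is H_l G^-1 = G (G^-1 H_l) G^-1, one conjugation for all l. Adjoints
    reverse the order of products, which [series_powSr] absorbs. *)
Lemma trlog_comp_real (G : 'M[R[i]]_n) (H : nat -> 'M[R[i]]_n) m :
  G \in unitmx -> ctrmx G = G -> (forall l, ctrmx (H l) = H l) ->
  conjc (trlog_comp (fun l => invmx G *m H l) m) =
  trlog_comp (fun l => invmx G *m H l) m.
Proof.
move=> uG hG hH; set A := fun l => _.
pose B l := ctrmx (A l).
have iG : ctrmx (invmx G) = invmx G.
  by rewrite /ctrmx map_invmx trmx_inv -/(ctrmx G) hG.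
have BE l : A l = 1 ^+ l *: (invmx G *m B l *m G).
  by rewrite expr1n scale1r /B /A ctrmxM hH iG -!mulmxA mulVmx// mulmx1.
have SB p k : ctrmx (series_pow A p k) = series_pow B p k.
  elim: p k => [|p IH] k.
    rewrite /=; case: eqP => _; first by rewrite /ctrmx map_mx1 trmx1.
    by rewrite /ctrmx map_mx0 trmx0.
  rewrite series_powSr ctrmx_sum /=; apply: eq_bigr => l _.
  by rewrite ctrmxM IH.
rewrite [RHS](trlog_comp_conj m uG BE) expr1n mul1r /trlog_comp conjc_sum.
apply: eq_bigr => p _; rewrite -SB conjcM; congr (_ * _).
  by rewrite conjcM conjc_inv conjc_nat rmorphXn rmorphN1.
by rewrite /ctrmx mxtrace_tr trace_map_mx.
Qed.

(** By the spectral theorem the determinant is the product of the eigenvalues, each the value of the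
    form at a row of the unitary matrix. In the order of R[i] the conclusion includes that the
    determinant is real. *)
Lemma posdef_det_gt0 G : ctrmx G = G ->
  (forall v : 'rV[R[i]]_n, v != 0 ->
     0 < \sum_a \sum_b G a b * v 0 a * conjc (v 0 b)) ->
  0 < \det G.
Proof.
move=> hG pG.
have nG : G \is normalmx.
  apply: hermitian_normalmx; apply/is_hermitianmxP.
  by rewrite expr0 scale1r -{1}hG /ctrmx map_trmx.
have /orthomx_spectralP E := nG.
set P := spectralmx G in E; set D := spectral_diag G in E.
have uP : P \in unitmx by exact: spectral_unit.
have unP : P *m ctrmx P = 1%:M.
  have /unitarymxP := spectral_unitarymx G.
  by rewrite -map_trmx.
have iP : invmx P = ctrmx P.
  by rewrite -[LHS]mulmx1 -unP mulmxA mulVmx// mul1mx.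
have dE i : D 0 i = (P *m G *m ctrmx P) i i.
  by rewrite E -iP !mulmxA mulmxV// mul1mx mulmxK// mxE eqxx mulr1n.
have -> : \det G = \prod_i D 0 i.
  by rewrite E !det_mulmx mulrAC -det_mulmx mulVmx// det1 mul1r det_diag.
apply: prodr_gt0 => i _; rewrite dE.
have : 0 < \sum_a \sum_b G a b * row i P 0 a * conjc (row i P 0 b).
  apply: pG; apply/negP => /eqP ri0; have := congr1 (fun M => row i M) unP.
  rewrite /= row_mul ri0 mul0mx => /rowP/(_ i); rewrite !mxE eqxx => /eqP.
  by rewrite eq_sym oner_eq0.
congr (_ < _); rewrite [RHS]mxE exchange_big; apply: eq_bigr => b _.
rewrite !mxE mulr_suml; apply: eq_bigr => a _.
by rewrite !mxE (mulrC (G a b)).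
Qed.

End Hermitian.

(** * The i del delbar operator and naturality of the trace-log series *)

Section MatrixSmooth.
Variables (R : realType) (V : normedModType R) (U : set V).
Hypothesis oU : open U.

Definition msmooth m n (M : V -> 'M[R[i]]_(m, n)) :=
  forall a b, csmooth U (fun q => M q a b).

Lemma msmooth_eq m n (M N : V -> 'M[R[i]]_(m, n)) :
  (forall q, U q -> M q = N q) -> msmooth M -> msmooth N.
Proof.
by move=> MN sM a b; apply: csmooth_eq (sM a b) => // q Uq; rewrite MN.
Qed.

Lemma msmooth_cst m n (M : 'M[R[i]]_(m, n)) : msmooth (fun=> M).
Proof. by move=> a b; exact: csmooth_cst. Qed.

Lemma msmoothM m n p (M : V -> 'M[R[i]]_(m, n)) (N : V -> 'M[R[i]]_(n, p)) :
  msmooth M -> msmooth N -> msmooth (fun q => M q *m N q).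
Proof.
move=> sM sN a b; under eq_fun do rewrite mxE.
by apply: csmooth_sum => // k; exact: csmoothM.
Qed.

Lemma msmoothN m n (M : V -> 'M[R[i]]_(m, n)) :
  msmooth M -> msmooth (fun q => - M q).
Proof. by move=> sM a b; under eq_fun do rewrite mxE; exact: csmoothN. Qed.

Lemma msmooth_sum m n (I : Type) (r : seq I) (P : pred I)
    (M : I -> V -> 'M[R[i]]_(m, n)) :
  (forall i, msmooth (M i)) -> msmooth (fun q => \sum_(i <- r | P i) M i q).
Proof.
move=> sM a b; under eq_fun do rewrite summxE.
by apply: csmooth_sum => // k; exact: sM.
Qed.

Lemma csmooth_det n (M : V -> 'M[R[i]]_n) : msmooth M -> csmooth U (fun q => \det (M q)).
Proof.
move=> sM; apply: csmooth_sum => // s; apply: csmoothM => //.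
  exact: csmooth_cst.
by apply: csmooth_prod => // i; exact: sM.
Qed.

Lemma csmooth_tr n (M : V -> 'M[R[i]]_n) : msmooth M -> csmooth U (fun q => \tr (M q)).
Proof. by move=> sM; apply: csmooth_sum => // i; exact: sM. Qed.

Lemma msmooth_inv n (M : V -> 'M[R[i]]_n) :
  (forall q, U q -> \det (M q) != 0) -> msmooth M -> msmooth (fun q => invmx (M q)).
Proof.
move=> M0 sM.
apply: (@msmooth_eq _ _ (fun q => (\det (M q))^-1 *: \adj (M q))).
  by move=> q /M0 Mq; rewrite /invmx unitmxE unitfE Mq.
move=> a b; under eq_fun do rewrite mxE.
apply: csmoothM => //; first by apply: csmoothV => //; exact: csmooth_det.
under eq_fun do rewrite mxE /cofactor.
apply: csmoothM => //; first exact: csmooth_cst.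
by apply: csmooth_det => i j; under eq_fun do rewrite !mxE; exact: sM.
Qed.

Lemma msmooth_series_pow n (A : V -> nat -> 'M[R[i]]_n) p m :
  (forall l, (l <= m)%N -> msmooth (fun q => A q l)) ->
  msmooth (fun q => series_pow (A q) p m).
Proof.
elim: p m => [|p IH] m sA /=; first exact: msmooth_cst.
apply: msmooth_sum => l; apply: msmoothM; first by apply: sA; rewrite -ltnS.
by apply: IH => k km; apply: sA; apply: leq_trans km (leq_subr _ _).
Qed.

Lemma csmooth_trlog n (A : V -> nat -> 'M[R[i]]_n) m :
  (forall l, (l <= m)%N -> msmooth (fun q => A q l)) ->
  csmooth U (fun q => trlog_comp (A q) m).
Proof.
move=> sA; apply: csmooth_sum => // p; apply: csmoothM => //.
  exact: csmooth_cst.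
by apply: csmooth_tr; exact: msmooth_series_pow.
Qed.

End MatrixSmooth.

Lemma eq_series_pow (K : fieldType) n (A B : nat -> 'M[K]_n) p m :
  (forall l, (l <= m)%N -> A l = B l) -> series_pow A p m = series_pow B p m.
Proof.
elim: p m => [//|p IH] m AB /=; apply: eq_bigr => l _.
rewrite AB -1?ltnS// IH// => k km; apply: AB; apply: leq_trans km (leq_subr _ _).
Qed.

Lemma eq_trlog_comp (K : fieldType) n (A B : nat -> 'M[K]_n) m :
  (forall l, (l <= m)%N -> A l = B l) -> trlog_comp A m = trlog_comp B m.
Proof.
move=> AB; apply: eq_bigr => p _; congr (_ * \tr _); exact: eq_series_pow.
Qed.

Section DDbar.
Variables (R : realType) (n : nat) (U : set (Cn R n)).
Hypothesis oU : open U.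
Implicit Types (f g : Cn R n -> R) (p : Cn R n).

Lemma ddbar_eq (F G : Cn R n -> R[i]) p : U p -> (forall q, U q -> F q = G q) ->
  ddbar F p = ddbar G p.
Proof.
move=> Up FG; apply/matrixP => a b.
apply: etrans (ddbarE F p a b) _; apply: etrans (esym (ddbarE G p a b)).
by apply: (del_eq oU a Up) => q Uq; exact: delbar_eq Uq FG.
Qed.

Lemma ddbarR_eq f g p : U p -> (forall q, U q -> f q = g q) ->
  ddbarR f p = ddbarR g p.
Proof. by move=> Up fg; apply: ddbar_eq => // q /fg ->. Qed.

Lemma ddbarD (F G : Cn R n -> R[i]) p : csmooth U F -> csmooth U G -> U p ->
  ddbar (fun q => F q + G q) p = ddbar F p + ddbar G p.
Proof.
move=> sF sG Up; apply/matrixP => a b; rewrite [RHS]mxE.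
apply: etrans (ddbarE _ p a b) _.
apply: etrans (esym (congr2 +%R (ddbarE F p a b) (ddbarE G p a b))).
rewrite -(delD a (csmooth_delbar oU b sF) (csmooth_delbar oU b sG) Up).
by apply: (del_eq oU a Up) => q Uq; exact: delbarD sF sG Uq.
Qed.

Lemma ddbarZ (c : R[i]) (F : Cn R n -> R[i]) p : csmooth U F -> U p ->
  ddbar (fun q => c * F q) p = c *: ddbar F p.
Proof.
move=> sF Up; apply/matrixP => a b; rewrite [RHS]mxE.
apply: etrans (ddbarE _ p a b) _.
apply: etrans (esym (congr1 ( *%R c) (ddbarE F p a b))).
rewrite -(delZ c a (csmooth_delbar oU b sF) Up).
by apply: (del_eq oU a Up) => q Uq; exact: delbarZ sF Uq.
Qed.

Lemma ddbarRD f g p : smooth U f -> smooth U g -> U p ->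
  ddbarR (fun q => f q + g q) p = ddbarR f p + ddbarR g p.
Proof.
move=> sf sg Up; rewrite -[RHS](ddbarD (csmooth_real sf) (csmooth_real sg) Up).
by apply: ddbar_eq => // q Uq; rewrite rmorphD.
Qed.

Lemma ddbarRZ (c : R) f p : smooth U f -> U p ->
  ddbarR (fun q => c * f q) p = c%:C *: ddbarR f p.
Proof.
move=> sf Up; rewrite -[RHS](ddbarZ _ (csmooth_real sf) Up).
by apply: ddbar_eq => // q Uq; rewrite rmorphM.
Qed.

Lemma ddbarR_cst (c : R) p : ddbarR (fun=> c) p = 0.
Proof.
apply/matrixP => a b; apply: etrans (ddbarRE (fun=> c) p a b) _; rewrite mxE.
rewrite (_ : delbar b _ = fun=> 0) ?del_cst//.
by apply/funext => q; exact: delbar_cst.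
Qed.

Lemma ddbar_herm f p : smooth U f -> U p -> ctrmx (ddbarR f p) = ddbarR f p.
Proof.
move=> sf Up; apply/matrixP => a b; rewrite !mxE.
have sF := csmooth_real sf.
rewrite -(delbarJ _ (csmooth_delbar oU a sF) Up) (delC oU _ _ sF Up).
apply: (delbar_eq oU b Up) => q Uq.
rewrite -(delJ _ sF Uq); apply: (del_eq oU a Uq) => r _.
exact: conjc_real.
Qed.

Lemma msmooth_ddbar (F : Cn R n -> R[i]) : csmooth U F -> msmooth U (ddbar F).
Proof.
move=> sF a b; apply: (csmooth_eq oU (F := fun q => del a (delbar b F) q)).
  by move=> q _; rewrite ddbarE.
by apply: csmooth_del => //; exact: csmooth_delbar.
Qed.

Lemma msmooth_ddbarR f : smooth U f -> msmooth U (ddbarR f).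
Proof. by move=> sf; apply: msmooth_ddbar; exact: csmooth_real. Qed.

(** Records exactly what inverting the metric and taking log det demand; both are used on every
    chart of E'. *)
Definition metric_pot f :=
  smooth U f /\ forall p, U p -> 0 < \det (ddbarR f p).

Lemma metric_pot_unit f p : metric_pot f -> U p -> ddbarR f p \in unitmx.
Proof. by move=> [_ /(_ p)] + Up => /(_ Up) d0; rewrite unitmxE unitfE gt_eqF. Qed.

Definition logdet f q := ln (complex.Re (\det (ddbarR f q))).

Lemma Re_det_gt0 f p : metric_pot f -> U p -> 0 < complex.Re (\det (ddbarR f p)).
Proof. by move=> [_ H] Up; have := H p Up; rewrite ltcE => /andP[]. Qed.

Lemma smooth_logdet f : metric_pot f -> smooth U (logdet f).
Proof.
move=> mf; apply: smooth_ln => //; first by move=> q; exact: Re_det_gt0.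
by have [] := csmooth_det oU (msmooth_ddbarR mf.1).
Qed.

Lemma ricE f p : ric (ddbarR f) p = - ddbarR (logdet f) p.
Proof. by []. Qed.

(** The bound l + 2 <= m is the triangularity behind the whole recursion: omega_0^-1 del delbar
    u_(l) sits in weight l + 2. *)
Lemma msmooth_pert f (u : nat -> Cn R n -> R) m : metric_pot f ->
  (forall l, (0 < l)%N -> (l + 2 <= m)%N -> smooth U (u l)) ->
  msmooth U (fun q => pert_comp f u q m).
Proof.
move=> mf su.
have si : msmooth U (fun q => invmx (ddbarR f q)).
  by apply: msmooth_inv (msmooth_ddbarR mf.1) => // q Uq; rewrite gt_eqF// mf.2.
case: m su => [|[|[|k]]] su /=; try exact: msmooth_cst.
  apply: msmoothN => //; apply: msmoothM => //.
  apply: (msmooth_eq oU (fun q _ => esym (ricE f q))).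
  by apply: msmoothN => //; apply: msmooth_ddbarR; exact: smooth_logdet.
apply: msmoothM => //; apply: msmooth_ddbarR; apply: su => //.
by rewrite addn2.
Qed.

Lemma csmooth_trlog_pert f (u : nat -> Cn R n -> R) m : metric_pot f ->
  (forall l, (0 < l)%N -> (l + 2 <= m)%N -> smooth U (u l)) ->
  csmooth U (fun q => trlog_comp (pert_comp f u q) m).
Proof.
move=> mf su; apply: csmooth_trlog => // l lm; apply: msmooth_pert => // k k0 kl.
by apply: su => //; apply: leq_trans kl lm.
Qed.

Lemma trlog_pert_real f (u : nat -> Cn R n -> R) m p : metric_pot f ->
  (forall l, (0 < l)%N -> (l + 2 <= m)%N -> smooth U (u l)) -> U p ->
  (complex.Re (trlog_comp (pert_comp f u p) m))%:C = trlog_comp (pert_comp f u p) m.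
Proof.
move=> mf su Up.
(* Cut off above weight m: the hypotheses say nothing about higher terms, and weight m of Tr log
   does not see them. *)
pose H l : 'M[R[i]]_n := if (l <= m)%N then match l with
  | 0%N | 1%N => 0
  | 2%N => - ric (ddbarR f) p
  | k.+3 => ddbarR (u k.+1) p
  end else 0.
have E l : (l <= m)%N -> pert_comp f u p l = invmx (ddbarR f p) *m H l.
  move=> lm; rewrite /H lm; case: l lm => [|[|[|k]]] lm //=; rewrite ?mulmx0//.
  by symmetry; exact: mulmxN.
rewrite (eq_trlog_comp E).
have : conjc (trlog_comp (fun l => invmx (ddbarR f p) *m H l) m) =
   trlog_comp (fun l => invmx (ddbarR f p) *m H l) m.
  apply: trlog_comp_real; first exact: metric_pot_unit.
    by apply: ddbar_herm => //; exact: mf.1.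
  have c0 : ctrmx (0 : 'M[R[i]]_n) = 0 by rewrite /ctrmx map_mx0 trmx0.
  move=> l; rewrite /H; case: leqP => lm //; case: l lm => [|[|[|k]]] lm //.
    rewrite ricE opprK; apply: ddbar_herm => //; exact: smooth_logdet.
  by apply: ddbar_herm => //; apply: su => //; rewrite addn2.
case: (trlog_comp _ m) => x y /= [] /eqP; rewrite -subr_eq0 -opprD oppr_eq0.
rewrite -mulr2n mulrn_eq0 /= => /eqP ->; exact: complexP.
Qed.

End DDbar.

(** If two forms are pulled back together, J cancels in G^-1 H and Q merely conjugates it. Applied
    with Q the adjoint of J, s = c^2, and a the factor picked up by the second form. *)
Lemma invmx_congruence (K : fieldType) n (G G' J Q H : 'M[K]_n) (s a : K) :
  s != 0 -> G \in unitmx -> G' \in unitmx -> Q \in unitmx ->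
  G = s^-1 *: (J *m G' *m Q) ->
  invmx G *m (a *: (J *m H *m Q)) =
  (s * a) *: (invmx Q *m (invmx G' *m H) *m Q).
Proof.
move=> s0 uG uG' uQ GE; apply: (can_inj (mulKmx uG)); rewrite mulKVmx//.
rewrite [in RHS]GE -scalemxAl -scalemxAr scalerA mulKf//; congr (_ *: _).
rewrite !mulmxA; congr (_ *m _); rewrite -!mulmxA; congr (_ *m _).
by rewrite mulKVmx// mulKVmx.
Qed.

Lemma Re_mulcJ (R : rcfType) (z : R[i]) :
  (complex.Re (z * conjc z))%:C = z * conjc z.
Proof. by case: z => x y; apply: complexP => //=; ring. Qed.

Lemma Re_mulcJ_gt0 (R : rcfType) (z : R[i]) : z != 0 ->
  0 < complex.Re (z * conjc z).
Proof.
move=> z0; rewrite -ltcR Re_mulcJ lt_def mulcJ_ge0 andbT.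
by rewrite mulf_neq0 ?conjc_eq0.
Qed.

Lemma ln_Re_split (R : realType) (a : R) n (z y : R[i]) :
  0 < a -> z != 0 -> 0 < complex.Re y ->
  ln (complex.Re (a%:C ^+ n * (z * conjc z) * y)) =
  ln (a ^+ n) + ln (complex.Re (z * conjc z)) + ln (complex.Re y).
Proof.
move=> a0 z0 y0; have N0 := Re_mulcJ_gt0 z0.
rewrite -[in LHS]Re_mulcJ -rmorphXn -rmorphM.
have -> (x : R) : complex.Re (x%:C * y) = x * complex.Re y.
  by rewrite cReM /= mul0r subr0.
by rewrite !lnM ?posrE ?mulr_gt0 ?exprn_gt0.
Qed.

(** * Ricci form and trace-log under holomorphic maps that rescale the metric *)

Section Naturality.
Variables (R : realType) (n : nat) (U W : set (Cn R n)) (phi : Cn R n -> Cn R n).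
Hypotheses (oU : open U) (oW : open W) (hphi : holo_map U phi).
Hypothesis phiW : forall q, U q -> W (phi q).

Let sphi : csmooth_map U phi. Proof. by move=> k; have [] := hphi k. Qed.

Lemma ddbarR_chain (c : R) (f g : Cn R n -> R) p : smooth W g -> U p ->
  (forall q, U q -> f q = c * g (phi q)) ->
  ddbarR f p = c%:C *: (jac phi p *m ddbarR g (phi p) *m ctrmx (jac phi p)).
Proof.
move=> sg Up fg; rewrite (ddbarR_eq oU Up fg).
rewrite (ddbarRZ oU c (smooth_comp oU oW sphi phiW sg) Up); congr (_ *: _).
exact: (ddbar_chain oU oW hphi phiW (csmooth_real sg) Up).
Qed.

(** Needed so that log |det J|^2 is pluriharmonic in the comparison of Ricci forms. *)
Lemma holomorphic_det_jac : holomorphic U (fun q => \det (jac phi q)).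
Proof.
have sj a k : csmooth U (fun q => jac phi q a k).
  apply: (csmooth_eq oU (F := fun q => del a (fun r => ccoord (phi r) k) q)).
    by move=> q _; rewrite mxE.
  exact: csmooth_del.
have dj a k b q : U q -> delbar b (fun q => jac phi q a k) q = 0.
  move=> Uq; rewrite (delbar_eq oU b Uq
     (G := fun q => del a (fun r => ccoord (phi r) k) q)); last first.
    by move=> r _; rewrite mxE.
  rewrite -(delC oU a b (sphi k) Uq) (del_eq oU a Uq (G := fun=> 0)) ?del_cst//.
  by move=> r Ur; exact: (hphi k).2.
split; first exact: csmooth_det.
move=> p Up b; rewrite /determinant.
have sP (s : 'S_n) : csmooth U (fun q => \prod_i jac phi q i (s i)).
  by apply: csmooth_prod.
rewrite (delbar_sum oU _ _ _ _ Up); last first.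
  by move=> s; apply: csmoothM => //; exact: csmooth_cst.
rewrite big1// => s _; rewrite (delbarZ _ _ (sP s) Up).
by rewrite (delbar_prod0 oU _ _ _ Up) ?mulr0// => i; exact: dj.
Qed.

Variables (c : R) (f g : Cn R n -> R).
Hypotheses (c0 : 0 < c) (mf : metric_pot U f) (mg : metric_pot W g).
Hypothesis fg : forall q, U q -> f q = (c ^+ 2)^-1 * g (phi q).

Lemma det_metric_chain q : U q -> \det (ddbarR f q) =
  ((c ^+ 2)^-1%:C) ^+ n * (\det (jac phi q) * conjc (\det (jac phi q)))
  * \det (ddbarR g (phi q)).
Proof.
move=> Uq; rewrite (ddbarR_chain mg.1 Uq fg) detZ !det_mulmx det_tr det_map_mx.
by rewrite -!mulrA; congr (_ * (_ * _)); rewrite mulrC.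
Qed.

(** No local inverse of phi is assumed: the determinant of the pulled back metric contains |det J|^2
    and is positive. *)
Lemma jac_unit q : U q -> jac phi q \in unitmx.
Proof.
move=> Uq; rewrite unitmxE unitfE; apply/negP => /eqP d0.
have := mf.2 q Uq; rewrite det_metric_chain// d0 mul0r mulr0 mul0r.
by rewrite ltxx.
Qed.

(** log det of the pulled back metric is a constant plus log |det J|^2 plus the old one composed
    with phi; the first two have zero Hessian. The factor c^-2 only enters the constant, so Ric does
    not rescale. *)
Lemma ric_chain p : U p -> ric (ddbarR f) p =
  jac phi p *m ric (ddbarR g) (phi p) *m ctrmx (jac phi p).
Proof.
move=> Up; apply: etrans (ricE f p) _.
have -> : ric (ddbarR g) (phi p) = - ddbarR (logdet g) (phi p) by exact: ricE.
pose N q := complex.Re (\det (jac phi q) * conjc (\det (jac phi q))).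
have d0 q : U q -> \det (jac phi q) != 0.
  by move=> /jac_unit; rewrite unitmxE unitfE.
have N0 q : U q -> 0 < N q by move=> /d0; exact: Re_mulcJ_gt0.
have hd := holomorphic_det_jac.
have sN : smooth U (fun q => ln (N q)).
  apply: smooth_ln => //.
  by have [] := csmoothM oU hd.1 (csmoothJ oU hd.1).
pose K := ln (((c ^+ 2)^-1) ^+ n).
have E q : U q -> logdet f q = (K + ln (N q)) + logdet g (phi q).
  move=> Uq; have D0 := Re_det_gt0 mg (phiW Uq).
  have k0 : 0 < (c ^+ 2)^-1 by rewrite invr_gt0 exprn_gt0.
  apply: etrans (congr1 (fun x => ln (complex.Re x)) (det_metric_chain Uq)) _.
  exact: (ln_Re_split n k0 (d0 q Uq) D0).
have sg : smooth U (fun q => logdet g (phi q)).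
  by apply: (smooth_comp oU oW sphi phiW); exact: smooth_logdet.
have sK : smooth U (fun q => K + ln (N q)) by apply: smoothD => //; exact: smooth_cst.
have E1 := ddbarR_eq oU Up E.
have E2 := ddbarRD oU sK sg Up.
have E3 : ddbarR (fun q => K + ln (N q)) p = 0.
  apply: etrans (ddbarRD oU (smooth_cst U K) sN Up) _.
  by rewrite ddbarR_cst add0r; exact: (ddbar_ln_sqnorm oU hd d0 Up).
have E4 := ddbarR_chain (smooth_logdet oW mg) Up (fun q _ => esym (mul1r (logdet g (phi q)))).
apply: etrans (congr1 -%R (etrans E1 (etrans E2 (congr2 +%R E3 E4)))) _.
by rewrite add0r scale1r mulmxN mulNmx.
Qed.

(** Used with c = 1 for transition maps, where it yields independence of the chart, and with c =
    t^-1 for the dilation by t, where it yields the weight. *)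
Lemma trlog_pert_natural (u v : nat -> Cn R n -> R) m p : U p ->
  (forall l, (0 < l)%N -> (l + 2 <= m)%N -> smooth W (v l)) ->
  (forall l q, (0 < l)%N -> (l + 2 <= m)%N -> U q -> u l q = c ^+ l * v l (phi q)) ->
  trlog_comp (pert_comp f u p) m =
  c%:C ^+ m * trlog_comp (pert_comp g v (phi p)) m.
Proof.
move=> Up sv uv; set J := jac phi p.
have uJ : J \in unitmx by exact: jac_unit.
have uQ : ctrmx J \in unitmx by rewrite /ctrmx unitmx_tr map_unitmx.
have uG := metric_pot_unit mf Up; have uG' := metric_pot_unit mg (phiW Up).
have cC : c%:C != 0 by rewrite complexR_eqE gt_eqF.
have gE := ddbarR_chain mg.1 Up fg; rewrite -/J in gE.
have ce : (c ^- 2)%:C = (c%:C ^+ 2)^-1 by rewrite complexR_inv rmorphXn.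
rewrite ce in gE.
have key (a : R[i]) (H : 'M[R[i]]_n) :
    invmx (ddbarR f p) *m (a *: (J *m H *m ctrmx J)) =
    (c%:C ^+ 2 * a) *: (invmx (ctrmx J) *m (invmx (ddbarR g (phi p)) *m H) *m ctrmx J).
  exact: (invmx_congruence H a (expf_neq0 2 cC) uG uG' uQ gE).
(* Truncation again: the relation between u and v is only available for the terms that reach weight
   m. *)
pose B l := if (l <= m)%N then pert_comp g v (phi p) l else 0.
pose A l := if (l <= m)%N then pert_comp f u p l else 0.
have AB l : A l = c%:C ^+ l *: (invmx (ctrmx J) *m B l *m ctrmx J).
  rewrite /A /B; case: leqP => lm; last by rewrite mulmx0 mul0mx scaler0.
  case: l lm => [|[|[|k]]] lm.
  - by rewrite /= mulmx0 mul0mx scaler0.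
  - by rewrite /= mulmx0 mul0mx scaler0.
  - have := key 1 (ric (ddbarR g) (phi p)); rewrite scale1r mulr1 => K2.
    change (- (invmx (ddbarR f p) *m ric (ddbarR f) p) = c%:C ^+ 2 *:
     (invmx (ctrmx J) *m (- (invmx (ddbarR g (phi p)) *m ric (ddbarR g) (phi p)))
       *m ctrmx J)).
    apply: etrans (congr1 (fun X => - (invmx (ddbarR f p) *m X)) (ric_chain Up)) _.
    apply: etrans (congr1 -%R K2) _.
    move: (invmx (ddbarR g (phi p)) *m _) => Y.
    by rewrite mulmxN mulNmx scalerN.
  - have k2 : (k.+1 + 2 <= m)%N by rewrite addn2.
    have uE := ddbarR_chain (sv k.+1 isT k2) Up (fun q => uv k.+1 q isT k2).
    apply: etrans (congr1 (fun X => invmx (ddbarR f p) *m X) uE) _.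
    apply: etrans (key _ _) _.
    have ck : c%:C ^+ 2 * (c ^+ k.+1)%:C = c%:C ^+ k.+3 by rewrite rmorphXn -exprD.
    exact: (congr1 (fun s => s *: _) ck).
have TA : trlog_comp (pert_comp f u p) m = trlog_comp A m.
  by apply: eq_trlog_comp => l lm; rewrite /A lm.
have TB : trlog_comp (pert_comp g v (phi p)) m = trlog_comp B m.
  by apply: eq_trlog_comp => l lm; rewrite /B lm.
exact: (etrans TA (etrans (trlog_comp_conj m uQ AB)
  (congr1 ( *%R (c%:C ^+ m)) (esym TB)))).
Qed.

End Naturality.

(** * Coordinates on the total space *)

Section Holomorphic.
Variables (R : realType) (n : nat).
Implicit Types (F G : Cn R n -> R[i]).

Lemma holomorphic_ccoord U (k : 'I_n) : holomorphic U (fun p : Cn R n => ccoord p k).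
Proof. by split; [exact: csmooth_ccoord|move=> p _ l; exact: delbar_ccoord]. Qed.

Lemma holomorphicM (U : set (Cn R n)) F G : open U -> holomorphic U F ->
  holomorphic U G -> holomorphic U (fun p => F p * G p).
Proof.
move=> oU [sF hF] [sG hG]; split; first exact: csmoothM.
by move=> p Up k; rewrite (delbarM _ sF sG Up) hF// hG// mulr0 mul0r addr0.
Qed.

Lemma holomorphic_eq (U : set (Cn R n)) F G : open U ->
  (forall p, U p -> F p = G p) -> holomorphic U F -> holomorphic U G.
Proof.
move=> oU FG [sF hF]; split; first exact: csmooth_eq sF.
by move=> p Up k; rewrite -(delbar_eq oU k Up FG) hF.
Qed.

Lemma holomorphic_sub (U W : set (Cn R n)) F : W `<=` U -> holomorphic U F ->
  holomorphic W F.
Proof.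
by move=> WU [sF hF]; split; [exact: csmooth_sub sF|move=> p /WU; exact: hF].
Qed.

Lemma holomorphic_cst (U : set (Cn R n)) c : holomorphic U (fun=> c).
Proof. by split; [exact: csmooth_cst|move=> p _ k; exact: delbar_cst]. Qed.

End Holomorphic.

Section SplitCoordinates.
Variables (R : realType) (d : nat).
Implicit Types (p v : Cn R (d + 1)) (w : Cn R d) (z : R[i]).

Definition mkp w z : Cn R (d + 1) :=
  (row_mx w.1 (complex.Re z)%:M, row_mx w.2 (complex.Im z)%:M).

Lemma wpart_mkp w z : wpart (mkp w z) = w.
Proof. by rewrite /wpart /mkp /= !row_mxKl; case: w. Qed.

Lemma zpart_mkp w z : zpart (mkp w z) = z.
Proof.
rewrite /zpart /ccoord /mkp /= !row_mxEr !mxE !eqxx !mulr1n.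
by case: z.
Qed.

Lemma mkpK p : mkp (wpart p) (zpart p) = p.
Proof.
have E (x : 'rV[R]_(d + 1)) : row_mx (lsubmx x) (x 0 (rshift d ord0))%:M = x.
  rewrite -[RHS]hsubmxK; congr row_mx; apply/rowP => k.
  by rewrite !mxE !ord1 eqxx mulr1n.
by case: p => x y; rewrite /mkp /wpart /zpart /ccoord /= !E.
Qed.

Lemma ccoord_mkpl w z k : ccoord (mkp w z) (lshift 1 k) = ccoord w k.
Proof. by rewrite /ccoord /mkp /= !row_mxEl. Qed.

Lemma ccoord_mkpr w z : ccoord (mkp w z) (rshift d ord0) = z.
Proof. exact: zpart_mkp. Qed.

Lemma ccoord_wpart p k : ccoord (wpart p) k = ccoord p (lshift 1 k).
Proof. by rewrite -[in RHS](mkpK p) ccoord_mkpl. Qed.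

Lemma mkp_add w w' z z' : mkp w z + mkp w' z' = mkp (w + w') (z + z').
Proof.
rewrite /mkp; congr (_, _); rewrite /= add_row_mx ?cReD ?cImD.
  by congr row_mx; apply/matrixP => a b; rewrite !mxE mulrnDl.
by congr row_mx; apply/matrixP => a b; rewrite !mxE mulrnDl.
Qed.

Lemma mkp_scale (s : R) w z : s *: mkp w z = mkp (s *: w) (s%:C * z).
Proof.
rewrite /mkp; congr (_, _); rewrite /= scale_row_mx scale_scalar_mx ?cReM ?cImM /=.
  by rewrite mul0r subr0.
by rewrite mul0r addr0.
Qed.

Lemma wpart_linear : linear (@wpart R d).
Proof. by move=> a u v; rewrite /wpart /= !linearP. Qed.

Lemma wpart_continuous : continuous (@wpart R d).
Proof.
move=> p; have -> : @wpart R d = fun q => \sum_k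
  (q.1 0 (lshift 1 k) *: dirRe R k + q.2 0 (lshift 1 k) *: dirIm R k).
  apply/funext => q; rewrite {1}[wpart q]Cn_decomp; apply: eq_bigr => k _.
  by rewrite /wpart /= !mxE.
apply: cvg_fin_sum => k; apply: cvgD; apply: cvgZr_tmp.
  exact: re_coord_continuous.
exact: im_coord_continuous.
Qed.

Lemma csmooth_zpart U : csmooth U (@zpart R d).
Proof. exact: csmooth_ccoord. Qed.

Lemma holo_map_wpart U : holo_map U (@wpart R d).
Proof.
move=> k; have -> : (fun p => ccoord (wpart p) k) = fun p => ccoord p (lshift 1 k).
  by apply/funext => p; exact: ccoord_wpart.
exact: holomorphic_ccoord.
Qed.

Lemma jac_wpart p : jac (@wpart R d) p = col_mx 1%:M 0.
Proof.
apply/matrixP => a k; rewrite mxE.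
have -> : (fun q => ccoord (wpart q) k) = fun q : Cn R (d + 1) => ccoord q (lshift 1 k).
  by apply/funext => q; exact: ccoord_wpart.
rewrite del_ccoord; case: (split_ordP a) => b ->.
  by rewrite col_mxEu mxE (inj_eq (@lshift_inj _ _)).
by rewrite col_mxEd mxE eq_rlshift.
Qed.

Lemma open_preimage_wpart B : open B -> open (@wpart R d @^-1` B).
Proof. by move=> oB; apply: open_comp => // p _; exact: wpart_continuous. Qed.

Lemma zpart_neq0_open : open [set p | @zpart R d p != 0].
Proof.
have -> : [set p | @zpart R d p != 0] =
  (fun p : Cn R (d + 1) => p.1 0 (rshift d ord0)) @^-1` [set~ 0] `|`
  (fun p : Cn R (d + 1) => p.2 0 (rshift d ord0)) @^-1` [set~ 0].
  apply/seteqP; split => p /=.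
    rewrite /zpart /ccoord eq_complex /= negb_and => /orP[|] /eqP ?.
      by left.
    by right.
  rewrite /zpart /ccoord eq_complex /= negb_and.
  by move=> [] /eqP ->; rewrite ?orbT.
have o0 : open [set~ (0 : R)].
  by rewrite openC; apply: accessible_closed_set1; exact: hausdorff_accessible.
apply: openU; apply: open_comp => // p _.
  exact: re_coord_continuous.
exact: im_coord_continuous.
Qed.

Lemma holomorphic_comp_wpart B F : open B -> holomorphic B F ->
  holomorphic (@wpart R d @^-1` B) (fun p => F (wpart p)).
Proof.
move=> oB [sF hF]; have oU := open_preimage_wpart oB.
split=> [|p Up k]; first by case: sF => sr si; split;
  [exact: (smooth_comp_linear wpart_linear wpart_continuous sr)
  |exact: (smooth_comp_linear wpart_linear wpart_continuous si)].
have -> := delbar_chain oB (@holo_map_wpart (@wpart R d @^-1` B)) (fun q Uq => Uq) k sF Up.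
by rewrite big1// => l _; rewrite hF// mul0r.
Qed.

End SplitCoordinates.

(** * Charts of E' and their transition maps *)

Section Charts.
Variables (R : realType) (d : nat) (D : complexManifold R d).

Lemma chart_image_open (i : cm_idx D) (A : set D) : open A ->
  open (cm_chart i @` (cm_dom i `&` A)).
Proof.
move=> oA; rewrite openE => _ [x [xi xA] <-]; rewrite /interior.
have oi := @cm_chart_open _ _ D i.
have Px : (cm_chart i @` cm_dom i) (cm_chart i x) by exists x.
have N1 : nbhs (cm_chart i x) (cm_chart i @` cm_dom i).
  by apply: open_nbhs_nbhs; split.
have N2 : nbhs (cm_chart i x) (cm_inv i @^-1` A).
  apply: (cm_inv_cont Px); rewrite cm_chartK//.
  by apply: open_nbhs_nbhs; split.
apply: filterS (filterI N1 N2) => q [[y yi <-]] /=.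
by rewrite cm_chartK// => yA; exists y.
Qed.

Variable E : lineBundle D.

Lemma base_dom_open (i : cm_idx D) (j : lb_idx E) : open (base_dom i j).
Proof. by apply: chart_image_open; exact: lb_dom_open. Qed.

Lemma total_dom_open (i : cm_idx D) (j : lb_idx E) : open (total_dom i j).
Proof.
apply: openI; last exact: zpart_neq0_open.
by apply: open_preimage_wpart; exact: base_dom_open.
Qed.

(** If the factor vanished, the k-th fiber coordinate would be 0 on the whole fiber over x, so all
    its points would coincide, against the j-th coordinate taking the values 0 and 1. *)
Lemma lb_trans_neq0 (j k : lb_idx E) x : lb_dom j x -> lb_dom k x ->
  lb_trans j k x != 0.
Proof.
move=> xj xk; apply/negP => /eqP t0.
have F z : lb_fib k (lb_inv j x z) = 0.
  by rewrite (lb_transE (j := j)) ?lb_proj_inv// t0 mul0r.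
have I z : lb_inv j x z = lb_inv k x 0.
  rewrite -[LHS](lb_fibK (j := k)) ?F ?lb_proj_inv//.
have := congr1 (lb_fib j) (etrans (I 1) (esym (I 0))).
by rewrite !lb_fib_inv// => /eqP; rewrite oner_eq0.
Qed.

Lemma base_domP (i : cm_idx D) (j : lb_idx E) w : base_dom i j w ->
  [/\ cm_dom i (cm_inv i w), lb_dom j (cm_inv i w) & cm_chart i (cm_inv i w) = w].
Proof. by move=> [x [xi xj] <-]; rewrite cm_chartK. Qed.

Lemma lb_inv_off_zero (j : lb_idx E) x z : lb_dom j x -> z != 0 ->
  off_zero (lb_inv j x z).
Proof.
move=> xj z0 k; rewrite lb_proj_inv// => xk.
rewrite (lb_transE (j := j)) ?lb_proj_inv// lb_fib_inv//.
by rewrite mulf_neq0// lb_trans_neq0.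
Qed.

Definition coords (i : cm_idx D) (j : lb_idx E) (e : E) : Cn R (d + 1) :=
  mkp (cm_chart i (lb_proj e)) (lb_fib j e).

Lemma total_inv_proj (i : cm_idx D) (j : lb_idx E) p : total_dom i j p ->
  lb_proj (total_inv i j p) = cm_inv i (wpart p).
Proof. by move=> [/base_domP[_ xj _] _]; rewrite /total_inv lb_proj_inv. Qed.

Lemma total_inv_off_zero (i : cm_idx D) (j : lb_idx E) p : total_dom i j p ->
  off_zero (total_inv i j p).
Proof. by move=> [/base_domP[_ xj _] z0]; exact: lb_inv_off_zero. Qed.

Lemma coordsK (i : cm_idx D) (j : lb_idx E) e :
  cm_dom i (lb_proj e) -> lb_dom j (lb_proj e) ->
  total_inv i j (coords i j e) = e.
Proof.
move=> ei ej; rewrite /total_inv /coords wpart_mkp zpart_mkp cm_chartK//.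
exact: lb_fibK.
Qed.

Lemma coords_dom (i : cm_idx D) (j : lb_idx E) e : off_zero e ->
  cm_dom i (lb_proj e) -> lb_dom j (lb_proj e) ->
  total_dom i j (coords i j e).
Proof.
move=> e0 ei ej; split; rewrite /coords ?wpart_mkp ?zpart_mkp.
  by exists (lb_proj e).
exact: e0.
Qed.

Section Transition.
Variables (i i' : cm_idx D) (j j' : lb_idx E).

Definition overlap : set (Cn R (d + 1)) :=
  [set p | (cm_chart i @` (cm_dom i `&` (lb_dom j `&` (cm_dom i' `&` lb_dom j'))))
             (wpart p) /\ zpart p != 0].

Definition transition p := coords i' j' (total_inv i j p).

Lemma overlap_open : open overlap.
Proof.
apply: openI; last exact: zpart_neq0_open.
apply: open_preimage_wpart; apply: chart_image_open.
by apply: openI; [exact: lb_dom_open|apply: openI; [exact: cm_dom_open|exact: lb_dom_open]].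
Qed.

Lemma overlap_total p : overlap p -> total_dom i j p.
Proof. by move=> [[x [xi [xj _]] xw] z0]; split=> //; exists x. Qed.

Lemma overlap_dom p : overlap p ->
  cm_dom i' (lb_proj (total_inv i j p)) /\ lb_dom j' (lb_proj (total_inv i j p)).
Proof.
move=> op; rewrite (total_inv_proj (overlap_total op)).
by move: op => [[x [xi [_ [xi' xj']]] <-] _]; rewrite cm_chartK.
Qed.

Lemma mem_overlap p : total_dom i j p ->
  cm_dom i' (lb_proj (total_inv i j p)) -> lb_dom j' (lb_proj (total_inv i j p)) ->
  overlap p.
Proof.
move=> tp; rewrite (total_inv_proj tp) => xi' xj'.
have [/base_domP[xi xj wE] z0] := tp.
by split=> //; exists (cm_inv i (wpart p)).
Qed.

Lemma transition_dom p : overlap p -> total_dom i' j' (transition p).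
Proof.
move=> op; have [xi' xj'] := overlap_dom op; apply: coords_dom => //.
exact: total_inv_off_zero (overlap_total op).
Qed.

Lemma transitionE p : overlap p ->
  total_inv i' j' (transition p) = total_inv i j p.
Proof. by move=> op; have [xi' xj'] := overlap_dom op; exact: coordsK. Qed.

(** The base components form a coordinate change of D; the fiber component is the transition
    function of E times z. *)
Lemma holo_map_transition : holo_map overlap transition.
Proof.
have oO := overlap_open; move=> k; case: (split_ordP k) => l ->.
  apply: (holomorphic_eq oO (F := fun p =>
      ccoord (cm_chart i' (cm_inv i (wpart p))) l)).
    move=> p op; rewrite /transition /coords ccoord_mkpl.
    by rewrite total_inv_proj//; exact: overlap_total.
  apply: (holomorphic_sub (U := @wpart R d @^-1` (cm_chart i @` (cm_dom i `&` cm_dom i')))).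
    by move=> p [[x [xi [xj [xi' xj']]] E1] _]; exists x.
  apply: (holomorphic_comp_wpart (F := fun w => ccoord (cm_chart i' (cm_inv i w)) l)).
    by apply: chart_image_open; exact: cm_dom_open.
  exact: cm_trans_holo.
rewrite (ord1 l); apply: (holomorphic_eq oO (F := fun p =>
   lb_trans j j' (cm_inv i (wpart p)) * zpart p)).
  move=> p op; rewrite /transition /coords ccoord_mkpr.
  have [_ xj'] := overlap_dom op; have tp := overlap_total op.
  have pE := total_inv_proj tp.
  have [/base_domP[_ xj _] _] := tp.
  by rewrite (lb_transE (j := j)) pE// -?pE// /total_inv lb_fib_inv.
apply: holomorphicM => //; last exact: holomorphic_ccoord.
apply: (holomorphic_sub (U := @wpart R d @^-1`
   (cm_chart i @` (cm_dom i `&` (lb_dom j `&` lb_dom j'))))).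
  by move=> p [[x [xi [xj [xi' xj']]] E1] _]; exists x.
apply: (holomorphic_comp_wpart (F := fun w => lb_trans j j' (cm_inv i w))).
  by apply: chart_image_open; apply: openI; exact: lb_dom_open.
exact: lb_trans_holo.
Qed.

End Transition.
End Charts.

(** * The potential |S|^-2 *)

Lemma quadE (R : rcfType) n (G : 'M[R[i]]_n) (v : 'rV[R[i]]_n) :
  \sum_a \sum_b G a b * v 0 a * conjc (v 0 b) = (v *m G *m ctrmx v) 0 0.
Proof.
rewrite [RHS]mxE exchange_big; apply: eq_bigr => b _.
rewrite !mxE mulr_suml; apply: eq_bigr => a _.
by rewrite (mulrC (G a b)).
Qed.

Lemma quad_congr (R : rcfType) n m (J : 'M[R[i]]_(n, m)) (H : 'M[R[i]]_m)
    (v : 'rV[R[i]]_n) :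
  v *m (J *m H *m ctrmx J) *m ctrmx v = (v *m J) *m H *m ctrmx (v *m J).
Proof. by rewrite ctrmxM !mulmxA. Qed.

Lemma quad_rank1 (R : rcfType) n (L : 'cV[R[i]]_n) (v : 'rV[R[i]]_n) :
  (v *m (L *m ctrmx L) *m ctrmx v) 0 0 = (v *m L) 0 0 * conjc ((v *m L) 0 0).
Proof.
rewrite mulmxA -mulmxA -ctrmxM [LHS]mxE big_ord1; congr (_ * _).
by rewrite !mxE.
Qed.

Section Metric.
Variables (R : realType) (d : nat) (D : complexManifold R d) (E : lineBundle D).
Variable h : hermitianMetric E.
Hypothesis h_kahler : kahler_curvature h.

Definition hbase (i : cm_idx D) (j : lb_idx E) (w : Cn R d) : R :=
  h (lb_frame j (cm_inv i w)).

Definition pot (i : cm_idx D) (j : lb_idx E) (p : Cn R (d + 1)) : R :=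
  (h (total_inv i j p))^-1.

(** log |S|^-2, separated into a base part whose Hessian is the curvature and the pluriharmonic -
    log |z|^2. *)
Definition lpot (i : cm_idx D) (j : lb_idx E) (p : Cn R (d + 1)) : R :=
  - ln (hbase i j (wpart p)) + - ln (complex.Re (zpart p * conjc (zpart p))).

Lemma h_total i j p : total_dom i j p ->
  h (total_inv i j p) = hbase i j (wpart p) * complex.Re (zpart p * conjc (zpart p)).
Proof.
move=> tp; have [/base_domP[_ xj _] _] := tp; have pE := total_inv_proj tp.
rewrite (@hm_sqE _ _ _ _ h j) pE//; congr (_ * _).
rewrite /total_inv lb_fib_inv//; case: (zpart p) => x y /=.
by rewrite mulrN opprK !expr2.
Qed.

Lemma hbase_gt0 i j w : base_dom i j w -> 0 < hbase i j w.
Proof. by move=> /base_domP[_ xj _]; exact: hm_pos. Qed.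

Lemma h_total_gt0 i j p : total_dom i j p -> 0 < h (total_inv i j p).
Proof.
move=> tp; rewrite h_total//; case: tp => bw z0.
by rewrite mulr_gt0 ?hbase_gt0// Re_mulcJ_gt0.
Qed.

Lemma pot_gt0 i j p : total_dom i j p -> 0 < pot i j p.
Proof. by move=> tp; rewrite invr_gt0 h_total_gt0. Qed.

Lemma lpotE i j p : total_dom i j p -> lpot i j p = ln (pot i j p).
Proof.
move=> tp; rewrite /lpot /pot lnV ?posrE ?h_total_gt0// h_total//.
case: tp => bw z0.
by rewrite lnM ?posrE ?hbase_gt0 ?Re_mulcJ_gt0// opprD.
Qed.

Lemma smooth_hbase i j : smooth (base_dom i j) (hbase i j).
Proof. exact: hm_smooth. Qed.

Lemma smooth_hbase_wpart i j :
  smooth (total_dom i j) (fun p => hbase i j (wpart p)).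
Proof.
apply: (@smooth_sub _ _ (@wpart R d @^-1` (base_dom i j))); first by move=> p [].
exact: (smooth_comp_linear (@wpart_linear R d) (@wpart_continuous R d)
  (smooth_hbase i j)).
Qed.

Lemma smooth_sqz U : open U ->
  smooth U (fun p => complex.Re (@zpart R d p * conjc (zpart p))).
Proof.
move=> oU; have sz := @csmooth_zpart R d U.
by have [] := csmoothM oU sz (csmoothJ oU sz).
Qed.

Lemma smooth_h i j : smooth (total_dom i j) (fun p => h (total_inv i j p)).
Proof.
have oT := @total_dom_open _ _ _ E i j.
apply: (smooth_eq oT (fun p tp => esym (h_total tp))).
by apply: smoothM => //; [exact: smooth_hbase_wpart|exact: smooth_sqz].
Qed.

Lemma smooth_pot i j : smooth (total_dom i j) (pot i j).
Proof.
have oT := @total_dom_open _ _ _ E i j.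
by apply: smoothV => //; [move=> p tp; rewrite gt_eqF// h_total_gt0|exact: smooth_h].
Qed.

Lemma smooth_ln_hbase i j : smooth (base_dom i j) (fun w => ln (hbase i j w)).
Proof.
apply: smooth_ln; [exact: base_dom_open|exact: hbase_gt0|exact: smooth_hbase].
Qed.

Lemma smooth_ln_hbase_wpart i j :
  smooth (total_dom i j) (fun p => ln (hbase i j (wpart p))).
Proof.
apply: smooth_ln; [exact: total_dom_open| |exact: smooth_hbase_wpart].
by move=> p [bw _]; exact: hbase_gt0.
Qed.

Lemma smooth_ln_sqz (i : cm_idx D) (j : lb_idx E) : smooth (total_dom i j)
  (fun p => ln (complex.Re (zpart p * conjc (zpart p)))).
Proof.
have oT := @total_dom_open _ _ _ E i j.
apply: smooth_ln => //; last exact: smooth_sqz.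
by move=> p [_ z0]; exact: Re_mulcJ_gt0.
Qed.

Lemma ddbar_lpot i j p : total_dom i j p ->
  ddbarR (lpot i j) p = jac (@wpart R d) p *m curvature h i j (wpart p)
                          *m ctrmx (jac (@wpart R d) p).
Proof.
move=> tp; have oT := @total_dom_open _ _ _ E i j.
have oB := @base_dom_open _ _ _ E i j.
have sN1 := smoothN oT (smooth_ln_hbase_wpart i j).
have sN2 := smoothN oT (smooth_ln_sqz i j).
apply: etrans (ddbarRD oT sN1 sN2 tp) _.
have Z : ddbarR (fun p => - ln (complex.Re (zpart p * conjc (zpart p)))) p = 0.
  have e : forall q, total_dom i j q -> - ln (complex.Re (zpart q * conjc (zpart q)))
      = -1 * ln (complex.Re (zpart q * conjc (zpart q))).
    by move=> q _; rewrite mulN1r.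
  apply: etrans (ddbarR_eq oT tp e) _.
  apply: etrans (ddbarRZ oT (-1) (smooth_ln_sqz i j) tp) _.
  have -> := ddbar_ln_sqnorm oT (@holomorphic_ccoord R (d + 1) _ (rshift d ord0))
    (fun q (tq : total_dom i j q) => tq.2) tp.
  by rewrite scaler0.
have hW : holo_map (total_dom i j) (@wpart R d) by exact: holo_map_wpart.
have e1 q : total_dom i j q -> - ln (hbase i j (wpart q))
      = -1 * (fun w => ln (hbase i j w)) (wpart q).
  by move=> _; rewrite mulN1r.
have C : ddbarR (fun p => - ln (hbase i j (wpart p))) p =
    jac (@wpart R d) p *m curvature h i j (wpart p) *m ctrmx (jac (@wpart R d) p).
  apply: etrans (ddbarR_eq oT tp e1) _.
  apply: etrans (ddbarRZ oT (-1) (smooth_ln_hbase_wpart i j) tp) _.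
  have := ddbar_chain oT oB hW (fun q (tq : total_dom i j q) => tq.1)
    (csmooth_real (smooth_ln_hbase i j)) tp.
  move=> /(congr1 (fun M => (-1)%:C *: M)) => H; apply: etrans H _.
  rewrite /curvature /hbase -/(ddbarR _ _) -/(ctrmx _).
  move: (ddbarR _ _) (jac _ _) => M J.
  by rewrite rmorphN1 scaleN1r mulmxN mulNmx.
by rewrite C Z addr0.
Qed.

(** This nonzero derivative is what makes omega_0 positive on vertical vectors, where the curvature
    term vanishes. *)
Lemma del_lpot_z i j p : total_dom i j p ->
  del (rshift d ord0) (fun q => (lpot i j q)%:C) p = - (zpart p)^-1.
Proof.
move=> tp; have oT := @total_dom_open _ _ _ E i j.
have oB := @base_dom_open _ _ _ E i j.
have hW : holo_map (total_dom i j) (@wpart R d) by exact: holo_map_wpart.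
have sl1 := csmooth_real (smooth_ln_hbase_wpart i j).
have sl2 := csmooth_real (smooth_ln_sqz i j).
have sz := @csmooth_zpart R d (total_dom i j).
set z := rshift d ord0.
have e q : total_dom i j q -> (lpot i j q)%:C =
   -1 * (ln (hbase i j (wpart q)))%:C
   + -1 * (ln (complex.Re (zpart q * conjc (zpart q))))%:C.
  by move=> _; rewrite /lpot rmorphD !rmorphN !mulN1r.
rewrite (del_eq oT z tp e).
have s1 := csmoothM oT (csmooth_cst (total_dom i j) (-1)) sl1.
have s2 := csmoothM oT (csmooth_cst (total_dom i j) (-1)) sl2.
apply: etrans (delD z s1 s2 tp) _.
apply: etrans (congr2 +%R (delZ (-1) z sl1 tp) (delZ (-1) z sl2 tp)) _.
have D1 : del z (fun q => (ln (hbase i j (wpart q)))%:C) p = 0.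
  have := del_chain oB hW (fun q (tq : total_dom i j q) => tq.1) z
    (csmooth_real (smooth_ln_hbase i j)) tp.
  move=> ->; rewrite big1// => k _.
  have -> : (fun q => ccoord (wpart q) k) = fun q : Cn R (d + 1) => ccoord q (lshift 1 k).
    by apply/funext => q; exact: ccoord_wpart.
  by rewrite del_ccoord eq_rlshift mulr0.
have sqz_gt0 q : total_dom i j q -> 0 < complex.Re (zpart q * conjc (zpart q)).
  by move=> [_ z0]; exact: Re_mulcJ_gt0.
have D2 : del z (fun q => (ln (complex.Re (zpart q * conjc (zpart q))))%:C) p = (zpart p)^-1.
  apply: etrans (del_ln z sqz_gt0 (smooth_sqz oT) tp) _.
  rewrite (del_eq oT z tp (G := fun q => zpart q * conjc (zpart q))); last first.
    by move=> q _; exact: Re_mulcJ.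
  rewrite (delM z sz (csmoothJ oT sz) tp) (delJ _ sz tp).
  rewrite delbar_ccoord del_ccoord eqxx conjc0 mulr0 add0r mul1r complexR_inv Re_mulcJ.
  rewrite invfM -mulrA mulVf ?mulr1//.
  by case: tp => _ z0; rewrite conjc_eq0.
by rewrite D1 D2 mulr0 add0r mulN1r.
Qed.

(** The Hessian is |S|^-2 times the sum of a rank one form, the square of del log |S|^-2, and the
    pulled back curvature. The curvature is positive as soon as the base part of v is nonzero;
    otherwise v is vertical and the rank one form gives |v_z / z|^2. *)
Lemma pot_metric i j : metric_pot (total_dom i j) (pot i j).
Proof.
have oT := @total_dom_open _ _ _ E i j.
split=> [|p tp]; first exact: smooth_pot.
apply: posdef_det_gt0; first exact: ddbar_herm (smooth_pot i j) tp.
move=> v v0; rewrite quadE.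
pose L : 'cV[R[i]]_(d + 1) := \col_a del a (fun q => (lpot i j q)%:C) p.
have [_ _ pc _ _] := h_kahler i j; have bw := tp.1.
pose J := jac (@wpart R d) p; pose C := curvature h i j (wpart p).
have slp : smooth (total_dom i j) (lpot i j).
  apply: smoothD => //; apply: smoothN => //.
    exact: smooth_ln_hbase_wpart.
  exact: smooth_ln_sqz.
have GE : ddbarR (pot i j) p = (pot i j p)%:C *: (L *m ctrmx L + J *m C *m ctrmx J).
  apply/matrixP => a b.
  apply: etrans (ddbar_exp oT a b (@pot_gt0 i j) (@lpotE i j) (smooth_pot i j) tp) _.
  rewrite (ddbar_lpot tp) -/J -/C.
  move: (J *m C *m ctrmx J) => M; rewrite !mxE big_ord1 !mxE.
  congr (_ * (_ * _ + _)).
  apply: esym; apply: etrans (esym (delbarJ b (csmooth_real slp) tp)) _.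
  by apply: (delbar_eq oT b tp) => q _; exact: conjc_real.
rewrite GE -scalemxAr -scalemxAl mxE pmulr_rgt0; last by rewrite ltcR pot_gt0.
rewrite mulmxDr mulmxDl mxE quad_rank1 quad_congr.
have vJ : v *m J = lsubmx v.
  by rewrite /J jac_wpart -{1}[v]hsubmxK mul_row_col mulmx1 mulmx0 addr0.
rewrite vJ -quadE.
have [w0|w0] := eqVneq (lsubmx v) 0; last first.
  by apply: ltr_wpDl; [exact: mulcJ_ge0|exact: pc].
rewrite w0 big1 ?addr0; last first.
  by move=> a _; rewrite big1// => b _; rewrite !mxE mulr0 mul0r.
rewrite lt_def mulcJ_ge0 andbT mulf_neq0 ?conjc_eq0//.
all: have -> : (v *m L) 0 0 = v 0 (rshift d ord0) * - (zpart p)^-1.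
1,3: rewrite mxE big_split_ord /= big_ord1 big1 ?add0r; last first;
  [move=> k _; have := congr1 (fun M : 'rV_d => M 0 k) w0; rewrite !mxE => ->;
   by rewrite mul0r|by rewrite mxE (del_lpot_z tp)].
all: rewrite mulf_neq0 ?oppr_eq0 ?invr_eq0//; try exact: tp.2.
all: apply: contraNneq v0 => vz; apply/eqP; rewrite -[v]hsubmxK w0.
all: rewrite (_ : rsubmx v = 0) ?row_mx0//.
all: by apply/rowP => k; rewrite !mxE (ord1 k).
Qed.

End Metric.

(** * Fiberwise dilations and weights *)

Section Dilation.
Variables (R : realType) (d : nat).
Implicit Types (p q : Cn R (d + 1)) (t : R) (a b : 'I_(d + 1)).

Definition dil t p : Cn R (d + 1) := mkp (wpart p) (t%:C * zpart p).

(* V as a real vector field: in [euler] it is given by its holomorphic part. *)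
Definition ev p : Cn R (d + 1) := mkp 0 (zpart p).

(** The exponent with which coordinate a scales under dilations: 1 for z, 0 on the base. *)
Definition isz a : nat := (a == rshift d ord0).

Lemma wpart_dil t p : wpart (dil t p) = wpart p.
Proof. exact: wpart_mkp. Qed.

Lemma zpart_dil t p : zpart (dil t p) = t%:C * zpart p.
Proof. exact: zpart_mkp. Qed.

Lemma dilE t p : dil t p = mkp (wpart p) 0 + t *: ev p.
Proof. by rewrite /ev mkp_scale mkp_add scaler0 addr0 add0r. Qed.

Lemma dil1 p : dil 1 p = p.
Proof. by rewrite /dil mul1r mkpK. Qed.

Lemma dilS s p : p + s *: ev p = dil (1 + s) p.
Proof. by rewrite dilE scalerDl scale1r addrA -[X in X + _]dil1 dilE scale1r. Qed.

Lemma ev_dil t p : ev (dil t p) = t *: ev p.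
Proof. by rewrite /ev zpart_dil mkp_scale scaler0. Qed.

Lemma ccoord_dil t p a : ccoord (dil t p) a = t%:C ^+ isz a * ccoord p a.
Proof.
rewrite /isz /dil; case: (split_ordP a) => k ->.
  by rewrite ccoord_mkpl ccoord_wpart eq_lrshift expr0 mul1r.
by rewrite (ord1 k) ccoord_mkpr eqxx expr1.
Qed.

Lemma holo_map_dil U t : open U -> holo_map U (dil t).
Proof.
move=> oU a.
apply: (holomorphic_eq oU (F := fun p => t%:C ^+ isz a * ccoord p a)).
  by move=> p _; rewrite ccoord_dil.
by apply: holomorphicM => //; [exact: holomorphic_cst|exact: holomorphic_ccoord].
Qed.

Lemma jac_dil t p : jac (dil t) p = \matrix_(a, b) ((a == b)%:R * t%:C ^+ isz b).
Proof.
apply/matrixP => a b; rewrite !mxE.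
have -> : (fun q => ccoord (dil t q) b) = fun q => t%:C ^+ isz b * ccoord q b.
  by apply/funext => q; exact: ccoord_dil.
rewrite (delZ (U := setT)) ?del_ccoord 1?mulrC//; exact: csmooth_ccoord.
Qed.

Lemma jac_dil_congr t p (H : 'M[R[i]]_(d + 1)) a b :
  (jac (dil t) p *m H *m ctrmx (jac (dil t) p)) a b =
  t%:C ^+ (isz a + isz b) * H a b.
Proof.
rewrite jac_dil !mxE (bigD1 b)//= big1 ?addr0; last first.
  move=> k kb; rewrite !mxE eq_sym (negbTE kb) mul0r.
  by rewrite conjc0 mulr0.
rewrite !mxE (bigD1 a)//= big1 ?addr0; last first.
  by move=> k ka; rewrite !mxE eq_sym (negbTE ka) !mul0r.
rewrite !mxE !eqxx !mul1r exprD rmorphXn /= oppr0.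
by rewrite mulrAC.
Qed.

Lemma ccoord_ev p a : ccoord (ev p) a = euler p 0 a.
Proof.
rewrite /ev /euler; case: (split_ordP a) => k ->.
  by rewrite ccoord_mkpl row_mxEl mxE /ccoord !mxE.
by rewrite (ord1 k) ccoord_mkpr row_mxEr mxE eqxx mulr1n.
Qed.

Lemma lieF_cderive U (F : Cn R (d + 1) -> R[i]) p : open U -> csmooth U F -> U p ->
  lieF (@euler R d) F p = cderive F (ev p) p.
Proof.
move=> oU sF Up; rewrite (cderive_wirtinger _ oU sF Up).
by apply: eq_bigr => k _; rewrite ccoord_ev.
Qed.

(** Homogeneity degrees are written as differences m - l of naturals, since |S|^-2 has degree -2 and
    coefficients of forms lose further powers of t. *)
Lemma is_derive_ratio (m l : nat) :
  is_derive (1 : R) 1 (fun t => t ^+ m * (t ^+ l)^-1) (m%:R - l%:R).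
Proof.
have dX k (x : R) : is_derive x 1 (fun t : R => t ^+ k) (k%:R * x ^+ k.-1).
  split; first exact: exprn_derivable.
  by rewrite exp_derive [LHS]mulr1.
have n0 : (fun t : R => t ^+ l) 1 != 0 by rewrite expr1n oner_eq0.
have dV : is_derive (1 : R) 1 (fun t => (t ^+ l)^-1) (- l%:R).
  split.
    by apply: derivableV => //; have [] := dX l 1.
  have dl : derivable (fun t : R => t ^+ l) 1 1 by have [] := dX l 1.
  apply: etrans (@deriveV R R (fun t : R => t ^+ l) 1 1 n0 dl) _.
  have [_ ->] := dX l 1.
  by rewrite !expr1n mulr1 invr1 scaleN1r.
suff : is_derive (1 : R) 1 ((fun t => t ^+ m) * (fun t => (t ^+ l)^-1)) (m%:R - l%:R) by [].
apply: is_derive_eq (@is_deriveM R R _ _ 1 1 _ _ (dX m 1) dV) _.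
by rewrite !expr1n invr1 mulr1 [1 *: _]mul1r [1 *: _]mul1r addrC.
Qed.

(** Euler's identity: moving from p by s V is the dilation by 1 + s, so the derivative along V is
    that of t^m / t^l at t = 1. *)
Lemma cderive_ev_scaling (F : Cn R (d + 1) -> R[i]) m l p :
  (forall t, 0 < t -> F (dil t p) = (t ^+ m * (t ^+ l)^-1)%:C * F p) ->
  cderive F (ev p) p = (m%:R - l%:R) * F p.
Proof.
move=> FS.
have key (f : Cn R (d + 1) -> R) :
    (forall t, 0 < t -> f (dil t p) = t ^+ m * (t ^+ l)^-1 * f p) ->
    'D_(ev p) f p = (m%:R - l%:R) * f p.
  move=> fS; apply: derive_val; apply/is_derive_lineP.
  pose g (t : R) := t ^+ m * (t ^+ l)^-1 * f p.
  have dg : is_derive (0 : R) 1 (fun s : R => g (1 + s)) ((m%:R - l%:R) * f p).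
    have dgg : is_derive (1 : R) 1 g ((m%:R - l%:R) * f p).
      suff : is_derive (1 : R) 1 ((fun t => t ^+ m * (t ^+ l)^-1) * cst (f p))
        ((m%:R - l%:R) * f p) by [].
      apply: is_derive_eq (@is_deriveM R R _ (cst (f p)) 1 1 _ _
        (is_derive_ratio m l) (@is_derive_cst R R R (f p) 1 1)) _.
      by rewrite scaler0 add0r [LHS]mulrC.
    have := (is_derive_lineP g 1 1 ((m%:R - l%:R) * f p)).1 dgg.
    by under eq_fun do rewrite [_ *: 1]mulr1.
  apply: near_eq_is_derive dg.
  near=> s; rewrite dilS fS//.
  near: s.
  have : \forall s \near (0:R), `|s| < 1 by exact: nbhs0_lt.
  by apply: filterS => s; rewrite ltr_norml => /andP[]; lra.
have -> : (m%:R - l%:R) * F p = ((m%:R - l%:R) * complex.Re (F p)) +i*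
    ((m%:R - l%:R) * complex.Im (F p)).
  have -> : (m%:R - l%:R : R[i]) = (m%:R - l%:R)%:C by rewrite rmorphB !rmorph_nat.
  by rewrite [LHS]complexE; case: (F p) => x y; apply: complexP => /=; ring.
rewrite /cderive key; last by move=> t t0; rewrite FS// cReM /= mul0r subr0.
by rewrite key//; move=> t t0; rewrite FS// cImM /= mul0r addr0.
Unshelve. all: by end_near. Qed.

Lemma del_euler p a k : del a (fun q => euler q 0 k) p = (isz a * isz k)%:R.
Proof.
have -> : (fun q => euler q 0 k) = fun q => (isz k)%:R * zpart q.
  apply/funext => q; rewrite -ccoord_ev /ev /isz; case: (split_ordP k) => l ->.
    by rewrite ccoord_mkpl eq_lrshift mul0r /ccoord !mxE.
  by rewrite (ord1 l) ccoord_mkpr eqxx mul1r.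
rewrite (delZ (U := setT)) ?del_ccoord//; last exact: csmooth_ccoord.
by rewrite mulrC natrM.
Qed.

Lemma iszP a b (H : 'M[R[i]]_(d + 1)) : \sum_k (isz a * isz k)%:R * H k b = (isz a)%:R * H a b.
Proof.
rewrite (bigD1 (rshift d ord0))//= big1 ?addr0; last first.
  by move=> k k0; rewrite /isz (negbTE k0) muln0 mul0r.
by rewrite /isz eqxx muln1; case: eqP => [->//|_]; rewrite !mul0r.
Qed.

(** The entry G_ab has degree m - l - (isz a + isz b); the terms of [lie11] that differentiate the
    vector field add isz a + isz b back. *)
Lemma lie11_scaling U (G : Cn R (d + 1) -> 'M[R[i]]_(d + 1)) m l p :
  open U -> msmooth U G -> U p ->
  (forall t a b, 0 < t ->
     G (dil t p) a b = (t ^+ m * (t ^+ (l + (isz a + isz b)))^-1)%:C * G p a b) ->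
  lie11 (@euler R d) G p = (m%:R - l%:R) *: G p.
Proof.
move=> oU sG Up GS; apply/matrixP => a b; rewrite [LHS]mxE [RHS]mxE.
rewrite (lieF_cderive oU (sG a b) Up).
rewrite (@cderive_ev_scaling _ m (l + (isz a + isz b))); last first.
  by move=> t t0; exact: GS.
under eq_bigr do rewrite del_euler.
rewrite iszP.
under eq_bigr do rewrite del_euler conjc_nat.
have -> : \sum_k (isz b * isz k)%:R * G p a k = (isz b)%:R * G p a b.
  by have := iszP b a (G p)^T; rewrite !mxE => <-; apply: eq_bigr => k _; rewrite mxE.
by rewrite !natrD; move: (G p a b) => x; ring.
Qed.

Lemma dil_congr_entry t p m l (X Y : 'M[R[i]]_(d + 1)) a b : 0 < t ->
  X = (t ^+ l * (t ^+ m)^-1)%:C *: (jac (dil t) p *m Y *m ctrmx (jac (dil t) p)) ->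
  Y a b = (t ^+ m * (t ^+ (l + (isz a + isz b)))^-1)%:C * X a b.
Proof.
move=> t0 ->; rewrite mxE jac_dil_congr; move: (Y a b) => x.
have tm k : t ^+ k != 0 by rewrite expf_neq0// gt_eqF.
rewrite [in RHS]mulrA [in RHS]mulrA -rmorphXn -!rmorphM /=.
rewrite (_ : t ^+ m * (t ^+ (l + (isz a + isz b)))^-1 * (t ^+ l * (t ^+ m)^-1) *
  t ^+ (isz a + isz b) = 1) ?mul1r// exprD.
by have := tm (isz a + isz b)%N; move: (t ^+ (isz a + isz b)) (t ^+ m) (tm m)
  (t ^+ l) (tm l) => u y y0 z z0 u0; field; rewrite y0 z0 u0.
Qed.

Lemma ddbarR_scaling U (f : Cn R (d + 1) -> R) m l p : open U -> smooth U f -> U p ->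
  (forall t q, 0 < t -> U q -> U (dil t q)) ->
  (forall t q, 0 < t -> U q -> f (dil t q) = t ^+ m * (t ^+ l)^-1 * f q) ->
  forall t a b, 0 < t -> ddbarR f (dil t p) a b =
    (t ^+ m * (t ^+ (l + (isz a + isz b)))^-1)%:C * ddbarR f p a b.
Proof.
move=> oU sf Up dU fS t a b t0.
have tm k : t ^+ k != 0 by rewrite expf_neq0// gt_eqF.
have fE q : U q -> f q = t ^+ l * (t ^+ m)^-1 * f (dil t q).
  by move=> Uq; rewrite fS//; move: (f q) (t ^+ m) (tm m) (t ^+ l) (tm l)
    => x y y0 z z0; field; rewrite y0 z0.
exact: (dil_congr_entry a b t0
  (ddbarR_chain oU oU (holo_map_dil t oU) (fun q => dU t q t0) sf Up fE)).
Qed.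

End Dilation.

(** * The weight equation and homogeneity under dilations *)

Section WeightScaling.
Variables (R : realType) (d : nat) (U : set (Cn R (d + 1))).
Hypotheses (oU : open U) (dU : forall (t : R) q, 0 < t -> U q -> U (dil t q)).

Definition scales k (f : Cn R (d + 1) -> R) :=
  forall (t : R) q, 0 < t -> U q -> f (dil t q) = t ^+ k * f q.

Lemma scales_lieF k f p : smooth U f -> scales k f -> U p ->
  lieF (@euler R d) (fun q => (f q)%:C) p = k%:R * (f p)%:C.
Proof.
move=> sf fS Up; rewrite (lieF_cderive oU (csmooth_real sf) Up).
rewrite (@cderive_ev_scaling _ _ _ k 0) ?subr0// => t t0.
by rewrite fS// expr0 invr1 mulr1 rmorphM.
Qed.

(* Along r |-> f (dil (exp r) p) the weight equation becomes the linear ODE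
   y' = k y. *)
Lemma lieF_scales k f : smooth U f ->
  (forall p, U p -> lieF (@euler R d) (fun q => (f q)%:C) p = k%:R * (f p)%:C) ->
  scales k f.
Proof.
move=> sf fL t p t0 Up.
have D q : U q -> 'D_(ev q) f q = k%:R * f q.
  move=> Uq; have := fL q Uq; rewrite (lieF_cderive oU (csmooth_real sf) Uq).
  by move=> /(congr1 (@complex.Re R)); rewrite cReM /= mulr0 subr0
     -(rmorph_nat (real_complex R)).
pose G s := f (mkp (wpart p) 0 + s *: ev p).
have GE s : G s = f (dil s p) by rewrite /G -dilE.
have dG (s : R) : 0 < s -> is_derive s 1 G (s^-1 * (k%:R * G s)).
  move=> s0; have Us := dU s0 Up; have s00 : s != 0 by rewrite gt_eqF.
  have := @is_derive_line _ _ f (mkp (wpart p) 0) (ev p) s.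
  move=> H; have dv : derivable f (dil s p) (ev p) := smooth_derivable sf Us.
  rewrite dilE in dv; apply: is_derive_eq (H dv) _.
  rewrite -dilE GE -(D _ Us) ev_dil (smooth_dirZ _ _ sf Us) mulrA mulVf// mul1r.
  by [].
pose K r := G (expR r) * expR (- (k%:R * r)).
have dK (r : R) : is_derive r 1 K 0.
  have e0 := expR_gt0 r.
  have d1 := @is_derive1_comp R G (@expR R) r _ _ (dG _ e0) (is_derive_expR r).
  have d2 : is_derive r 1 (fun r => - (k%:R * r)) (- k%:R).
    have := @is_deriveN R R R _ _ _ _ (@is_deriveZ R R R id k%:R r 1 1 (is_derive_id _ _)).
    by rewrite [_ *: 1]mulr1.
  have d3 := @is_derive1_comp R (@expR R) (fun r => - (k%:R * r)) r _ _
    (is_derive_expR _) d2.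
  have d4 := @is_deriveM R R _ _ _ _ _ _ d1 d3.
  apply: is_derive_eq d4 _; rewrite /= /GRing.scale /=.
  move: (G (expR r)) (expR (- _)) (expR r) e0 => x y z z0.
  by field; rewrite gt_eqF.
have := @is_derive_0_is_cst R K (ln t) 0 dK.
rewrite /K expR0 mulr0 oppr0 expR0 mulr1 lnK ?posrE// !GE dil1 => E.
rewrite expRN expRM_natl lnK ?posrE// in E.
by rewrite -E mulrC mulfVK// expf_neq0// gt_eqF.
Qed.

End WeightScaling.

(** * The soliton equation in one chart *)

Section LocalSoliton.
Variables (R : realType) (d : nat) (D : complexManifold R d) (E : lineBundle D).
Variable h : hermitianMetric E.
Hypothesis h_kahler : kahler_curvature h.
Variables (i : cm_idx D) (j : lb_idx E).
Local Notation U := (@total_dom R d D E i j).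
Local Notation f0 := (pot h i j).

Let oU : open U. Proof. exact: total_dom_open. Qed.

Lemma total_dom_dil (t : R) p : 0 < t -> U p -> U (dil t p).
Proof.
move=> t0 [bw z0]; split; first by rewrite /= wpart_dil.
by rewrite /= zpart_dil mulf_neq0// complexR_eqE gt_eqF.
Qed.

Lemma pot_dil (t : R) p : 0 < t -> U p -> f0 (dil t p) = t ^+ 0 * (t ^+ 2)^-1 * f0 p.
Proof.
move=> t0 Up; rewrite /pot !h_total//; last exact: total_dom_dil.
rewrite wpart_dil zpart_dil expr0 mul1r -invfM; congr (_^-1).
by case: (zpart p) => x y /=; ring.
Qed.

Lemma ric_scaling p (t : R) a b : U p -> 0 < t -> ric (ddbarR f0) (dil t p) a b =
  (t ^+ 0 * (t ^+ (0 + (isz a + isz b)))^-1)%:C * ric (ddbarR f0) p a b.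
Proof.
move=> Up t0; have mf := pot_metric h_kahler i j.
have ti : 0 < t^-1 by rewrite invr_gt0.
have fg q : U q -> f0 q = (t^-1 ^+ 2)^-1 * f0 (dil t q).
  move=> Uq; rewrite pot_dil// expr0 mul1r exprVn invrK mulrA mulfV ?mul1r//.
  by rewrite expf_neq0// gt_eqF.
have := ric_chain oU oU (holo_map_dil t oU) (fun q => @total_dom_dil t q t0) ti mf mf fg Up.
move=> H; apply: (dil_congr_entry a b t0); rewrite expr0 invr1 mulr1 scale1r.
exact: H.
Qed.

Lemma exprV_scaleK (t : R) m (A B : R[i]) : t != 0 ->
  A = t^-1%:C ^+ m * B -> B = (t ^+ m)%:C * A.
Proof.
move=> t0 ->; rewrite mulrA -rmorphXn -rmorphM /= exprVn mulfV ?expf_neq0//.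
by rewrite mul1r.
Qed.

Lemma trlog_scaling (u : nat -> Cn R (d + 1) -> R) m (t : R) p : U p -> 0 < t ->
  (forall l, (0 < l)%N -> (l + 2 <= m)%N -> smooth U (u l) /\ scales U l (u l)) ->
  trlog_comp (pert_comp f0 u (dil t p)) m =
  (t ^+ m)%:C * trlog_comp (pert_comp f0 u p) m.
Proof.
move=> Up t0 su; have mf := pot_metric h_kahler i j.
have ti : 0 < t^-1 by rewrite invr_gt0.
have t00 : t != 0 by rewrite gt_eqF.
have fg q : U q -> f0 q = (t^-1 ^+ 2)^-1 * f0 (dil t q).
  move=> Uq; rewrite pot_dil// expr0 mul1r exprVn invrK mulrA mulfV ?mul1r//.
  by rewrite expf_neq0.
have sv l l0 lm := (su l l0 lm).1.
have uv l q : (0 < l)%N -> (l + 2 <= m)%N -> U q -> u l q = t^-1 ^+ l * u l (dil t q).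
  move=> l0 lm Uq; rewrite (su l l0 lm).2// mulrA exprVn mulVf ?mul1r//.
  by rewrite expf_neq0.
exact: (exprV_scaleK t00 (trlog_pert_natural oU oU (holo_map_dil t oU)
  (fun q => @total_dom_dil t q t0) ti mf mf fg Up sv uv)).
Qed.

(** Read with X the Hessian of T_k, Y that of u_(k) and c = k, the eigenvalue of the Lie derivative:
    the origin of 1 + k/2. *)
Lemma soliton_weight_eq n (X Y : 'M[R[i]]_n) (c : R[i]) :
  - X + 2^-1 *: (c *: Y) = - Y <-> X = (1 + c / 2) *: Y.
Proof.
rewrite scalerA (mulrC 2^-1) scalerDl scale1r; set B := (c / 2) *: Y.
split=> [/eqP|->]; last by rewrite opprD addrNK.
by rewrite addrC subr_eq addrC -subr_eq opprK addrC => /eqP.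
Qed.

Lemma formal_solitonP (u : nat -> Cn R (d + 1) -> R) p : U p ->
  (forall k, (0 < k)%N -> smooth U (u k) /\ scales U k (u k)) ->
  formal_soliton_at (@euler R d) f0 u p <->
  forall k, (0 < k)%N ->
    ddbar (fun q => trlog_comp (pert_comp f0 u q) k) p =
    (1 + k%:R / 2) *: ddbarR (u k) p.
Proof.
move=> Up su; have mf := pot_metric h_kahler i j.
have two : (2 : R[i]) != 0 by rewrite pnatr_eq0.
have Lu k : (0 < k)%N -> lie11 (@euler R d) (ddbarR (u k)) p = k%:R *: ddbarR (u k) p.
  move=> k0; have [sk Sk] := su k k0.
  apply: etrans (lie11_scaling (m := k) (l := 0) oU (msmooth_ddbarR oU sk) Up _) _;
    last by rewrite subr0.
  move=> t a b t0; apply: (ddbarR_scaling oU sk Up total_dom_dil) => //.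
  by move=> s q s0 Uq; rewrite expr0 invr1 mulr1; exact: Sk.
have L0 : lie11 (@euler R d) (ddbarR f0) p = (0%:R - 2%:R) *: ddbarR f0 p.
  apply: (lie11_scaling oU (msmooth_ddbarR oU mf.1) Up) => t a b t0.
  exact: (ddbarR_scaling oU mf.1 Up total_dom_dil (@pot_dil) a b t0).
have Lr : lie11 (@euler R d) (fun q => - ric (ddbarR f0) q) p = 0.
  have := @lie11_scaling R d U (fun q => - ric (ddbarR f0) q) 0 0 p oU.
  rewrite subrr scale0r; apply => //.
    apply: (msmooth_eq oU (fun q _ => esym (congr1 -%R (ricE f0 q)))).
    by do 2 apply: msmoothN => //; apply: msmooth_ddbarR => //; exact: smooth_logdet.
  have oppE (X Y : 'M[R[i]]_(d + 1)) c a b : X a b = c * Y a b ->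
      (- X) a b = c * (- Y) a b.
    by move=> XY; rewrite mxE [in RHS]mxE XY mulrN.
  by move=> t a b t0; apply: oppE; exact: ric_scaling.
have Lz : lie11 (@euler R d) (fun=> 0) p = 0.
  have := @lie11_scaling R d U (fun=> 0) 0 0 p oU.
  rewrite subrr scale0r; apply => //; first exact: msmooth_cst.
  by move=> t a b t0; rewrite mxE mulr0.
have half2 (X : 'M[R[i]]_(d + 1)) : 0 + 2^-1 *: ((0%:R - 2%:R) *: X) = - X.
  by rewrite add0r sub0r scalerA mulrN mulVf// scaleN1r.
split=> [H k k0|H].
  case: k k0 => [|k] k0; first exact: (False_ind _ (notF k0)).
  apply: (proj1 (soliton_weight_eq
    (ddbar (fun q => trlog_comp (pert_comp f0 u q) k.+1) p)
    (ddbarR (u k.+1) p) k.+1%:R)).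
  apply: etrans (H (Posz k.+1)).
  exact: (congr1 (fun M => _ + 2^-1 *: M) (esym (Lu _ k0))).
(* Weights 0, k + 1, -1, -2 and below -2, in this order. Weight 0 holds because Ric(omega_0) is
   invariant, weight -2 because half the Lie derivative of omega_0 is - omega_0. *)
case=> [[|k]|[|[|k]]].
- apply: etrans (congr1 (fun M => _ + 2^-1 *: M) Lr) _.
  by rewrite scaler0 addr0 opprK.
- apply: etrans (congr1 (fun M => _ + 2^-1 *: M) (Lu k.+1 isT)) _.
  exact: (proj2 (soliton_weight_eq
    (ddbar (fun q => trlog_comp (pert_comp f0 u q) k.+1) p)
    (ddbarR (u k.+1) p) k.+1%:R) (H k.+1 isT)).
- apply: etrans (congr1 (fun M => _ + 2^-1 *: M) Lz) _.
  by rewrite /= scaler0 addr0 oppr0.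
- apply: etrans (congr1 (fun M => _ + 2^-1 *: M) L0) _.
  exact: half2.
- apply: etrans (congr1 (fun M => _ + 2^-1 *: M) Lz) _.
  by rewrite /= scaler0 addr0 oppr0.
Qed.

End LocalSoliton.

(** * Existence *)

Lemma metric_pot_sub (R : realType) n (U W : set (Cn R n)) f :
  W `<=` U -> metric_pot U f -> metric_pot W f.
Proof.
move=> WU [sf df]; split; first exact: smooth_sub sf.
by move=> p /WU; exact: df.
Qed.

Lemma eq_pert_comp (R : realType) n (f : Cn R n -> R) (u v : nat -> Cn R n -> R) p k :
  (forall l, (0 < l)%N -> (l + 2 <= k)%N -> ddbarR (u l) p = ddbarR (v l) p) ->
  pert_comp f u p k = pert_comp f v p k.
Proof.
move=> uv; case: k uv => [|[|[|k]]] uv; [exact: erefl|exact: erefl|exact: erefl|].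
have k2 : (k.+1 + 2 <= k.+3)%N by rewrite addn2.
exact: (congr1 (fun M => invmx (ddbarR f p) *m M) (uv k.+1 isT k2)).
Qed.

Lemma eq_trlog_pert (R : realType) n (f : Cn R n -> R) (u v : nat -> Cn R n -> R) p k :
  (forall l, (0 < l)%N -> (l + 2 <= k)%N -> ddbarR (u l) p = ddbarR (v l) p) ->
  trlog_comp (pert_comp f u p) k = trlog_comp (pert_comp f v p) k.
Proof.
move=> uv; apply: eq_trlog_comp => l lk; apply: eq_pert_comp => m m0 ml.
by apply: uv => //; apply: leq_trans ml lk.
Qed.

Section Existence.
Variables (R : realType) (d : nat) (D : complexManifold R d) (E : lineBundle D).
Variable h : hermitianMetric E.
Hypothesis h_kahler : kahler_curvature h.

Definition in_chart (u : nat -> E -> R) (i : cm_idx D) (j : lb_idx E) :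
    nat -> Cn R (d + 1) -> R :=
  fun l q => u l (total_inv i j q).

Definition trlog_chart (u : nat -> E -> R) (k : nat) (i : cm_idx D) (j : lb_idx E)
    (p : Cn R (d + 1)) : R[i] :=
  trlog_comp (pert_comp (pot h i j) (in_chart u i j) p) k.

(** An arbitrary chart at each point, so that the next term can be defined directly on E;
    independence of the choice is a consequence of naturality. *)
Definition base_chart (e : E) : cm_idx D := sval (cid (cm_cover (lb_proj e))).
Definition fiber_chart (e : E) : lb_idx E := sval (cid (lb_cover E (lb_proj e))).

Lemma base_chartP e : cm_dom (base_chart e) (lb_proj e).
Proof. exact: svalP (cid (cm_cover (lb_proj e))). Qed.
Lemma fiber_chartP e : lb_dom (fiber_chart e) (lb_proj e).
Proof. exact: svalP (cid (lb_cover E (lb_proj e))). Qed.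

(** The factor is the inverse of 1 + k/2. The real part only changes the type: by [trlog_pert_real]
    the value is real once the earlier terms are smooth. *)
Definition next_term (u : nat -> E -> R) (k : nat) (e : E) : R :=
  2 / (k%:R + 2) * complex.Re
    (trlog_chart u k (base_chart e) (fiber_chart e)
       (coords (base_chart e) (fiber_chart e) e)).

Lemma next_term_local u v k : (forall l, (l < k)%N -> u l = v l) ->
  next_term u k = next_term v k.
Proof.
move=> uv; apply/funext => e.
apply: (congr1 (fun x => 2 / (k%:R + 2) * complex.Re x)).
apply: eq_trlog_pert => l _ lk; have -> // : in_chart u (base_chart e) (fiber_chart e) l =
  in_chart v (base_chart e) (fiber_chart e) l.
by rewrite /in_chart uv//; apply: leq_trans lk; rewrite addn2.
Qed.

(** Course-of-values recursion by iteration from the zero sequence: [next_term] at k reads only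
    terms below k, so the k-th term is final after k + 1 rounds. *)
Definition iterates n := iter n next_term (fun _ _ => 0).
Definition expansion k := iterates k.+1 k.

Lemma iterates_stable k n : (k < n)%N -> iterates n k = expansion k.
Proof.
elim/ltn_ind: k n => k IH [//|n] kn.
apply: (@next_term_local (iterates n) (iterates k) k) => l lk.
rewrite (IH _ lk n) ?(IH _ lk k)//.
exact: leq_trans lk kn.
Qed.

Lemma expansionE k : expansion k = next_term expansion k.
Proof.
apply: (@next_term_local (iterates k) expansion k) => l lk.
exact: iterates_stable.
Qed.

(** Naturality with c = 1: |S|^-2 and the u_(l) are functions on E', hence agree through the
    transition map. *)
Lemma trlog_chart_transition u k i i' j j' p : overlap i i' j j' p ->
  (forall l, (0 < l)%N -> (l + 2 <= k)%N -> smooth (total_dom i' j') (in_chart u i' j' l)) ->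
  trlog_chart u k i j p = trlog_chart u k i' j' (transition i i' j j' p).
Proof.
move=> op su; have oO := @overlap_open _ _ _ E i i' j j'.
have mf := metric_pot_sub (@overlap_total _ _ _ E i i' j j') (pot_metric h_kahler i j).
have fg q : overlap i i' j j' q -> pot h i j q =
    (1 ^+ 2)^-1 * pot h i' j' (transition i i' j j' q).
  by move=> oq; rewrite expr1n invr1 mul1r /pot transitionE.
have uv l q : (0 < l)%N -> (l + 2 <= k)%N -> overlap i i' j j' q ->
    in_chart u i j l q = 1 ^+ l * in_chart u i' j' l (transition i i' j j' q).
  by move=> _ _ oq; rewrite expr1n mul1r /in_chart transitionE.
have := trlog_pert_natural oO (@total_dom_open _ _ _ E i' j')
  (@holo_map_transition _ _ _ E i i' j j') (@transition_dom _ _ _ E i i' j j')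
  ltr01 mf (pot_metric h_kahler i' j') fg op su uv.
by move=> H; apply: etrans H _; rewrite expr1n mul1r.
Qed.

Lemma expansion_chart k :
  (forall l i j, (l < k)%N -> smooth (total_dom i j) (in_chart expansion i j l)) ->
  forall i j p, total_dom i j p ->
  in_chart expansion i j k p =
    2 / (k%:R + 2) * complex.Re (trlog_chart expansion k i j p).
Proof.
move=> su i j p tp; set e := total_inv i j p.
have op : overlap i (base_chart e) j (fiber_chart e) p.
  by apply: mem_overlap => //; [exact: base_chartP|exact: fiber_chartP].
apply: etrans (congr1 (fun f => f e) (expansionE k)) _.
apply: (congr1 (fun x => 2 / (k%:R + 2) * complex.Re x)).
apply: esym; apply: trlog_chart_transition op _ => l _ lk.
by apply: su; apply: leq_trans lk; rewrite addn2.
Qed.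

(** Induction over all charts together: identifying the k-th term with its expression in one chart
    needs smoothness of the earlier terms in the chart chosen at each point. *)
Lemma expansion_smooth_scales k i j :
  smooth (total_dom i j) (in_chart expansion i j k) /\
  scales (total_dom i j) k (in_chart expansion i j k).
Proof.
elim/ltn_ind: k i j => k IH i j; have oT := @total_dom_open _ _ _ E i j.
have cE := expansion_chart (fun l i j lk => (IH l lk i j).1).
have ss l : (0 < l)%N -> (l + 2 <= k)%N ->
    smooth (total_dom i j) (in_chart expansion i j l) /\
    scales (total_dom i j) l (in_chart expansion i j l).
  by move=> _ lk; apply: IH; apply: leq_trans lk; rewrite addn2.
split.
  apply: (smooth_eq oT (fun p tp => esym (cE i j p tp))).
  apply: smoothM => //; first exact: smooth_cst.
  exact: (csmooth_trlog_pert oT (pot_metric h_kahler i j) (fun l l0 lk => (ss l l0 lk).1)).1.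
move=> t p t0 tp; apply: etrans (cE i j _ (total_dom_dil t0 tp)) _.
apply: etrans (esym (congr1 ( *%R (t ^+ k)) (cE i j _ tp))).
apply: etrans (congr1 (fun x => 2 / (k%:R + 2) * complex.Re x)
  (trlog_scaling h_kahler tp t0 ss)) _.
rewrite /trlog_chart; move: (trlog_comp _ k) => x.
by rewrite cReM /= mul0r subr0 mulrCA.
Qed.

Lemma expansion_soliton : soliton_expansion h expansion.
Proof.
split.
- by move=> k k0 i j; exact: (expansion_smooth_scales k i j).1.
- move=> k k0 i j p tp; have [sk Sk] := expansion_smooth_scales k i j.
  exact: (scales_lieF (@total_dom_open _ _ _ E i j) sk Sk tp).
move=> i j p tp; have oT := @total_dom_open _ _ _ E i j.
apply/(formal_solitonP h_kahler tp (fun k _ => expansion_smooth_scales k i j)) => k k0.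
have sk := (expansion_smooth_scales k i j).1.
have cE := expansion_chart (fun l i j (_ : (l < k)%N) => (expansion_smooth_scales l i j).1).
have TE q : total_dom i j q ->
    trlog_comp (pert_comp (pot h i j) (in_chart expansion i j) q) k =
    ((1 + k%:R / 2) * in_chart expansion i j k q)%:C.
  move=> tq; apply: etrans (esym (trlog_pert_real oT (pot_metric h_kahler i j)
    (fun l l0 _ => (expansion_smooth_scales l i j).1) tq)) _.
  rewrite cE//; congr (_%:C); rewrite /trlog_chart.
  move: (complex.Re _) => x; have k2 : (k%:R + 2 : R) != 0.
    by rewrite gt_eqF// ltr_wpDl// ltr0n.
  by field.
apply: etrans (ddbar_eq oT tp TE) _.
apply: etrans (ddbarRZ oT (1 + k%:R / 2) sk tp) _.
congr (_ *: _).
by rewrite rmorphD rmorph1 rmorphM rmorph_nat fmorphV rmorph_nat.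
Qed.

End Existence.

(** * The maximum principle *)

Section SecondDerivativeTest.
Variables (R : realType).

(** Were the second derivative positive at x, it would be positive nearby, and the centered
    difference f (x + s v) - 2 f x + f (x - s v) would be positive too, against maximality. It is
    [mixed_difference] based at x - s v with both directions equal to v. *)
Lemma second_derivative_max (V : normedModType R) (U : set V) (f : V -> R) x v :
  open U -> smooth U f -> U x -> (forall y, U y -> f y <= f x) ->
  'D_v (fun y => 'D_v f y) x <= 0.
Proof.
move=> oU sf Ux mx; rewrite leNgt; apply/negP => c0.
have sDD := smooth_derive v (smooth_derive v sf).
have cDD := smooth_cont sDD Ux.
have /cvgrPdist_lt /(_ _ c0) /nbhs_ballP[r1 /= r10 rB] := cDD.
have [r2 r20 rU] := open_ballP oU Ux.
pose m := Num.min r1 r2.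
have m0 : 0 < m by rewrite lt_min r10 r20.
(* All points involved are x + (- s + a + b) v with |a|, |b| <= s, hence the 3. *)
pose C := 3 * `|v| + 1.
have C0 : 0 < C by rewrite ltr_wpDl// mulr_ge0.
pose s := m / C.
have s0 : 0 < s by rewrite divr_gt0.
have small (a : R) : `|a| <= 3 * s -> `|x + a *: v - x| < m.
  move=> ha; rewrite addrC addKr normrZ.
  apply: (@le_lt_trans _ _ (s * (3 * `|v|))).
    by rewrite mulrA (mulrC s) ler_wpM2r.
  have -> : m = s * C by rewrite /s divfK// gt_eqF.
  by rewrite ltr_pM2l// ltrDl.
have pt (a b : R) : x - s *: v + a *: v + b *: v = x + (- s + a + b) *: v.
  by rewrite !scalerDl scaleNr !addrA.
have bd (a b : R) : `|a| <= s -> `|b| <= s -> `|- s + a + b| <= 3 * s.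
  move=> ha hb; apply: le_trans (ler_normD _ _) _.
  have : `|- s + a| <= `|-s| + `|a| by exact: ler_normD.
  by rewrite normrN (gtr0_norm s0); lra.
have Uab (a b : R) : `|a| <= s -> `|b| <= s -> U (x - s *: v + a *: v + b *: v).
  move=> ha hb; rewrite pt; apply: rU; apply: lt_le_trans (small _ (bd _ _ ha hb)) _.
  by rewrite ge_min lexx orbT.
have [|a [b [ha hb EQ]]] := @mixed_difference R V f (x - s *: v) v v s s0.
  move=> a b ha hb; have Up := Uab _ _ ha hb; split; first exact: smooth_derivable Up.
  exact: smooth_derivable (smooth_derive v sf) Up.
have ss : `|s| <= s by rewrite gtr0_norm.
have s00 : `|0 : R| <= s by rewrite normr0 ltW.
have F1 := mx _ (Uab s s ss ss).
have F2 := mx _ (Uab 0 0 s00 s00); rewrite scale0r !addr0 in F2.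
have pos : 0 < 'D_v (fun y => 'D_v f y) (x - s *: v + a *: v + b *: v).
  have := rB (x - s *: v + a *: v + b *: v); rewrite -ball_normE /= distrC pt.
  move=> /(_ (lt_le_trans (small _ (bd _ _ ha hb)) _)).
  rewrite ge_min lexx => /(_ isT); rewrite ltr_norml => /andP[_].
  by rewrite ltrBlDr ltrDl.
have : 0 < s * s * 'D_v (fun y => 'D_v f y) (x - s *: v + a *: v + b *: v).
  exact: (mulr_gt0 (mulr_gt0 s0 s0) pos).
rewrite subrK in EQ F1; rewrite -EQ -addrA (addrC _ (f _)) addrA -addrA.
by apply/negP; rewrite -leNgt -[leRHS](addr0 0) lerD// subr_le0.
Qed.

(** The right-hand side is a quarter of the Laplacian in the a-th complex coordinate. *)
Lemma Re_ddbarR_diag n (U : set (Cn R n)) (f : Cn R n -> R) a p :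
  open U -> smooth U f -> U p ->
  complex.Re (ddbarR f p a a) = 2^-1 * (2^-1 *
    ('D_(dirRe R a) (fun y => 'D_(dirRe R a) f y) p +
     'D_(dirIm R a) (fun y => 'D_(dirIm R a) f y) p)).
Proof.
move=> oU sf Up.
have E0 (v : Cn R n) q : cderive (fun q => (f q)%:C) v q = ('D_v f q)%:C.
  by rewrite /cderive /=; congr (_ +i* _); exact: derive_cst.
have halfC : (2^-1 : R[i]) = (2^-1)%:C by rewrite fmorphV rmorph_nat.
have E1 q : delbar a (fun q => (f q)%:C) q =
    (2^-1 * 'D_(dirRe R a) f q) +i* (2^-1 * 'D_(dirIm R a) f q).
  rewrite /delbar !E0 halfC; move: ('D_(dirRe R a) f q) ('D_(dirIm R a) f q) => x y.
  by apply: complexP => /=; ring.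
have dZ (g : Cn R n -> R) v : smooth U g ->
    'D_v (fun q => 2^-1 * g q) p = 2^-1 * 'D_v g p.
  move=> sg; have dg : derivable g p v by exact: smooth_derivable Up.
  exact: (@deriveZ R (Cn R n) R g 2^-1 p v dg).
apply: etrans (congr1 (@complex.Re R) (ddbarRE f p a a)) _.
have -> : delbar a (fun q => (f q)%:C) = (fun q =>
    (2^-1 * 'D_(dirRe R a) f q) +i* (2^-1 * 'D_(dirIm R a) f q)).
  by apply/funext.
have reh (A B : R[i]) : complex.Re (2^-1 * (A - 'i * B)) =
    2^-1 * (complex.Re A + complex.Im B).
  by rewrite halfC; case: A => x y; case: B => z t /=; ring.
apply: etrans (reh _ _) _.
apply: etrans (congr1 ( *%R 2^-1) (congr2 +%R
  (dZ _ (dirRe R a) (smooth_derive (dirRe R a) sf))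
  (dZ _ (dirIm R a) (smooth_derive (dirIm R a) sf)))) _.
by rewrite -mulrDr.
Qed.

(** The affine complex line z |-> p + z v. Its Jacobian is v, so restricting to it turns the Hessian
    form at v into a one-variable Laplacian. *)
Definition cline n (p : Cn R n) (v : 'rV[R[i]]_n) (z : Cn R 1) : Cn R n :=
  (\row_a complex.Re (ccoord p a + ccoord z ord0 * v 0 a),
   \row_a complex.Im (ccoord p a + ccoord z ord0 * v 0 a)).

Lemma ccoord_cline n (p : Cn R n) v z a :
  ccoord (cline p v z) a = ccoord p a + ccoord z ord0 * v 0 a.
Proof.
rewrite {1}/ccoord /cline /= !mxE.
by move: (ccoord p a + _) => -[].
Qed.

Lemma holo_map_cline n (p : Cn R n) v : holo_map setT (cline p v).
Proof.
move=> a; have oT := @openT (Cn R 1).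
apply: (holomorphic_eq oT (F := fun z => ccoord p a + ccoord z ord0 * v 0 a)).
  by move=> z _; rewrite ccoord_cline.
have sc := @csmooth_ccoord R 1 setT ord0.
have hM : holomorphic setT (fun z : Cn R 1 => ccoord z ord0 * v 0 a).
  by apply: holomorphicM; [exact: oT|exact: holomorphic_ccoord|exact: holomorphic_cst].
split; first by apply: csmoothD; [exact: oT|exact: csmooth_cst|exact: hM.1].
move=> z _ k; rewrite (delbarD _ (csmooth_cst setT (ccoord p a)) hM.1 (I : setT z)).
by rewrite delbar_cst hM.2 ?addr0.
Qed.

Lemma jac_cline n (p : Cn R n) v z : jac (cline p v) z = v.
Proof.
apply/matrixP => k a; rewrite mxE !ord1.
have -> : (fun z => ccoord (cline p v z) a) =
    (fun z => ccoord p a + ccoord z ord0 * v 0 a).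
  by apply/funext => y; exact: ccoord_cline.
have sc := @csmooth_ccoord R 1 setT ord0.
have sv := csmooth_cst (V := Cn R 1) setT (v 0 a).
rewrite (delD _ (csmooth_cst setT (ccoord p a)) (csmoothM (@openT _) sc sv) (I : setT z)).
rewrite (delM _ sc sv (I : setT z)) !del_cst del_ccoord eqxx.
by rewrite add0r mulr0 add0r mul1r.
Qed.

Lemma cline0 n (p : Cn R n) v : cline p v 0 = p.
Proof.
have E : forall a, ccoord p a + ccoord (0 : Cn R 1) ord0 * v 0 a = ccoord p a.
  move=> a; have -> : ccoord (0 : Cn R 1) ord0 = 0 by rewrite /ccoord !mxE.
  by rewrite mul0r addr0.
rewrite /cline; case: p E => x y E; congr (_, _); apply/rowP => a; rewrite mxE E.
  by [].
by [].
Qed.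

Lemma Re_ddbarR_max n (U : set (Cn R n)) (f : Cn R n -> R) p (v : 'rV[R[i]]_n) :
  open U -> smooth U f -> U p -> (forall q, U q -> f q <= f p) ->
  complex.Re ((v *m ddbarR f p *m ctrmx v) 0 0) <= 0.
Proof.
move=> oU sf Up mx.
have hc := holo_map_cline p v.
have sc : csmooth_map setT (cline p v) by move=> k; have [] := hc k.
pose W := cline p v @^-1` U.
have oW : open W.
  by apply: open_comp => // z _; exact: (csmooth_map_cont sc (I : setT z)).
have hW : holo_map W (cline p v) by move=> k; apply: holomorphic_sub (hc k).
have W0 : W 0 by rewrite /W /= cline0.
have sW : csmooth_map W (cline p v) by move=> k; have [] := hW k.
have sg := smooth_comp oW oU sW (fun z Wz => Wz) sf.
have := ddbar_chain oW oU hW (fun z Wz => Wz) (csmooth_real sf) W0.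
rewrite cline0 jac_cline => /matrixP/(_ 0 0) H.
apply: (@le_trans _ _ (complex.Re (ddbarR (fun z => f (cline p v z)) 0 0 0))).
  by rewrite le_eqVlt (congr1 (@complex.Re R) H) eqxx.
rewrite (Re_ddbarR_diag _ oW sg W0) !pmulr_rle0 ?invr_gt0//.
have M z : W z -> f (cline p v z) <= f (cline p v 0) by move=> Wz; rewrite cline0; exact: mx.
have M1 := second_derivative_max (dirRe R 0) oW sg W0 M.
have M2 := second_derivative_max (dirIm R 0) oW sg W0 M.
by apply: le_trans (lerD M1 M2) _; rewrite addr0.
Qed.

End SecondDerivativeTest.

Lemma smoothX (R : realType) (V : normedModType R) (U : set V) (f : V -> R) n :
  open U -> smooth U f -> smooth U (fun x => f x ^+ n).
Proof.
move=> oU sf; elim: n => [|n IH]; first exact: smooth_cst.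
by under eq_fun do rewrite exprS; exact: smoothM.
Qed.

(** * Maxima of dilation-invariant functions on E' *)

Section Compactness.
Variables (R : realType) (d : nat) (D : complexManifold R d) (E : lineBundle D).
Hypothesis D_compact : compact [set: D].

Lemma polydisc_small (w0 : Cn R d) (e : R) : 0 < e -> exists2 r : R, 0 < r &
  forall w : Cn R d, (forall k, `|w.1 0 k - w0.1 0 k| <= r /\ `|w.2 0 k - w0.2 0 k| <= r) ->
    `|w - w0| < e.
Proof.
move=> e0; pose C := \sum_(k < d) (`|dirRe R k| + `|dirIm R k|) : R.
have C0 : 0 <= C by apply: sumr_ge0 => k _; rewrite addr_ge0.
have C1 : 0 < C + 1 by rewrite ltr_wpDl.
exists (e / (C + 1)); first by rewrite divr_gt0.
move=> w H; apply: (@le_lt_trans _ _ (e / (C + 1) * C)); last first.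
  by rewrite -mulrA gtr_pMr// mulrC ltr_pdivrMr// mul1r ltrDl.
rewrite [w - w0]Cn_decomp; apply: le_trans (ler_norm_sum _ _ _) _.
rewrite mulr_sumr; apply: ler_sum => k _; apply: le_trans (ler_normD _ _) _.
rewrite !normrZ mulrDr; have [H1 H2] := H k.
by apply: lerD; apply: ler_wpM2r => //; rewrite !mxE.
Qed.

(** A compact slice: over a polydisc of the base, every dilation orbit meets |z| = 1. *)
Definition polydisc_circle (w0 : Cn R d) (r : R) : set (Cn R (d + 1)) :=
  [set p : Cn R (d + 1) | (forall k, `|p.1 0 (lshift 1 k) - w0.1 0 k| <= r /\
                      `|p.2 0 (lshift 1 k) - w0.2 0 k| <= r) /\
           complex.Re (zpart p * conjc (zpart p)) = 1].

Lemma polydisc_circle_compact w0 r : compact (polydisc_circle w0 r).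
Proof.
pose box (c : 'rV[R]_d) : set 'rV[R]_(d + 1) :=
  [set x | forall a, `[row_mx (c - const_mx r) (const_mx (-1)) 0 a,
                      row_mx (c + const_mx r) (const_mx 1) 0 a]%classic (x ord0 a)].
have cbox c : compact (box c).
  by apply: (@rV_compact R _ (fun a => _)) => a; exact: segment_compact.
apply: (@subclosed_compact _ _ (box w0.1 `*` box w0.2)); last 2 first.
- exact: compact_setX.
- move=> p [H1 H2]; have zE : (zpart p) = p.1 0 (rshift d ord0) +i* p.2 0 (rshift d ord0) by [].
  rewrite zE /= mulrN opprK -!expr2 in H2.
  have [b1 b2] : `|p.1 0 (rshift d ord0)| <= 1 /\ `|p.2 0 (rshift d ord0)| <= 1.
    split; rewrite -(@ler_pXn2r _ 2)// ?nnegrE// expr1n real_normK ?num_real// -H2.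
      by rewrite lerDl sqr_ge0.
    by rewrite lerDr sqr_ge0.
  split=> a /=; rewrite in_itv /=; case: (split_ordP a) => k ->;
    rewrite ?row_mxEl ?row_mxEr !mxE.
  + by have [+ _] := H1 k; rewrite ler_distl.
  + by move: b1; rewrite (ord1 k) ler_norml.
  + by have [_] := H1 k; rewrite ler_distl.
  + by move: b2; rewrite (ord1 k) ler_norml.
have clos (g : Cn R (d + 1) -> R) (c : R) : continuous g -> closed [set p | g p <= c].
  move=> cg; apply: (@preimage_closed _ _ g [set y | y <= c]); last exact: closed_le.
  by move=> x _; exact: cg.
(* Every condition becomes a sublevel set of a continuous function, the equation of the circle being
   split into two inequalities. *)
have -> : polydisc_circle w0 r =
   (\bigcap_k ([set p : Cn R (d + 1) | `|p.1 0 (lshift 1 k) - w0.1 0 k| <= r] `&`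
               [set p : Cn R (d + 1) | `|p.2 0 (lshift 1 k) - w0.2 0 k| <= r])) `&`
   ([set p | complex.Re (zpart p * conjc (zpart p)) <= 1] `&`
    [set p | - complex.Re (zpart p * conjc (zpart p)) <= -1]).
  apply/seteqP; split=> p [H1 H2]; split.
  - by move=> k _; exact: H1.
  - by split; rewrite /mkset H2.
  - by move=> k; exact: H1 k I.
  - case: H2 => H2 H3; apply/eqP; rewrite eq_le; apply/andP; split; first exact: H2.
    by rewrite -lerN2; exact: H3.
have cz : continuous (fun p => complex.Re (@zpart R d p * conjc (zpart p))).
  move=> p; exact: (smooth_cont (@smooth_sqz R d setT (@openT _)) (I : setT p)).
apply: closedI; last first.
  apply: closedI; apply: clos => // p.
  have := smoothN (@openT _) (@smooth_sqz R d setT (@openT _)).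
  by move=> /smooth_cont /(_ (I : setT p)).
apply: closed_bigI => k _; apply: closedI; apply: clos => p.
  apply: (@continuous_comp _ _ _ (fun q : Cn R (d + 1) => q.1 0 (lshift 1 k) - w0.1 0 k)
    (fun x : R => `|x|)); last exact: norm_continuous.
  by apply: continuousB; [exact: re_coord_continuous|exact: cst_continuous].
apply: (@continuous_comp _ _ _ (fun q : Cn R (d + 1) => q.2 0 (lshift 1 k) - w0.2 0 k)
    (fun x : R => `|x|)); last exact: norm_continuous.
by apply: continuousB; [exact: im_coord_continuous|exact: cst_continuous].
Qed.

(** Over a neighborhood of each point of D, invariance bounds g by its maximum on a compact slice;
    the near-covering form of compactness makes one bound serve all of D. *)
Lemma scale_invariant_bounded (g : E -> R) :
  (forall i j p, total_dom i j p -> {for p, continuous (fun q => g (total_inv i j q))}) ->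
  (forall i j p (t : R), total_dom i j p -> 0 < t ->
     g (total_inv i j (dil t p)) = g (total_inv i j p)) ->
  exists M : R, forall e, off_zero e -> g e <= M.
Proof.
move=> gc gs.
pose P (M : R) (x : D) := forall e, lb_proj e = x -> off_zero e -> g e <= M.
have /compact_near_coveringP nc := D_compact.
have H : \forall M \near +oo, [set: D] `<=` P M.
  apply: nc => x _.
  have [i xi] := cm_cover x; have [j xj] := lb_cover E x.
  pose w0 := cm_chart i x.
  have bw : base_dom i j w0 by exists x.
  have [e e0 eB] := open_ballP (@base_dom_open _ _ _ E i j) bw.
  have [r r0 rB] := polydisc_small w0 e0.
  pose K := polydisc_circle w0 r.
  have KT : K `<=` total_dom i j.
    move=> p [H1 H2]; split.
      apply: eB; apply: rB => k; have := H1 k.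
      by rewrite /wpart /= !mxE.
    apply/negP => /eqP z0; move/eqP: H2; rewrite z0 mul0r eq_sym /=.
    by rewrite oner_eq0.
  have K0 : K !=set0.
    exists (mkp w0 1); split=> [k|].
      by rewrite /= !row_mxEl !subrr normr0 ltW.
    by rewrite zpart_mkp mul1r conjc1.
  have [|c cK cM] := @compact_EVT_max _ R (fun p => g (total_inv i j p)) K K0
    (@polydisc_circle_compact w0 r).
    apply: continuous_in_subspaceT => p; rewrite inE => Kp; apply: gc; exact: KT.
  pose N := [set y | cm_dom i y /\ lb_dom j y /\ forall k,
    `|(cm_chart i y).1 0 k - w0.1 0 k| < r /\ `|(cm_chart i y).2 0 k - w0.2 0 k| < r].
  have nN : nbhs x N.
    have n1 : nbhs x (cm_dom i) by apply: open_nbhs_nbhs; split=> //; exact: cm_dom_open.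
    have n2 : nbhs x (lb_dom j) by apply: open_nbhs_nbhs; split=> //; exact: lb_dom_open.
    have n3 : \forall y \near x, forall k : 'I_d,
       `|(cm_chart i y).1 0 k - w0.1 0 k| < r /\ `|(cm_chart i y).2 0 k - w0.2 0 k| < r.
      apply: filter_forall => k; have cc := cm_chart_cont xi.
      have c1 : {for x, continuous (fun y => (cm_chart i y).1 0 k)}.
        by apply: (@continuous_comp _ _ _ (cm_chart i) (fun p : Cn R d => p.1 0 k)) => //;
          exact: re_coord_continuous.
      have c2 : {for x, continuous (fun y => (cm_chart i y).2 0 k)}.
        by apply: (@continuous_comp _ _ _ (cm_chart i) (fun p : Cn R d => p.2 0 k)) => //;
          exact: im_coord_continuous.
      have /cvgrPdist_lt /(_ r r0) f1 := c1.
      have /cvgrPdist_lt /(_ r r0) f2 := c2.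
      by apply: filterS2 f1 f2 => y h1 h2; rewrite distrC [X in _ /\ X < _]distrC.
    by apply: filterS3 n1 n2 n3 => y y1 y2 y3; split=> //; split.
  exists (N, [set M | g (total_inv i j c) <= M]) => /=.
    by split=> //; apply: nbhs_pinfty_ge; exact: num_real.
  move=> [y M] /= [[yi [yj yr]] cM'] e' ey e'0; apply: le_trans cM'.
  have ti : total_dom i j (coords i j e') by apply: coords_dom; rewrite ?ey.
  pose p := coords i j e'.
  have zp := Re_mulcJ_gt0 ti.2.
  (* Dividing by |z| moves the point along its orbit onto the slice. *)
  pose t := (Num.sqrt (complex.Re (zpart p * conjc (zpart p))))^-1.
  have t0 : 0 < t by rewrite invr_gt0 sqrtr_gt0.
  have -> : g e' = g (total_inv i j (dil t p)).
    by rewrite gs// /p coordsK ?ey.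
  apply: cM; rewrite inE; split.
    have wE : cm_chart i y = wpart (dil t p).
      by rewrite wpart_dil /p /coords wpart_mkp ey.
    have w1 q k : (@wpart R d q).1 0 k = q.1 0 (lshift 1 k) by rewrite mxE.
    have w2 q k : (@wpart R d q).2 0 k = q.2 0 (lshift 1 k) by rewrite mxE.
    move=> k; have [h1 h2] := yr k; rewrite wE w1 in h1; rewrite wE w2 in h2.
    by split; apply: ltW.
  rewrite zpart_dil.
  have -> (z : R[i]) : complex.Re (t%:C * z * conjc (t%:C * z)) =
     t ^+ 2 * complex.Re (z * conjc z).
    by case: z => a b /=; ring.
  rewrite exprVn sqr_sqrtr ?mulVf//; last exact: ltW.
  by rewrite gt_eqF.
have [M HM] := filter_ex H.
by exists M => e e0; apply: (HM (lb_proj e) I e erefl e0).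
Qed.

(** Boundedness alone suffices, with no compact quotient of E': if the supremum were not attained,
    (sup S - g)^-1 would be continuous, invariant and therefore bounded, which keeps g away from its
    supremum. *)
Lemma scale_invariant_max (g : E -> R) (e1 : E) : off_zero e1 ->
  (forall i j p, total_dom i j p -> {for p, continuous (fun q => g (total_inv i j q))}) ->
  (forall i j p (t : R), total_dom i j p -> 0 < t ->
     g (total_inv i j (dil t p)) = g (total_inv i j p)) ->
  exists2 e0, off_zero e0 & forall e, off_zero e -> g e <= g e0.
Proof.
move=> e10 gc gs.
have [M gM] := scale_invariant_bounded gc gs.
pose S := [set g e | e in @off_zero _ _ _ E].
have hS : has_sup S.
  split; first by exists (g e1); exists e1.
  by exists M => _ [e e0 <-]; exact: gM.
have gS e : off_zero e -> g e <= sup S.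
  by move=> e0; apply: sup_upper_bound => //; exists e.
have [[e0 e00 ge0]|nE] := pselect (exists2 e0, off_zero e0 & g e0 = sup S).
  by exists e0 => // e ee; rewrite ge0; exact: gS.
exfalso.
have lt e : off_zero e -> g e < sup S.
  move=> e0; rewrite lt_neqAle gS// andbT; apply/eqP => ge.
  by apply: nE; exists e.
have [|p q t|M' gM'] := @scale_invariant_bounded (fun e => (sup S - g e)^-1).
- move=> i j p tp.
  apply: (@continuousV _ _ (fun q => sup S - g (total_inv i j q))).
    by rewrite gt_eqF// subr_gt0 lt//; exact: total_inv_off_zero.
  by apply: continuousB; [exact: cst_continuous|exact: gc].
- by move=> s ts s0; rewrite gs.
have M'0 : 0 < M'.
  by apply: lt_le_trans (gM' e1 e10); rewrite invr_gt0 subr_gt0 lt.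
have iM : 0 < M'^-1 by rewrite invr_gt0.
have [_ [e e0 <-]] := sup_adherent iM hS.
rewrite ltrBlDr -ltrBlDl => H.
have := gM' e e0; rewrite leNgt => /negP; apply.
by rewrite -[ltLHS]invrK ltf_pV2 ?posrE// subr_gt0 lt.
Qed.

End Compactness.

(** The Hessian of 2 log |F| is 2 (del delbar F / F - del F delbar F / F^2), and the first term
    vanishes by hypothesis. *)
Lemma ddbar_ln_sq (R : realType) n (U : set (Cn R n)) (F : Cn R n -> R) p a b :
  open U -> smooth U F -> (forall q, U q -> F q != 0) -> U p -> ddbarR F p = 0 ->
  ddbarR (fun q => ln (F q * F q)) p a b = - (2 * ((F p)%:C ^+ 2)^-1) *
    (del a (fun q => (F q)%:C) p * delbar b (fun q => (F q)%:C) p).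
Proof.
move=> oU sF F0 Up hF; have sC := csmooth_real sF.
have FC0 q : U q -> (F q)%:C != 0 by move=> /F0; rewrite complexR_eqE.
have F2 q : U q -> 0 < F q * F q by move=> /F0 Fq; rewrite -expr2 exprn_even_gt0.
have sF2 := smoothM oU sF sF.
have sV := csmoothV oU FC0 sC; have sb := csmooth_delbar oU b sC.
have E q : U q -> delbar b (fun q => (ln (F q * F q))%:C) q =
    2 * ((F q)%:C^-1 * delbar b (fun q => (F q)%:C) q).
  move=> Uq; apply: etrans (delbar_ln b F2 sF2 Uq) _.
  rewrite (delbar_eq oU b Uq (G := fun q => (F q)%:C * (F q)%:C)); last first.
    by move=> r _; rewrite rmorphM.
  have -> : (F q * F q)^-1%:C = ((F q)%:C * (F q)%:C)^-1.
    by rewrite complexR_inv rmorphM.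
  rewrite (delbarM b sC sC Uq).
  move: (delbar b _ q) ((F q)%:C) (FC0 q Uq) => x y y0.
  by field.
apply: etrans (ddbarRE (fun q => ln (F q * F q)) p a b) _.
apply: etrans (del_eq oU a Up E) _.
apply: etrans (delZ 2 a (csmoothM oU sV sb) Up) _.
apply: etrans (congr1 ( *%R 2) (delM a sV sb Up)) _.
have z : del a (delbar b (fun q => (F q)%:C)) p = 0.
  apply: etrans (esym (ddbarRE F p a b)) _.
  by apply: etrans (congr1 (fun M : 'M[R[i]]_n => M a b) hF) _; rewrite mxE.
apply: etrans (congr1 (fun x => 2 * (_ * x + _)) z) _.
apply: etrans (congr1 (fun x => 2 * (_ * 0 + x * _)) (delV oU a FC0 sC Up)) _.
move: (del a _ p) (delbar b _ p) ((F p)%:C) => x y w.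
by rewrite mulr0 add0r; ring.
Qed.

(** * Vanishing of homogeneous pluriharmonic functions *)

Section Vanishing.
Variables (R : realType) (d : nat) (D : complexManifold R d) (E : lineBundle D).
Variable h : hermitianMetric E.
Hypotheses (d_gt0 : (0 < d)%N) (D_compact : compact [set: D]).
Hypothesis h_kahler : kahler_curvature h.

(* At an interior maximum of log (F^2 |S|^-2k) the complex Hessian is nonpositive,
   but on the kernel of dF it equals k times the curvature of h. *)
Lemma pluriharmonic_no_max (i : cm_idx D) (j : lb_idx E) k (F : Cn R (d + 1) -> R) p :
  (0 < k)%N -> total_dom i j p -> smooth (total_dom i j) F ->
  scales (total_dom i j) k F -> ddbarR F p = 0 -> F p != 0 ->
  ~ (forall q, total_dom i j q -> F q ^+ 2 * pot h i j q ^+ k <= F p ^+ 2 * pot h i j p ^+ k).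
Proof.
move=> k0 tp sF SF hF Fp mx.
have oT := @total_dom_open _ _ _ E i j.
pose U := [set q | total_dom i j q /\ F q != 0].
have oU : open U.
  rewrite openE => q [tq Fq]; rewrite /interior.
  have n1 : nbhs q (total_dom i j) by apply: open_nbhs_nbhs.
  have n2 : \forall r \near q, F r != 0.
    have cF := smooth_cont sF tq.
    exact: (cvgr_neq0 (F q) cF Fq).
  by apply: filterS2 n1 n2 => r; split.
have UT : U `<=` total_dom i j by move=> q [].
have Up : U p by [].
have sFU := smooth_sub UT sF.
have F0 q : U q -> F q != 0 by case.
have F2 q : U q -> 0 < F q * F q by move=> /F0 Fq; rewrite -expr2 exprn_even_gt0.
have sl : smooth U (fun q => ln (F q * F q)).
  by apply: smooth_ln => //; exact: smoothM.
have slp : smooth U (lpot h i j).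
  apply: (smooth_sub UT); apply: smoothD => //; apply: smoothN => //.
    exact: smooth_ln_hbase_wpart.
  exact: smooth_ln_sqz.
have skl : smooth U (fun q => k%:R * lpot h i j q).
  by apply: smoothM => //; exact: smooth_cst.
have PhiE q : U q -> ln (F q * F q) + k%:R * lpot h i j q =
    ln (F q ^+ 2 * pot h i j q ^+ k).
  move=> Uq; have tq := UT q Uq; have pq := pot_gt0 h tq.
  have -> : ln (F q ^+ 2 * pot h i j q ^+ k) = ln (F q ^+ 2) + ln (pot h i j q ^+ k).
    by apply: lnM; rewrite posrE; [rewrite expr2; exact: F2 | exact: exprn_gt0].
  by rewrite (lnXn k pq) -lpotE// expr2 mulr_natl.
have mPhi q : U q -> ln (F q * F q) + k%:R * lpot h i j q <=
                     ln (F p * F p) + k%:R * lpot h i j p.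
  move=> Uq; rewrite !PhiE// ler_ln ?posrE; first exact/mx/UT.
    apply: mulr_gt0; [by rewrite expr2; exact: F2 | apply: exprn_gt0].
    exact: pot_gt0 (UT q Uq).
  apply: mulr_gt0; [by rewrite expr2; exact: F2 | apply: exprn_gt0].
  exact: pot_gt0 tp.
pose L : 'cV[R[i]]_(d + 1) := \col_a del a (fun q => (F q)%:C) p.
pose z := rshift d (ord0 : 'I_1).
have LJ b : delbar b (fun q => (F q)%:C) p = conjc (del b (fun q => (F q)%:C) p).
  apply: etrans (delbarJ b (csmooth_real sF) tp).
  by apply: (delbar_eq oT b tp) => q _; rewrite conjc_real.
(* If del F / del z vanished at p, so would V F = k F, although F p != 0. *)
have Lz : L z 0 != 0.
  rewrite mxE; apply/negP => /eqP dz.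
  have := scales_lieF oT sF SF tp; rewrite /lieF big_split_ord /= big_ord1 big1.
    rewrite add0r -/z LJ dz conjc0 !mulr0 addr0 => /esym/eqP.
    by rewrite mulf_eq0 pnatr_eq0 complexR_eqE (negbTE Fp) orbF -leqn0 leqNgt k0.
  by move=> l _; rewrite /euler row_mxEl mxE conjc0 !mul0r addr0.
pose w : 'rV[R[i]]_d := delta_mx 0 (Ordinal d_gt0).
(* The vertical component that corrects the base vector w to a vector annihilated by del F. *)
pose c := - ((w *m usubmx L) 0 0 / L z 0).
pose v : 'rV[R[i]]_(d + 1) := row_mx w c%:M.
have w0 : w != 0.
  apply/negP => /eqP/rowP/(_ (Ordinal d_gt0)); rewrite !mxE !eqxx => /eqP.
  by rewrite oner_eq0.
have vL : v *m L = 0.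
  rewrite -[L]vsubmxK mul_row_col; apply/matrixP => a b; rewrite !ord1.
  rewrite [LHS]mxE [X in _ + X = _]mxE big_ord1 [RHS]mxE [c%:M _ _]mxE eqxx mulr1n.
  have -> : dsubmx L 0 0 = L z 0 by rewrite mxE.
  rewrite /c mulNr divfK; last exact: Lz.
  by rewrite subrr.
have Hl : ddbarR (fun q => ln (F q * F q)) p =
    (- (2 * ((F p)%:C ^+ 2)^-1)) *: (L *m ctrmx L).
  apply/matrixP => a b.
  apply: etrans (ddbar_ln_sq a b oU sFU F0 Up hF) _.
  rewrite [RHS]mxE [(L *m _) a b]mxE big_ord1 ![L _ _]mxE; congr (_ * (_ * _)).
  by rewrite LJ /ctrmx !mxE.
pose J := jac (@wpart R d) p; pose C := curvature h i j (wpart p).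
have HPhi : ddbarR (fun q => ln (F q * F q) + k%:R * lpot h i j q) p =
   (- (2 * ((F p)%:C ^+ 2)^-1)) *: (L *m ctrmx L) + (k%:R : R)%:C *: (J *m C *m ctrmx J).
  apply: etrans (ddbarRD oU sl skl Up) _.
  apply: congr2 Hl _.
  apply: etrans (ddbarRZ oU k%:R slp Up) _.
  exact: (congr1 (fun M => _ *: M) (ddbar_lpot h tp)).
have := Re_ddbarR_max v oU (smoothD oU sl skl) Up mPhi.
rewrite leNgt => /negP; apply.
have [_ _ pc _ _] := h_kahler i j; have pos := pc _ tp.1 w w0.
rewrite quadE in pos.
rewrite HPhi mulmxDr mulmxDl -!scalemxAr -!scalemxAl quad_congr.
have -> : v *m (L *m ctrmx L) *m ctrmx v = 0 by rewrite mulmxA vL !mul0mx.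
have -> : v *m J = w.
  by rewrite /J jac_wpart mul_row_col mulmx1 mulmx0 addr0.
rewrite scaler0 add0r mxE -/C.
move: pos; rewrite -/C; move: ((w *m C *m ctrmx w) 0 0) => x.
rewrite ltcE => /andP[_ x0]; rewrite cReM /= mul0r subr0 mulr_gt0//.
by rewrite ltr0n.
Qed.

Lemma h_dil (i : cm_idx D) (j : lb_idx E) (t : R) p : total_dom i j p -> 0 < t ->
  h (total_inv i j (dil t p)) = t ^+ 2 * h (total_inv i j p).
Proof.
move=> tp t0; rewrite !h_total//; last exact: total_dom_dil.
rewrite wpart_dil zpart_dil.
by case: (zpart p) => x y /=; ring.
Qed.

(** If f is nonzero somewhere, the maximum of g is positive, so f is nonzero at the maximum point
    and log f^2 is available there. *)
Lemma pluriharmonic_weight_eq0 k (f : E -> R) : (0 < k)%N ->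
  (forall i j, smooth (total_dom i j) (fun q => f (total_inv i j q))) ->
  (forall i j, scales (total_dom i j) k (fun q => f (total_inv i j q))) ->
  (forall i j p, total_dom i j p -> ddbarR (fun q => f (total_inv i j q)) p = 0) ->
  forall e, off_zero e -> f e = 0.
Proof.
move=> k0 sf Sf hf e1 e10; apply/eqP/negPn/negP => f1.
pose g (e : E) := f e ^+ 2 * (h e)^-1 ^+ k.
have [||e0 e00 gmax] := @scale_invariant_max R d D E D_compact g e1 e10.
- move=> i j p tp; have oT := @total_dom_open _ _ _ E i j.
  have s : smooth (total_dom i j) (fun q => g (total_inv i j q)).
    apply: smoothM => //; apply: smoothX => //.
    exact: smooth_pot.
  exact: smooth_cont s tp.
- move=> i j p t tp t0; have := Sf i j t p t0 tp; rewrite /g /= => ->.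
  rewrite h_dil// invfM !exprMn -exprM mulnC mulrACA.
  by rewrite [(t ^+ 2)^-1 ^+ k]exprVn -exprM mulfV ?mul1r// expf_neq0// gt_eqF.
have [i ei] := cm_cover (lb_proj e0); have [j ej] := lb_cover E (lb_proj e0).
pose p := coords i j e0.
have tp : total_dom i j p by exact: coords_dom.
have pE : total_inv i j p = e0 by exact: coordsK.
have hpos e : off_zero e -> 0 < h e.
  move=> ee; have [i' ei'] := cm_cover (lb_proj e).
  have [j' ej'] := lb_cover E (lb_proj e).
  by have := h_total_gt0 h (coords_dom ee ei' ej'); rewrite coordsK.
have g1 : 0 < g e1.
  apply: mulr_gt0; first by rewrite exprn_even_gt0 ?f1.
  by apply: exprn_gt0; rewrite invr_gt0; exact: hpos.
have f0 : f (total_inv i j p) != 0.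
  apply/negP => /eqP; rewrite pE => fe; have := lt_le_trans g1 (gmax e1 e10).
  by rewrite /g fe expr0n mul0r ltxx.
apply: (pluriharmonic_no_max k0 tp (sf i j) (Sf i j) (hf i j p tp) f0).
move=> q tq; rewrite /pot pE; exact: gmax (total_inv_off_zero tq).
Qed.

End Vanishing.

(** * Uniqueness *)

Section Uniqueness.
Variables (R : realType) (d : nat) (D : complexManifold R d) (E : lineBundle D).
Variable h : hermitianMetric E.
Hypotheses (d_gt0 : (0 < d)%N) (D_compact : compact [set: D]).
Hypothesis h_kahler : kahler_curvature h.

Lemma soliton_expansion_chart (v : nat -> E -> R) k i j : soliton_expansion h v ->
  (0 < k)%N -> smooth (total_dom i j) (in_chart v i j k) /\
               scales (total_dom i j) k (in_chart v i j k).
Proof.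
move=> [sv wv _] k0; split; first exact: sv.
apply: lieF_scales (sv k k0 i j) (wv k k0 i j); first exact: total_dom_open.
by move=> t q; exact: total_dom_dil.
Qed.

(** T_k is the same for u and v because it only reads terms below k, and 1 + k/2 can be cancelled.
    Agreement off the zero section is enough, since charts of E' only reach such points. *)
Lemma soliton_expansion_ddbar (u v : nat -> E -> R) k i j p :
  soliton_expansion h u -> soliton_expansion h v -> (0 < k)%N -> total_dom i j p ->
  (forall l e, (0 < l)%N -> (l < k)%N -> off_zero e -> u l e = v l e) ->
  ddbarR (in_chart u i j k) p = ddbarR (in_chart v i j k) p.
Proof.
move=> Hu Hv k0 tp uv; have oT := @total_dom_open _ _ _ E i j.
have [_ _ su] := Hu; have [_ _ sv] := Hv.
have eu := (formal_solitonP h_kahler tp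
  (fun l => @soliton_expansion_chart u l i j Hu)).1 (su i j p tp) k k0.
have ev := (formal_solitonP h_kahler tp
  (fun l => @soliton_expansion_chart v l i j Hv)).1 (sv i j p tp) k k0.
have T q : total_dom i j q ->
    trlog_comp (pert_comp (pot h i j) (in_chart u i j) q) k =
    trlog_comp (pert_comp (pot h i j) (in_chart v i j) q) k.
  move=> tq; apply: eq_trlog_pert => l l0 lk.
  apply: (ddbarR_eq oT tq) => r tr; apply: uv => //.
    by apply: leq_trans lk; rewrite addn2.
  exact: total_inv_off_zero.
have c0 : (1 + k%:R / 2 : R[i]) != 0.
  have -> : (1 + k%:R / 2 : R[i]) = (1 + k%:R / 2)%:C.
    by rewrite rmorphD rmorph1 rmorphM rmorph_nat fmorphV rmorph_nat.
  by rewrite complexR_eqE gt_eqF// ltr_pwDl// divr_ge0.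
apply: (scalerI c0).
by apply: etrans (esym eu) _; apply: etrans (ddbar_eq oT tp T) _; exact: ev.
Qed.

Lemma soliton_expansion_unique (u v : nat -> E -> R) k e :
  soliton_expansion h u -> soliton_expansion h v -> (0 < k)%N -> off_zero e ->
  v k e = u k e.
Proof.
move=> Hu Hv; elim/ltn_ind: k e => k IH e k0 e0.
(* The difference is written with a factor -1 so that additivity and homogeneity of [ddbarR] apply
   as they stand. *)
apply/eqP; rewrite -subr_eq0 -mulN1r; apply/eqP.
apply: (@pluriharmonic_weight_eq0 R d D E h d_gt0 D_compact h_kahler k
  (fun e => v k e + -1 * u k e)) => // [i j|i j|i j p tp];
  have oT := @total_dom_open _ _ _ E i j;
  have [su Su] := soliton_expansion_chart i j Hu k0;
  have [sv Sv] := soliton_expansion_chart i j Hv k0.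
- apply: smoothD => //; apply: smoothM => //; exact: smooth_cst.
- move=> t q t0 tq; have := Su t q t0 tq; have := Sv t q t0 tq.
  by rewrite /in_chart => -> ->; ring.
have sNu : smooth (total_dom i j) (fun q => -1 * in_chart u i j k q).
  by apply: smoothM => //; exact: smooth_cst.
apply: etrans (ddbarRD oT sv sNu tp) _.
apply: etrans (congr1 (fun M => _ + M) (ddbarRZ oT (-1) su tp)) _.
apply: etrans (congr1 (fun M => M + _) (soliton_expansion_ddbar Hv Hu k0 tp _)) _.
  by move=> l e' l0 lk; exact: IH.
move: (ddbarR _ p) => M.
by rewrite rmorphN1 scaleN1r subrr.
Qed.

End Uniqueness.

Theorem proposition5p40 (R : realType) (d : nat) (d_gt0 : (0 < d)%N)
    (D : complexManifold R d) (D_compact : compact [set: D])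
    (E : lineBundle D) (E_ample : ample E)
    (h : hermitianMetric E) (h_kahler : kahler_curvature h) :
  exists u : nat -> E -> R,
    soliton_expansion h u /\
    forall v : nat -> E -> R, soliton_expansion h v ->
      forall k e, (0 < k)%N -> off_zero e -> v k e = u k e.
Proof.
have Hu := expansion_soliton h_kahler.
exists (expansion h); split=> // v Hv k e k0 e0.
exact: (soliton_expansion_unique d_gt0 D_compact h_kahler Hu Hv).
Qed.
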